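(* If $G$ is LERF, of deficiency $1$ and has a finite index subgroup with first Betti number at least $2$, then $G$ is large or $G$ is isomorphic to $\mathbb{Z}\times\mathbb{Z}$ or to the Klein bottle group.
   Context: The deficiency of a finite presentation is the number of generators minus the number of relators; a group of deficiency $1$ is a group having a finite presentation of deficiency $1$. A group is LERF (locally extended residually finite, or subgroup separable) if every finitely generated subgroup is an intersection of finite index subgroups. The first Betti number of a finitely generated group is the torsion-free rank of its abelianisation. A finitely generated group is large if it has a finite index subgroup possessing a homomorphism onto a non-abelian free group. The Klein bottle group is $BS(1,-1)=\langle a,t\mid tat^{-1}=a^{-1}\rangle$. *)

(* Defs.v *)
From HB Require Import structures.
From mathcomp Require Import all_boot all_order all_algebra.
From mathcomp Require Import boolp classical_sets cardinality.

Set Implicit Arguments.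
Unset Strict Implicit.
Unset Printing Implicit Defensive.

Local Open Scope group_scope.
Local Open Scope quotient_scope.
Local Open Scope classical_set_scope.

Definition isomorphic (G K : groupType) : Prop :=
  exists f : {multiplicative G -> K}, bijective f.

Definition abelian_group (G : groupType) : Prop := forall x y : G, commute x y.

Record subgroup (G : groupType) := Subgroup {
  subgroup_set :> set G;
  subgroup1 : subgroup_set 1;
  subgroupM : forall x y, subgroup_set x -> subgroup_set y ->
    subgroup_set (x * y);
  subgroupV : forall x, subgroup_set x -> subgroup_set x^-1 }.

Record group_of (G : groupType) (H : subgroup G) := GroupOf {
  group_val : G;
  _ : group_val \in (H : set G) }.

Section GroupOf.
Variables (G : groupType) (H : subgroup G).

HB.instance Definition _ := [isSub for @group_val G H].
HB.instance Definition _ := [Choice of group_of H by <:].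

Lemma group_of_closed : group_closed (mem (H : set G)).
Proof.
split; first exact/mem_set/subgroup1.
move=> x y /set_mem Hx /set_mem Hy; apply/mem_set.
by apply: subgroupM => //; exact: subgroupV.
Qed.

HB.instance Definition _ :=
  SubChoice_isSubGroup.Build G _ (group_of H) group_of_closed.

End GroupOf.

Section Generated.
Variables (G : groupType) (A : set G).

Definition generated_set : set G :=
  \bigcap_(K in [set K : subgroup G | A `<=` K]) (K : set G).

Lemma generated1 : generated_set 1.
Proof. by move=> K _; exact: subgroup1. Qed.

Lemma generatedM x y :
  generated_set x -> generated_set y -> generated_set (x * y).
Proof. by move=> hx hy K AK; apply: subgroupM; [exact: hx | exact: hy]. Qed.

Lemma generatedV x : generated_set x -> generated_set x^-1.
Proof. by move=> hx K AK; apply: subgroupV; exact: hx. Qed.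

Definition generated : subgroup G :=
  Subgroup generated1 generatedM generatedV.

End Generated.

Definition finitely_generated_subgroup (G : groupType) (H : subgroup G) :
    Prop :=
  exists2 A : set G, finite_set A & (H : set G) = generated A.

Definition left_coset (G : groupType) (H : subgroup G) (g : G) : set G :=
  [set g * h | h in (H : set G)].

Definition finite_index (G : groupType) (H : subgroup G) : Prop :=
  finite_set (range (left_coset H)).

Definition LERF (G : groupType) : Prop :=
  forall H : subgroup G, finitely_generated_subgroup H ->
  exists2 F : set (subgroup G), (forall K, F K -> finite_index K) &
    (H : set G) = \bigcap_(K in F) (K : set G).

Record normal_subgroup (G : groupType) := NormalSubgroup {
  normal_subgroup_sub :> subgroup G;
  normal_subgroupJ : forall x g,
    subgroup_set normal_subgroup_sub x ->
    subgroup_set normal_subgroup_sub (x ^ g) }.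

Section Quotient.
Variables (G : groupType) (N : normal_subgroup G).

Definition coset_eq : rel G := fun x y => `[< subgroup_set N (x^-1 * y) >].

Lemma coset_eq_refl : reflexive coset_eq.
Proof. by move=> x; apply/asboolP; rewrite mulVg; exact: subgroup1. Qed.

Lemma coset_eq_sym : symmetric coset_eq.
Proof.
suff h x y : coset_eq x y -> coset_eq y x.
  by move=> x y; apply/idP/idP; exact: h.
by move=> /asboolP/subgroupV; rewrite invgM invgK => Nyx; exact/asboolP.
Qed.

Lemma coset_eq_trans : transitive coset_eq.
Proof.
move=> y x z /asboolP Nxy /asboolP Nyz; apply/asboolP.
by have := subgroupM Nxy Nyz; rewrite mulgA mulgK.
Qed.

Canonical coset_equiv :=
  EquivRel coset_eq coset_eq_refl coset_eq_sym coset_eq_trans.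

Definition quotient : Type := {eq_quot coset_equiv}.

HB.instance Definition _ := Choice.on quotient.
HB.instance Definition _ := Quotient.on quotient.
HB.instance Definition _ := EqQuotient.on quotient.

Definition quotient_mul (a b : quotient) : quotient :=
  \pi_quotient (repr a * repr b).
Definition quotient_one : quotient := \pi_quotient 1.
Definition quotient_inv (a : quotient) : quotient := \pi_quotient (repr a)^-1.

Lemma quotient_eqP (x y : G) :
  subgroup_set N (x^-1 * y) <-> \pi_quotient x = \pi_quotient y :> quotient.
Proof.
split; first by move=> Nxy; apply/eqmodP; exact/asboolP.
by move/eqmodP/asboolP.
Qed.

Lemma quotient_piM (x y : G) :
  \pi_quotient (x * y) = quotient_mul (\pi_quotient x) (\pi_quotient y).
Proof.
apply/quotient_eqP.
set x' := repr _; set y' := repr _.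
have Nx : subgroup_set N (x^-1 * x') by apply/quotient_eqP; rewrite reprK.
have Ny : subgroup_set N (y^-1 * y') by apply/quotient_eqP; rewrite reprK.
have -> : (x * y)^-1 * (x' * y') = ((x^-1 * x') ^ y) * (y^-1 * y').
  by rewrite /conjg invgM !mulgA mulgK.
by apply: subgroupM => //; exact: normal_subgroupJ.
Qed.

Lemma quotient_piV (x : G) :
  \pi_quotient x^-1 = quotient_inv (\pi_quotient x).
Proof.
apply/quotient_eqP; set x' := repr _.
have Nx : subgroup_set N (x'^-1 * x) by apply/quotient_eqP; rewrite reprK.
have := normal_subgroupJ x'^-1 Nx.
by rewrite /conjg !invgK !mulgA mulgV mul1g.
Qed.

Lemma quotient_mulA : associative quotient_mul.
Proof.
elim/quotW=> x; elim/quotW=> y; elim/quotW=> z.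
rewrite -(quotient_piM y z) -(quotient_piM x (y * z)) mulgA.
by rewrite (quotient_piM (x * y) z) (quotient_piM x y).
Qed.

Lemma quotient_mul1g : left_id quotient_one quotient_mul.
Proof. by elim/quotW=> x; rewrite -(quotient_piM 1 x) mul1g. Qed.

Lemma quotient_mulg1 : right_id quotient_one quotient_mul.
Proof. by elim/quotW=> x; rewrite -(quotient_piM x 1) mulg1. Qed.

Lemma quotient_mulVg : left_inverse quotient_one quotient_inv quotient_mul.
Proof.
by elim/quotW=> x; rewrite -(quotient_piV x) -(quotient_piM x^-1 x) mulVg.
Qed.

Lemma quotient_mulgV : right_inverse quotient_one quotient_inv quotient_mul.
Proof.
by elim/quotW=> x; rewrite -(quotient_piV x) -(quotient_piM x x^-1) mulgV.
Qed.

HB.instance Definition _ := isGroup.Build quotient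
  quotient_mulA quotient_mul1g quotient_mulg1 quotient_mulVg quotient_mulgV.

End Quotient.

Section NormalClosure.
Variables (G : groupType) (A : set G).

Definition normal_closure_sub : subgroup G :=
  generated [set a ^ g | a in A & g in [set: G]].

Lemma normal_closureJ x g :
  subgroup_set normal_closure_sub x ->
  subgroup_set normal_closure_sub (x ^ g).
Proof.
move=> hx K AK.
pose Kg : set G := [set y | subgroup_set K (y ^ g)].
have K1 : Kg 1 by rewrite /Kg /= conj1g; exact: subgroup1.
have KM y z : Kg y -> Kg z -> Kg (y * z).
  by rewrite /Kg /= conjMg; exact: subgroupM.
have KV y : Kg y -> Kg y^-1 by rewrite /Kg /= conjVg; exact: subgroupV.
apply: (hx (Subgroup K1 KM KV)) => _ [a Aa [h _ <-]] /=.
by rewrite /Kg /= -conjgM; apply: AK; exists a => //; exists (h * g).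
Qed.

Definition normal_closure : normal_subgroup G :=
  NormalSubgroup normal_closureJ.

End NormalClosure.

Section Derived.
Variable G : groupType.

Definition derived_sub : subgroup G :=
  generated [set [~ x, y] | x in [set: G] & y in [set: G]].

Lemma derivedJ x g :
  subgroup_set derived_sub x -> subgroup_set derived_sub (x ^ g).
Proof.
move=> hx; rewrite -[x ^ g](mulKg x^-1) invgK -commgEl.
apply: subgroupM => // K AK.
by apply: AK; exists x => //; exists g.
Qed.

Definition derived : normal_subgroup G := NormalSubgroup derivedJ.

End Derived.

Definition abelianization (G : groupType) : groupType := quotient (derived G).

Definition expgz (G : groupType) (x : G) (a : int) : G :=
  match a with Posz n => x ^+ n | Negz n => x ^- n.+1 end.

(* Meant for abelian [A], written multiplicatively. *)
Definition Z_independent (A : groupType) (r : nat) (x : 'I_r -> A) : Prop :=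
  forall a : 'I_r -> int,
    \prod_(i < r) expgz (x i) (a i) = 1 -> forall i, a i = 0%R.

(* A relation, since no [r] satisfies it when the rank is infinite. *)
Definition torsion_free_rank (A : groupType) (r : nat) : Prop :=
  (exists x : 'I_r -> A, Z_independent x) /\
  (forall (s : nat) (x : 'I_s -> A), Z_independent x -> (s <= r)%N).

Definition first_betti (G : groupType) (b : nat) : Prop :=
  torsion_free_rank (abelianization G) b.

(* The free group on [X] consists of the reduced words in the letters [(x, e)],
   where [(x, false)] stands for [x] and [(x, true)] for its inverse. *)
Section FreeGroup.
Variable X : choiceType.

Definition letter : choiceType := (X * bool)%type.
Implicit Types (a : letter) (u v w : seq letter).

Definition letter_inv a : letter := (a.1, ~~ a.2).

Definition reduced : pred (seq letter) := sorted (fun a b => b != letter_inv a).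

Record free_group := FreeWord { word : seq letter; _ : reduced word }.

HB.instance Definition _ := [isSub for word].
HB.instance Definition _ := [Choice of free_group by <:].

(* Left multiplication of a reduced word by a letter, then by a word. *)
Definition push a w : seq letter :=
  if w is b :: w' then if b == letter_inv a then w' else a :: w else [:: a].

Definition act u w : seq letter := foldr push w u.

Lemma letter_invK : involutive letter_inv.
Proof. by case=> x e; rewrite /letter_inv /= negbK. Qed.

Lemma push_reduced a w : reduced w -> reduced (push a w).
Proof.
case: w => [|b w] //= rw; case: ifPn => [_|ne]; last by rewrite /= ne.
exact: path_sorted rw.
Qed.

Lemma act_reduced u w : reduced w -> reduced (act u w).
Proof. by elim: u => //= a u IH rw; exact/push_reduced/IH. Qed.

Lemma pushK a w : reduced w -> push a (push (letter_inv a) w) = w.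
Proof.
case: w => [|b w] /= rw; first by rewrite eqxx.
rewrite letter_invK; case: eqP => [ba|_] /=; last by rewrite eqxx.
by case: w rw => [|c w] /=; rewrite ba // => /andP[/negPf-> _].
Qed.

Lemma pushVK a w : reduced w -> push (letter_inv a) (push a w) = w.
Proof. by rewrite -{2}[a]letter_invK; exact: pushK. Qed.

Lemma act_push a u w : reduced u -> reduced w ->
  act (push a u) w = push a (act u w).
Proof.
case: u => [|b u] //= ru rw; case: eqP => //= ->.
by rewrite pushK //; exact: act_reduced.
Qed.

Lemma act_act u v w : reduced v -> reduced w ->
  act (act u v) w = act u (act v w).
Proof.
by elim: u => //= a u IH rv rw; rewrite act_push ?IH //; exact: act_reduced.
Qed.

Lemma act_nil w : reduced w -> act w [::] = w.
Proof.
elim: w => //= a w IH rw; rewrite IH; last exact: path_sorted rw.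
by case: w rw {IH} => //= b w /andP[/negPf-> _].
Qed.

Definition word_inv u : seq letter := rev (map letter_inv u).

Lemma word_inv_reduced u : reduced u -> reduced (word_inv u).
Proof.
rewrite /word_inv /reduced rev_sorted sorted_map.
apply: sub_sorted => a b /=; apply: contra => /eqP.
by rewrite letter_invK => ->.
Qed.

Lemma word_invK : involutive word_inv.
Proof.
by move=> u; rewrite /word_inv map_rev revK -map_comp map_id_in // => a _;
  exact: letter_invK.
Qed.

Lemma act_word_inv u w : reduced w -> act (word_inv u) (act u w) = w.
Proof.
elim: u w => //= a u IH w rw.
rewrite /word_inv /= rev_cons /act foldr_rcons -/(act _ _) pushVK; last first.
  exact: act_reduced.
exact: IH.
Qed.

Implicit Types x y z : free_group.

Definition fg_mul x y : free_group :=
  Sub (act (word x) (word y)) (act_reduced (word x) (valP y)).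
Definition fg_one : free_group := Sub [::] isT.
Definition fg_inv x : free_group :=
  Sub (word_inv (word x)) (word_inv_reduced (valP x)).

Lemma fg_mulA : associative fg_mul.
Proof.
move=> x y z; apply: val_inj; rewrite !SubK act_act //; exact: valP.
Qed.

Lemma fg_mul1g : left_id fg_one fg_mul.
Proof. by move=> x; apply: val_inj; rewrite !SubK. Qed.

Lemma fg_mulg1 : right_id fg_one fg_mul.
Proof. by move=> x; apply: val_inj; rewrite !SubK act_nil //; exact: valP. Qed.

Lemma fg_mulVg : left_inverse fg_one fg_inv fg_mul.
Proof.
move=> x; apply: val_inj; rewrite !SubK -{2}(act_nil (valP x)).
exact: act_word_inv.
Qed.

Lemma fg_mulgV : right_inverse fg_one fg_inv fg_mul.
Proof.
move=> x; rewrite -{1}[x](_ : fg_inv (fg_inv x) = x) ?fg_mulVg //.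
by apply: val_inj; rewrite !SubK word_invK.
Qed.

HB.instance Definition _ := isGroup.Build free_group
  fg_mulA fg_mul1g fg_mulg1 fg_mulVg fg_mulgV.

Definition free_gen (s : X) : free_group := Sub [:: (s, false)] isT.

End FreeGroup.

(* The homomorphism extending [f] in the universal property of free groups. *)
Definition letter_eval (X : choiceType) (G : groupType) (f : X -> G)
  (a : letter X) : G := if a.2 then (f a.1)^-1 else f a.1.

Definition free_eval (X : choiceType) (G : groupType) (f : X -> G)
  (w : free_group X) : G := \prod_(a <- word w) letter_eval f a.

Section FreeEval.
Variables (X : choiceType) (G : groupType) (f : X -> G).

Lemma free_eval_gen s : free_eval f (free_gen s) = f s.
Proof. by rewrite /free_eval SubK big_seq1. Qed.

Lemma free_evalM : {morph free_eval f : x y / x * y}.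
Proof.
pose ev (w : seq (letter X)) := \prod_(a <- w) letter_eval f a.
have evP a w : ev (push a w) = letter_eval f a * ev w.
  rewrite /ev /push; case: w => [|b w]; first by rewrite big_seq1 big_nil mulg1.
  case: eqP => [->|_]; last by rewrite big_cons.
  rewrite big_cons mulgA; case: a => s [] /=; rewrite /letter_eval /=.
    by rewrite mulVg mul1g.
  by rewrite mulgV mul1g.
move=> x y; rewrite /free_eval SubK -/(ev _) -/(ev (word x)) -/(ev (word y)).
elim: (word x) => [|a u IH] /=; first by rewrite /ev big_nil mul1g.
by rewrite evP IH /ev big_cons mulgA.
Qed.

HB.instance Definition _ :=
  isMultiplicative.Build (free_group X) G (free_eval f) free_evalM.

End FreeEval.

Lemma free_eval_unique (X : choiceType) (G : groupType)
    (f g : {multiplicative free_group X -> G}) :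
  (forall s, f (free_gen s) = g (free_gen s)) -> f =1 g.
Proof.
move=> fg; have hom1 (h : {multiplicative free_group X -> G}) : h 1 = 1.
  by apply: (mulgI (h 1)); rewrite -gmulfM !mulg1.
have homV (h : {multiplicative free_group X -> G}) x : h x^-1 = (h x)^-1.
  by apply/esym/mulg1_eq; rewrite -gmulfM mulgV hom1.
case=> w rw; elim: w rw => [|[s e] w IH] rw.
  have -> : FreeWord rw = 1 :> free_group X by exact: val_inj.
  by rewrite !hom1.
have rw' : reduced w := path_sorted rw.
have -> : FreeWord rw =
    (if e then (free_gen s)^-1 else free_gen s) * FreeWord rw' :> free_group X.
  apply: val_inj; case: e rw => /= rw;
    by case: w rw {IH rw'} => //= b w /andP[/negPf-> _].
by rewrite !gmulfM IH; case: e {rw}; rewrite ?homV fg.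
Qed.

(* A list: relators are counted with repetition in the deficiency. *)
Record finite_presentation := FinitePresentation {
  ngens : nat;
  relators : seq (free_group 'I_ngens) }.

Definition presented_group (P : finite_presentation) : groupType :=
  quotient (normal_closure [set` relators P]).

Definition deficiency (P : finite_presentation) : int :=
  ((ngens P)%:Z - (size (relators P))%:Z)%R.

Definition has_deficiency (G : groupType) (d : int) : Prop :=
  exists2 P : finite_presentation,
    isomorphic G (presented_group P) & deficiency P = d.

Definition large (G : groupType) : Prop :=
  exists2 H : subgroup G, finite_index H &
  exists2 X : choiceType, ~ abelian_group (free_group X) &
  exists f : {multiplicative group_of H -> free_group X},
    forall y, exists x, f x = y.

Definition ZxZ : groupType :=
  (Algebra.to_multiplicative int * Algebra.to_multiplicative int)%type.

Definition klein_bottle_presentation : finite_presentation :=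
  let a : free_group 'I_2 := free_gen ord0 in
  let t : free_group 'I_2 := free_gen ord_max in
  FinitePresentation [:: (t * a * t^-1) / a^-1].

Definition klein_bottle_group : groupType :=
  presented_group klein_bottle_presentation.

(* Main.v *)
From HB Require Import structures.
From mathcomp Require Import all_boot all_order all_algebra all_fingroup.
From mathcomp Require Import boolp classical_sets cardinality cyclic zify ring.
Require Import Defs.

Set Implicit Arguments.
Unset Strict Implicit.
Unset Printing Implicit Defensive.

Local Open Scope group_scope.
Local Open Scope quotient_scope.
Local Open Scope classical_set_scope.

(** Suppose that [G] is not large. Being LERF, having a presentation with more
    generators than relators ([deficient]) and not being large all pass to subgroups
    of finite index, the second one by Reidemeister-Schreier rewriting
    ([deficient_sub]). A group with these three properties is called [tame].

    Let [chi] be a nonzero homomorphism from a tame group to [Z]. Its kernel is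
    finitely generated ([finitely_generated_kernel]). The group is an HNN extension
    whose stable letter [t] is sent by [chi] to a generator of the image, with a base
    and associated subgroups that are finitely generated. If one associated subgroup
    is the whole base, then LERF makes [t] normalise it, since a subgroup and its
    conjugate have images of the same order in a finite quotient. If both are proper,
    a finite quotient separates one of them from the base. Its kernel maps onto the
    fundamental group of a finite graph with at least twice as many edges as
    vertices, a free group of rank at least [2], and the group is large.

    Let [chi1] and [chi2] be independent homomorphisms from a tame group to [Z]. Then
    no nontrivial element is killed by both ([kernel_injective]). Otherwise residual
    finiteness gives a finite index subgroup with a homomorphism to a field [k] of
    prime order which is nonzero on some element of the common kernel. On that
    subgroup consider the Alexander module over [k[s^+-1, t^+-1]], presented by the
    Fox derivatives of the relators, where a group element acts by the monomial with
    exponents [chi1] and [chi2]. For each [(p, q)] the kernel of [p chi1 + q chi2] is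
    finitely generated, and Cayley-Hamilton yields an annihilator of the classes of
    the common kernel whose Newton polygon has a vertex in the direction [(p, q)]
    ([vertex_annihilator]). An ideal with vertices in all directions contains a
    polynomial in [t] alone ([ideal_meets_constants]), and it also contains one that
    is monic in [s] up to a power of [t]. The relators number less than the
    generators and their Fox derivatives are linearly independent, so that a class
    killed by two such coprime polynomials is zero. Evaluation at [s = t = 1] turns
    this into the vanishing of every homomorphism to [k] on the common kernel
    ([fox_kernel_zhom]).

    A finite index subgroup of first Betti number at least [2] has two independent
    homomorphisms to [Z] ([two_zhoms]), hence embeds in [Z^2]. The centraliser [D] of
    its normal core inherits such a pair by transfer, so [D] is a normal, abelian and
    self-centralising subgroup of finite index ([abelian_normal_finite_index]). With
    [chi] from [G] onto [Z], which exists because [G] is deficient, the kernel of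
    [chi] on [D] is infinite cyclic and [G] acts on it by signs. This leaves [Z^2],
    the Klein bottle group, and a group with a finite index subgroup that is the
    product of [Z] and the infinite dihedral group
    ([isomorphic_ZxZ_or_klein]); the last one is not deficient
    ([no_dihedral_by_Z]), as unipotent representations over the field of two elements
    show ([unipotent_lift]). *)

(** * Homomorphisms, subgroups and finite index *)

Notation "x 'isin' H" := (subgroup_set H x) (at level 70, no associativity).

Definition multiplicative_of (G K : groupType) (f : G -> K)
    (fM : {morph f : x y / x * y}) : {multiplicative G -> K} :=
  HB.pack_for (Multiplicative.type G K) f (isMultiplicative.Build G K f fM).

Lemma multM (G K : groupType) (f : {multiplicative G -> K}) :
  {morph f : x y / x * y}.
Proof. by move=> x y; rewrite gmulfM. Qed.

Section Morph.
Variables (G K : groupType) (f : G -> K).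
Hypothesis fM : {morph f : x y / x * y}.

Lemma morph1g : f 1 = 1.
Proof. by apply: (mulgI (f 1)); rewrite -fM !mulg1. Qed.

Lemma morphVg : {morph f : x / x^-1}.
Proof. by move=> x; apply/esym/mulg1_eq; rewrite -fM mulgV morph1g. Qed.

Lemma morphXg n : {morph f : x / x ^+ n}.
Proof.
by move=> x; elim: n => [|n IH]; rewrite ?expg0 ?morph1g // !expgS fM IH.
Qed.

Lemma morphJg : {morph f : x y / x ^ y}.
Proof. by move=> x y; rewrite /conjg !fM morphVg. Qed.

Lemma morphg_inj : (forall x, f x = 1 -> x = 1) -> injective f.
Proof.
by move=> f1 x y fxy; apply/divg1_eq/f1; rewrite fM morphVg fxy mulgV.
Qed.

End Morph.

Definition zhom (G : groupType) (V : zmodType) (f : G -> V) :=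
  forall x y, f (x * y) = (f x + f y)%R.

Section Zhom.
Variables (G : groupType) (V : zmodType) (f : G -> V).
Hypothesis fM : zhom f.

Lemma zhom1 : f 1 = 0%R.
Proof. by apply: (@GRing.addrI _ (f 1)); rewrite -fM mulg1 GRing.addr0. Qed.

Lemma zhomV x : f x^-1 = (- f x)%R.
Proof.
by apply: (@GRing.addrI _ (f x)); rewrite -fM mulgV zhom1 GRing.subrr.
Qed.

Lemma zhomX x n : f (x ^+ n) = (f x *+ n)%R.
Proof.
elim: n => [|n IH]; first by rewrite expg0 zhom1.
by rewrite expgS fM IH GRing.mulrS.
Qed.

Lemma zhomJ x y : f (x ^ y) = f x.
Proof. by rewrite /conjg !fM zhomV GRing.addrCA GRing.addNr GRing.addr0. Qed.

End Zhom.

Section Subgroup.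
Variables (G : groupType) (H : subgroup G).

Lemma subgroupX x n : x isin H -> x ^+ n isin H.
Proof.
move=> Hx; elim: n => [|n IH]; first exact: subgroup1.
by rewrite expgS; apply: subgroupM.
Qed.

Lemma group_valP (x : group_of H) : val x isin H.
Proof. exact/set_mem/valP. Qed.

Definition to_group_of x (Hx : x isin H) : group_of H := Sub x (mem_set Hx).

Lemma to_group_ofK x (Hx : x isin H) : val (to_group_of Hx) = x.
Proof. exact: SubK. Qed.

End Subgroup.

Section MorphKernel.
Variables (G K : groupType) (f : G -> K).
Hypothesis fM : {morph f : x y / x * y}.

Lemma morph_kernelM x y : f x = 1 -> f y = 1 -> f (x * y) = 1.
Proof. by move=> fx fy; rewrite fM fx fy mulg1. Qed.

Lemma morph_kernelV x : f x = 1 -> f x^-1 = 1.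
Proof. by move=> fx; rewrite (morphVg fM) fx invg1. Qed.

Definition morph_kernel : subgroup G :=
  @Subgroup G [set x | f x = 1] (morph1g fM) morph_kernelM morph_kernelV.

End MorphKernel.

Section ZhomKernel.
Variables (G : groupType) (V : zmodType) (chi : G -> V).
Hypothesis chiM : zhom chi.

Lemma zhom_kernelM g h : chi g = 0%R -> chi h = 0%R -> chi (g * h) = 0%R.
Proof. by move=> g0 h0; rewrite chiM g0 h0 GRing.addr0. Qed.

Lemma zhom_kernelV g : chi g = 0%R -> chi g^-1 = 0%R.
Proof. by move=> g0; rewrite zhomV // g0 GRing.oppr0. Qed.

Definition zhom_kernel : subgroup G :=
  @Subgroup G [set g | chi g = 0%R] (zhom1 chiM) zhom_kernelM zhom_kernelV.

End ZhomKernel.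

Lemma sub_generated (G : groupType) (A : set G) : A `<=` generated A.
Proof. by move=> x Ax K AK; apply: AK. Qed.

Lemma generated_min (G : groupType) (A : set G) (K : subgroup G) :
  A `<=` K -> generated A `<=` K.
Proof. by move=> AK x; apply. Qed.

(** Right cosets, although finite index is defined with left ones: right
    translation of the labels then composes in the order of permutations. *)
Lemma finite_index_label (G : groupType) (H : subgroup G) :
  finite_index H -> exists n (c : G -> 'I_n.+1) (r : 'I_n.+1 -> G),
    cancel r c /\ forall x y, c x = c y <-> x * y^-1 isin H.
Proof.
move=> fH; have [n /card_esym/card_set_bijP [f [ff fi fs]]] := fH.
have coset_eqP x y : left_coset H x = left_coset H y <-> x^-1 * y isin H.
  split=> [e|Hxy].
    have : left_coset H y y by exists 1; rewrite ?mulg1 //; apply: subgroup1.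
    by rewrite -e => -[h Hh <-]; rewrite mulKg.
  apply/seteqP; split=> z [h Hh <-].
    exists (y^-1 * x * h); last by rewrite !mulgA mulgV mul1g.
    by apply: subgroupM => //; rewrite -[y^-1 * x]invgK invgM invgK; apply: subgroupV.
  by exists (x^-1 * y * h); [apply: subgroupM | rewrite !mulgA mulgV mul1g].
have lab x : exists2 i, (i < n)%N & f i = left_coset H x^-1.
  by have [|i] := fs (left_coset H x^-1); [exists x^-1 | exists i].
have {lab} /choice [c cP] : forall x, exists i, (i < n)%N /\ f i = left_coset H x^-1.
  by move=> x; have [i] := lab x; exists i.
have rep (i : nat) : exists x : G, (i < n)%N -> f i = left_coset H x^-1.
  case: (ltnP i n) => [i_n|]; last by exists 1.
  by have [x _ <-] := ff _ i_n; exists x^-1; rewrite invgK.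
have {rep} /choice [r rP] := rep.
case: n f ff fi fs cP rP {fH} => [|n] f ff fi fs cP rP; first by case: (cP 1).
have c1 x : (c x < n.+1)%N by case: (cP x).
have c2 x : f (c x) = left_coset H x^-1 by case: (cP x).
exists n, (fun x => Ordinal (c1 x)), (fun i => r i); split.
  move=> i; apply: val_inj => /=.
  by apply: fi; [exact/mem_set/c1 | apply/mem_set; case: i | rewrite c2 -rP].
move=> x y; rewrite -[x in x * _]invgK -coset_eqP -!c2.
split=> [[->] //|e]; apply: val_inj => /=.
by apply: fi => //; apply/mem_set/c1.
Qed.

Lemma finite_indexI (G : groupType) (H : subgroup G) (T : finType) (c : G -> T) :
  (forall x y, c x = c y -> x^-1 * y isin H) -> finite_index H.
Proof.
move=> cP.
have [F FP] : {F : T -> set G & forall x, F (c x) = left_coset H x}.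
  have /choice [r rP] : forall t, exists x, forall y, c y = t -> c x = t.
    move=> t; case: (pselect (exists y, c y = t)) => [[y yt]|n]; first by exists y.
    by exists 1 => y yt; case: n; exists y.
  exists (fun t => left_coset H (r t)) => x.
  have {cP} /cP Hr := rP (c x) x erefl.
  apply/seteqP; split=> z [h Hh <-].
    exists (x^-1 * r (c x) * h); last by rewrite !mulgA mulgV mul1g.
    by apply: subgroupM => //; rewrite -[_ * _]invgK invgM invgK; apply: subgroupV.
  by exists ((r (c x))^-1 * x * h); [apply: subgroupM | rewrite !mulgA mulgV mul1g].
apply: (@sub_finite_set _ _ (F @` setT)).
  by move=> _ [x _ <-]; exists (c x).
by apply: finite_image; exact: finite_finset.
Qed.

Lemma finite_indexIr (G : groupType) (H : subgroup G) (T : finType) (c : G -> T) :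
  (forall x y, c x = c y -> x * y^-1 isin H) -> finite_index H.
Proof.
move=> cP; apply: (@finite_indexI _ _ _ (fun x => c x^-1)) => x y /cP.
by rewrite invgK.
Qed.

Lemma morph_kernel_finite_index (G : groupType) (T : finGroupType) (f : G -> T)
    (fM : {morph f : x y / x * y}) : finite_index (morph_kernel fM).
Proof.
apply: (finite_indexI (c := f)) => x y fxy.
by rewrite /= fM (morphVg fM) fxy mulVg.
Qed.

Lemma finite_index_perm (G : groupType) (H : subgroup G) : finite_index H ->
  exists n (f : G -> {perm 'I_n.+1}) (i : 'I_n.+1),
    {morph f : x y / x * y} /\ forall g, f g i = i <-> g isin H.
Proof.
move=> /finite_index_label [n [c [r [rK cP]]]].
have cM x y g : c x = c y -> c (x * g) = c (y * g).
  by move/cP => xy; apply/cP; rewrite invgM mulgA mulgK.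
have rc x g : c (r (c x) * g) = c (x * g) by apply: cM; rewrite rK.
have inj g : injective (fun i => c (r i * g)).
  move=> i j /(cM _ _ g^-1).
  by rewrite !mulgK !rK.
pose f g : {perm 'I_n.+1} := perm (inj g).
exists n, f, (c 1); split.
  by move=> x y; apply/permP => i; rewrite permM !permE rc mulgA.
by move=> g; rewrite permE rc mul1g cP invg1 mulg1.
Qed.

Section SubgroupOf.
Variables (G : groupType) (H : subgroup G).

Section Image.
Variable L : subgroup (group_of H).

Definition image_set : set G := [set val x | x in (L : set (group_of H))].

Lemma image_set1 : image_set 1.
Proof. by exists 1; [exact: subgroup1 | exact: val1]. Qed.

Lemma image_setM x y : image_set x -> image_set y -> image_set (x * y).
Proof.
move=> [a La <-] [b Lb <-]; exists (a * b); last exact: valM.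
exact: subgroupM.
Qed.

Lemma image_setV x : image_set x -> image_set x^-1.
Proof.
by move=> [a La <-]; exists a^-1; [exact: subgroupV | exact: (gmulfV (val : group_of H -> G))].
Qed.

Definition image_sub := Subgroup image_set1 image_setM image_setV.

End Image.

Section Preimage.
Variable K : subgroup G.

Definition preimage_set : set (group_of H) := fun x => val x isin K.

Lemma preimage_set1 : preimage_set 1.
Proof. by rewrite /preimage_set val1; exact: subgroup1. Qed.

Lemma preimage_setM x y : preimage_set x -> preimage_set y -> preimage_set (x * y).
Proof. by rewrite /preimage_set valM; exact: subgroupM. Qed.

Lemma preimage_setV x : preimage_set x -> preimage_set x^-1.
Proof. by rewrite /preimage_set (gmulfV (val : group_of H -> G)); exact: subgroupV. Qed.

Definition preimage_sub := Subgroup preimage_set1 preimage_setM preimage_setV.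

Lemma preimage_finite_index : finite_index K -> finite_index preimage_sub.
Proof.
move=> /finite_index_label [n [c [r [rK cP]]]].
apply: (@finite_indexIr _ _ _ (fun x => c (val x))) => x y /cP.
by rewrite /= /preimage_set valM (gmulfV (val : group_of H -> G)).
Qed.

End Preimage.

Lemma image_finite_index (L : subgroup (group_of H)) :
  finite_index H -> finite_index L -> finite_index (image_sub L).
Proof.
move=> /finite_index_label [n [c [r [rK cP]]]].
move=> /finite_index_label [m [d [s [sK dP]]]].
have hP x : x * (r (c x))^-1 isin H by apply/cP; rewrite rK.
apply: (@finite_indexIr _ _ _ (fun x => (c x, d (to_group_of (hP x))))).
move=> x y [cxy /dP Lxy]; eexists; first exact: Lxy.
by rewrite valM (gmulfV (val : group_of H -> G)) !to_group_ofK cxy invgM invgK mulgA mulgVK.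
Qed.

(** A finitely generated subgroup of [H] is one of [G], and the finite index
    subgroups of [G] that cut it out can be intersected with [H]. *)
Lemma LERF_sub : LERF G -> LERF (group_of H).
Proof.
move=> lerfG L [A finA LA].
have [|F Ff FE] := lerfG (image_sub L).
  exists (val @` A); first exact: finite_image.
  apply/seteqP; split=> x.
    move=> [a La <-] /= K AK.
    have : a isin preimage_sub K; last by [].
    move: La; rewrite LA; apply: generated_min => b Ab /=.
    by apply: AK; exists b.
  apply: generated_min => _ [a Aa <-] /=; exists a => //.
  by rewrite LA; apply: sub_generated.
exists [set preimage_sub K | K in F].
  by move=> _ [K /Ff Kf <-]; apply: preimage_finite_index.
apply/seteqP; split=> x.
  move=> Lx _ [K FK <-] /=.
  have : (image_sub L : set G) (val x) by exists x.
  by rewrite FE; apply.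
move=> xK; have : (image_sub L : set G) (val x).
  by rewrite FE => K FK; apply: (xK (preimage_sub K)); exists K.
by move=> [y Ly /val_inj <-].
Qed.

Lemma large_sub : finite_index H -> large (group_of H) -> large G.
Proof.
move=> Hf [L Lf [X nX [f fs]]].
exists (image_sub L); first exact: image_finite_index.
exists X => //.
have imP (x : group_of (image_sub L)) : val x isin H.
  by have [y _ <-] := group_valP x; exact: group_valP.
have imL x : to_group_of (imP x) isin L.
  have [y Ly yx] := group_valP x.
  by have -> : to_group_of (imP x) = y by apply: val_inj.
pose g x := f (to_group_of (imL x)).
have gM : {morph g : x y / x * y}.
  move=> x y; rewrite /g -gmulfM; congr (f _).
  apply: val_inj; rewrite [RHS]valM [LHS]to_group_ofK !to_group_ofK.
  by apply: val_inj; rewrite [RHS]valM [LHS]to_group_ofK !to_group_ofK valM.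
exists (multiplicative_of gM) => y /=.
have [x <-] := fs y.
have ix : val (val x) isin image_sub L by exists (val x) => //; exact: group_valP.
exists (to_group_of ix); congr (f _).
by apply/val_inj/(etrans (to_group_ofK _))/val_inj/(etrans (to_group_ofK _))/to_group_ofK.
Qed.

End SubgroupOf.

(** The action on the cosets of a finite index subgroup that contains [H] but not
    [x]: the base point is fixed by [H] and moved by [x]. *)
Lemma LERF_separate (G : groupType) (H : subgroup G) (x : G) :
  LERF G -> finitely_generated_subgroup H -> ~ x isin H ->
  exists n (f : G -> {perm 'I_n.+1}) (i : 'I_n.+1),
  [/\ {morph f : x y / x * y}, forall h, h isin H -> f h i = i & f x i <> i].
Proof.
move=> lerfG /lerfG [F Ff FE] Hx.
have [K FK Kx] : exists2 K, F K & ~ x isin K.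
  apply: contrapT => nK; apply: Hx; rewrite FE => K FK.
  by apply: contrapT => Kx; apply: nK; exists K.
have [n [f [i [fM fP]]]] := finite_index_perm (Ff K FK).
exists n, f, i; split=> // [h|/fP//]; rewrite FE => /(_ K FK).
by move/fP.
Qed.

(** * Free groups, crossed homomorphisms and presentations *)

Lemma free_group_ind (X : choiceType) (P : free_group X -> Prop) :
  P 1 -> (forall x w, P w -> P (free_gen x * w)) ->
  (forall x w, P w -> P ((free_gen x)^-1 * w)) -> forall w, P w.
Proof.
move=> P1 Pg PV [w rw]; elim: w rw => [|[s e] w IH] rw.
  by have -> : FreeWord rw = 1 :> free_group X by exact: val_inj.
have rw' : reduced w := path_sorted rw.
have -> : FreeWord rw =
    (if e then (free_gen s)^-1 else free_gen s) * FreeWord rw' :> free_group X.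
  apply: val_inj; case: e rw => /= rw;
    by case: w rw {IH rw'} => //= b w /andP[/negPf-> _].
by case: e {rw}; [apply: PV | apply: Pg].
Qed.

Lemma free_eval1 (X : choiceType) (G : groupType) (f : X -> G) : free_eval f 1 = 1.
Proof. by rewrite /free_eval big_nil. Qed.

Lemma free_evalV (X : choiceType) (G : groupType) (f : X -> G) w :
  free_eval f w^-1 = (free_eval f w)^-1.
Proof. by apply/esym/mulg1_eq; rewrite -free_evalM mulgV free_eval1. Qed.

Section Cocycle.
Variables (X : choiceType) (H : groupType) (y : X -> H) (C : Type).
Variable act : C -> H -> C.
Hypothesis act1 : forall c, act c 1 = c.
Hypothesis actM : forall c g h, act c (g * h) = act (act c g) h.
Variables (P : groupType) (s : C -> X -> P).

Definition letter_act c (a : letter X) := act c (letter_eval y a).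

Definition letter_cocycle c (a : letter X) : P :=
  if a.2 then (s (letter_act c a) a.1)^-1 else s c a.1.

Fixpoint word_cocycle c (w : seq (letter X)) : P :=
  if w is a :: w' then letter_cocycle c a * word_cocycle (letter_act c a) w'
  else 1.

(** A crossed homomorphism of the free group, for the right action of [H] on [C]:
    the product of the labels [s] read along the path that [w] traces from [c]. With
    the cosets of a subgroup for [C] it is Reidemeister-Schreier rewriting. *)
Definition cocycle c (w : free_group X) := word_cocycle c (word w).

Lemma letter_actK c a : letter_act (letter_act c a) (letter_inv a) = c.
Proof.
rewrite /letter_act -actM /letter_eval /=.
by case: a.2; rewrite /= ?mulVg ?mulgV act1.
Qed.

Lemma word_cocycle_push c a w :
  word_cocycle c (push a w) = letter_cocycle c a * word_cocycle (letter_act c a) w.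
Proof.
case: w => [|b w] //=; case: eqP => [->|//].
rewrite letter_actK mulgA.
suff -> : letter_cocycle (letter_act c a) (letter_inv a) = (letter_cocycle c a)^-1.
  by rewrite mulgV mul1g.
rewrite /letter_cocycle letter_actK.
by case: a => x []; rewrite /= ?invgK.
Qed.

Lemma cocycle1 c : cocycle c 1 = 1.
Proof. by []. Qed.

Lemma cocycle_gen c x : cocycle c (free_gen x) = s c x.
Proof. by rewrite /cocycle /= mulg1. Qed.

Lemma cocycleM c v w :
  cocycle c (v * w) = cocycle c v * cocycle (act c (free_eval y v)) w.
Proof.
rewrite /cocycle /free_eval [word (v * w)]/=; move: (word w) => {}w.
elim: (word v) c => [|a u IH] c /=; first by rewrite big_nil act1 mul1g.
by rewrite word_cocycle_push IH big_cons actM mulgA.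
Qed.

Lemma cocycleV c w :
  cocycle c w^-1 = (cocycle (act c (free_eval y w)^-1) w)^-1.
Proof.
have e1 := free_eval1 y.
have eV := free_evalV y w.
apply: (@mulIg _ (cocycle (act c (free_eval y w)^-1) w)).
by rewrite mulVg -eV -cocycleM mulVg.
Qed.

Lemma cocycle_unique (f : C -> free_group X -> P) :
  (forall c v w, f c (v * w) = f c v * f (act c (free_eval y v)) w) ->
  (forall c x, f c (free_gen x) = s c x) -> forall c w, f c w = cocycle c w.
Proof.
move=> fM fg c w.
have e1 := free_eval1 y.
have f1 d : f d 1 = 1.
  by apply: (mulgI (f d 1)); have := fM d 1 1; rewrite !mulg1 e1 act1 => <-.
move: w c; apply: free_group_ind => [|x w IH|x w IH] c.
- by rewrite f1.
- by rewrite fM cocycleM fg cocycle_gen IH.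
rewrite fM [RHS]cocycleM IH; congr (_ * _).
rewrite cocycleV cocycle_gen -fg.
have eV := free_evalV y (free_gen x).
apply: (@mulIg _ (f (act c (free_eval y (free_gen x))^-1) (free_gen x))).
by rewrite mulVg -eV -fM mulVg f1.
Qed.

End Cocycle.

Lemma cocycle_map (X : choiceType) (H : groupType) (y : X -> H) (C : Type)
    (act : C -> H -> C) (P P' : groupType) (f : P -> P') s c w :
  {morph f : x y / x * y} ->
  f (cocycle y act s c w) = cocycle y act (fun c x => f (s c x)) c w.
Proof.
move=> fM; rewrite /cocycle; elim: (word w) c => [|a u IH] c /=.
  exact: morph1g.
rewrite fM IH; congr (_ * _); rewrite /letter_cocycle.
by case: a.2; rewrite ?(morphVg fM).
Qed.

(** The last clause says that the kernel is the normal closure of the relators, in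
    the form of an induction principle. *)
Definition presentation (G : groupType) (X : choiceType) (J : Type) (y : X -> G)
    (r : J -> free_group X) :=
  [/\ forall g, exists w, free_eval y w = g,
      forall j, free_eval y (r j) = 1
    & forall N : normal_subgroup (free_group X), (forall j, r j isin N) ->
      forall w, free_eval y w = 1 -> w isin N].

Lemma presentation_ind (G : groupType) (X : choiceType) (J : Type) (y : X -> G)
    (r : J -> free_group X) (R : free_group X -> Prop) :
  presentation y r -> R 1 -> (forall u v, R u -> R v -> R (u * v)) ->
  (forall u, R u -> R u^-1) -> (forall u g, R u -> R (u ^ g)) ->
  (forall j, R (r j)) -> forall w, free_eval y w = 1 -> R w.
Proof.
move=> [_ _ Hmin] R1 RM RV RJ Rr w w1.
exact: (Hmin (@NormalSubgroup _ (@Subgroup _ R R1 RM RV) RJ)).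
Qed.

(** The words that act trivially and have a trivial cocycle from every starting
    point form a normal subgroup, which contains the relators. *)
Lemma cocycle_presentation (X : choiceType) (G : groupType) (y : X -> G) (J : Type)
    (r : J -> free_group X) (C : Type) (act : C -> G -> C) (P : groupType)
    (s : C -> X -> P) :
  (forall c, act c 1 = c) -> (forall c g h, act c (g * h) = act (act c g) h) ->
  presentation y r -> (forall c j, cocycle y act s c (r j) = 1) ->
  forall c v w, free_eval y v = free_eval y w ->
    cocycle y act s c v = cocycle y act s c w.
Proof.
move=> act1 actM pr cr.
have key w : free_eval y w = 1 -> free_eval y w = 1 /\ forall c, cocycle y act s c w = 1.
  move: w; apply: (presentation_ind (R := fun w => _ /\ _) pr).
  - by rewrite free_eval1; split=> // c; exact: cocycle1.
  - move=> u v [u1 cu] [v1 cv]; rewrite free_evalM u1 v1 mulg1; split=> // c.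
    by rewrite cocycleM // u1 act1 cu cv mulg1.
  - move=> u [u1 cu]; rewrite free_evalV u1 invg1; split=> // c.
    by rewrite cocycleV // u1 invg1 act1 cu invg1.
  - move=> u g [u1 cu]; rewrite /conjg !free_evalM u1 mul1g free_evalV mulVg.
    split=> // c; rewrite !cocycleM // cu mul1g u1 act1 -cocycleM // mulVg.
    exact: cocycle1.
  by move=> j; split=> //; have [_ ->] := pr.
move=> c v w vw; have vw1 : free_eval y (v * w^-1) = 1.
  by rewrite free_evalM free_evalV vw mulgV.
have [e1 ce] := key _ vw1.
by rewrite -[v](mulgVK w) cocycleM // ce e1 act1 mul1g.
Qed.

(** Deficiency at least [1], with arbitrary finite types as indices: subgroups of
    finite index are presented on such types. *)
Definition deficient (G : groupType) := exists (X J : finType) (y : X -> G)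
  (r : J -> free_group X), presentation y r /\ (#|J| < #|X|)%N.

Section QuotientMap.
Variables (G : groupType) (N : normal_subgroup G).

Definition quotient_pi (x : G) : quotient N := \pi_(quotient N) x.

Lemma quotient_pi_morph : {morph quotient_pi : x y / x * y}.
Proof. exact: quotient_piM. Qed.

Definition quotient_map := multiplicative_of quotient_pi_morph.

Lemma quotient_map_eq1 x : quotient_map x = 1 <-> x isin N.
Proof.
rewrite -(morph1g quotient_pi_morph) /= /quotient_pi; split.
  move=> /esym/quotient_eqP; by rewrite invg1 mul1g.
by move=> Nx; apply/esym/quotient_eqP; rewrite invg1 mul1g.
Qed.

Lemma morph_with_kernel : exists (K : groupType) (f : G -> K),
  {morph f : x y / x * y} /\ forall x, f x = 1 <-> x isin N.
Proof.
by exists (quotient N), quotient_map; split; [exact: multM | exact: quotient_map_eq1].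
Qed.

Lemma quotient_map_surj a : exists x, quotient_map x = a.
Proof. by elim/quotW: a => x; exists x. Qed.

End QuotientMap.

Lemma bijective_morphV (G K : groupType) (f : G -> K) (g : K -> G) :
  {morph f : x y / x * y} -> cancel f g -> cancel g f -> {morph g : x y / x * y}.
Proof. by move=> fM fK gK x y; rewrite -{1}[x]gK -{1}[y]gK -fM fK. Qed.

Lemma isomorphic_sym (G K : groupType) : isomorphic G K -> isomorphic K G.
Proof.
move=> [f [g fK gK]].
exists (multiplicative_of (bijective_morphV (multM f) fK gK)).
by exists f.
Qed.

Lemma has_deficiency_deficient (G : groupType) : has_deficiency G 1%R -> deficient G.
Proof.
move=> [P [f [g fK gK]] dP].
have gM := bijective_morphV (multM f) fK gK.
pose N : normal_subgroup (free_group 'I_(ngens P)) := normal_closure [set` relators P].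
pose p : {multiplicative _ -> _} := multiplicative_of gM \o quotient_map N.
pose y i := p (free_gen i).
have yE w : free_eval y w = p w.
  by apply: free_eval_unique => i; exact: free_eval_gen y i.
have p1 w : p w = 1 <-> w isin N.
  rewrite -quotient_map_eq1; split=> [pw|/= ->]; last exact: (morph1g gM).
  by rewrite -[quotient_map N w]gK [g _]pw (morph1g (multM f)).
have relN w : w \in relators P -> w isin N.
  by move=> wP; apply: sub_generated; exists w => //; exists 1 => //; rewrite conjg1.
exists 'I_(ngens P), 'I_(size (relators P)), y, (tnth (in_tuple (relators P))).
split; last first.
  rewrite !card_ord; move: dP; rewrite /deficiency => /eqP.
  by rewrite GRing.subr_eq -PoszD => /eqP [e]; rewrite -add1n -e.
split.
- move=> x; have [w wx] := quotient_map_surj (f x); exists w.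
  by rewrite yE [p w](congr1 g wx) fK.
- by move=> j; rewrite yE; apply/p1/relN; exact: mem_tnth.
move=> N' rN' w; rewrite yE => /p1; apply: generated_min.
move=> _ [a Ra [u _ <-]]; apply: normal_subgroupJ.
by have /tnthP [j ->] : a \in in_tuple (relators P) by []; exact: rN'.
Qed.

(** * Presentations of subgroups of finite index *)

Section ReidemeisterSchreier.
Variables (G : groupType) (X : choiceType) (J : Type) (y : X -> G).
Variables (r : J -> free_group X) (K : subgroup G) (n : nat).
Variables (c : G -> 'I_n.+1) (rep : 'I_n.+1 -> G).
Hypothesis repK : cancel rep c.
Hypothesis cP : forall g h, c g = c h <-> g * h^-1 isin K.
Hypothesis pres : presentation y r.

Let i0 := c 1.
Let tau (i : 'I_n.+1) := if i == i0 then 1 else rep i.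
Let act (i : 'I_n.+1) g := c (tau i * g).

Let c_tau i : c (tau i) = i.
Proof. by rewrite /tau; case: eqP => [->|_]. Qed.

Let cM g h k : c g = c h -> c (g * k) = c (h * k).
Proof. by move/cP => gh; apply/cP; rewrite invgM mulgA mulgK. Qed.

Let act_c g h : act (c g) h = c (g * h).
Proof. by apply: cM; rewrite c_tau. Qed.

Let act1 i : act i 1 = i.
Proof. by rewrite /act mulg1 c_tau. Qed.

Let actM i g h : act i (g * h) = act (act i g) h.
Proof. by rewrite [act i g]/act act_c /act mulgA. Qed.

Let gen_in (z : 'I_n.+1 * X) :
  tau z.1 * y z.2 * (tau (act z.1 (y z.2)))^-1 isin K.
Proof. by apply/cP; rewrite c_tau. Qed.

Definition schreier_gen (z : 'I_n.+1 * X) : group_of K := to_group_of (gen_in z).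

Let lift_word g : exists w, free_eval y w = g /\ (g = 1 -> w = 1).
Proof.
have [->|g1] := pselect (g = 1); first by exists 1; rewrite free_eval1.
by have [/(_ g)[w wg] _ _] := pres; exists w.
Qed.

Let wd g : free_group X := projT1 (cid (lift_word g)).

Let wdK g : free_eval y (wd g) = g.
Proof. by case: (projT2 (cid (lift_word g))). Qed.

Let wd1 : wd 1 = 1.
Proof. by case: (projT2 (cid (lift_word 1))) => _; apply. Qed.

Let sigma := cocycle y act (fun (i : 'I_n.+1) (x : X) => free_gen (i, x)).

(** The relators of [G] are rewritten from every coset. The remaining ones make the
    rewritten coset representatives trivial, except that of [K] itself, for which
    this holds already. The representatives are arbitrary: instead of discarding
    the generators on a Schreier tree, each is compensated by a relator. *)
Definition schreier_rel (j : 'I_n.+1 * J + 'I_n) : free_group ('I_n.+1 * X)%type :=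
  match j with
  | inl (i, j) => sigma i (r j)
  | inr k => sigma i0 (wd (rep (lift i0 k)))
  end.

Let sigmaE i w : val (free_eval schreier_gen (sigma i w)) =
  tau i * free_eval y w * (tau (act i (free_eval y w)))^-1.
Proof.
pose f u := val (free_eval schreier_gen u).
have fM : {morph f : u v / u * v} by move=> u v; rewrite /f free_evalM valM.
rewrite -[LHS]/(f (sigma i w)) (cocycle_map y act _ _ _ fM).
apply/esym; move: i w.
apply: cocycle_unique => // [i v w|i x].
  by rewrite free_evalM actM !mulgA mulgVK.
by rewrite /f !free_eval_gen to_group_ofK.
Qed.

Lemma schreier_presentation : presentation schreier_gen schreier_rel.
Proof.
have tau0 : tau i0 = 1 by rewrite /tau eqxx.
have [ysurj yr ymin] := pres; split.
- move=> h; have [w wh] := ysurj (val h); exists (sigma i0 w).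
  apply: val_inj; rewrite sigmaE wh tau0 mul1g act_c mul1g.
  have -> : c (val h) = i0 by apply/cP; rewrite invg1 mulg1; exact: group_valP.
  by rewrite tau0 invg1 mulg1.
- case=> [[i j]|k]; apply: val_inj; rewrite sigmaE ?yr ?act1 ?mulg1 ?mulgV ?val1 //.
  rewrite wdK act_c mul1g repK tau0 mul1g /tau eq_sym (negPf (neq_lift _ _)).
  by rewrite mulgV.
move=> N Nr w.
pose f := quotient_map N.
pose coc := cocycle y act (fun (i : 'I_n.+1) (x : X) => f (free_gen (i, x))).
have cocE i v : coc i v = f (sigma i v) by rewrite (cocycle_map y act _ _ _ (multM f)).
have coc_eval i u v : free_eval y u = free_eval y v -> coc i u = coc i v.
  apply: (cocycle_presentation act1 actM pres) => {}i j.
  by rewrite -/coc cocE; apply/quotient_map_eq1/(Nr (inl (i, j))).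
have coc_tau i : coc i0 (wd (tau i)) = 1.
  rewrite /tau; case: eqP => [_|/eqP ii0]; first by rewrite wd1; exact: cocycle1.
  rewrite cocE; apply/quotient_map_eq1.
  have [k ->|ik] := unliftP i0 i; first exact: (Nr (inr k)).
  by rewrite ik eqxx in ii0.
(* A generator goes back to a word of [G] that represents it, and rewriting this
   word from the base coset recovers the generator modulo the relators. So a word
   that is trivial in [K] becomes one that is trivial in [G], where the rewriting
   is well defined. *)
pose sub (z : 'I_n.+1 * X) :=
  wd (tau z.1) * free_gen z.2 * (wd (tau (act z.1 (y z.2))))^-1.
have subE v : free_eval y (free_eval sub v) = val (free_eval schreier_gen v).
  move: v; apply: (free_eval_unique
    (f := (free_eval y : {multiplicative _ -> _}) \o (free_eval sub : {multiplicative _ -> _}))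
    (g := multiplicative_of (@valM _ _ (group_of K)) \o
          (free_eval schreier_gen : {multiplicative _ -> _}))) => z.
  rewrite /= -[LHS]/(free_eval y (free_eval sub (free_gen z))).
  rewrite -[RHS]/(val (free_eval schreier_gen (free_gen z))) !free_eval_gen.
  by rewrite to_group_ofK !free_evalM free_evalV !wdK free_eval_gen.
have act0 (h : group_of K) : act i0 (val h) = i0.
  by rewrite act_c mul1g; apply/cP; rewrite invg1 mulg1; exact: group_valP.
pose g v := coc i0 (free_eval sub v).
have gM : {morph g : u v / u * v}.
  by move=> u v; rewrite /g free_evalM [LHS]cocycleM // subE act0.
have cocM i u v : coc i (u * v) = coc i u * coc (act i (free_eval y u)) v.
  exact: cocycleM.
have cocV i u : coc i u^-1 = (coc (act i (free_eval y u)^-1) u)^-1.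
  exact: cocycleV.
have cocg i x : coc i (free_gen x) = f (free_gen (i, x)) by exact: cocycle_gen.
have fg v : f v = g v.
  move: v; apply: (free_eval_unique (g := multiplicative_of gM)) => -[i x].
  rewrite -[RHS]/(g (free_gen (i, x))) /g free_eval_gen /sub !cocM coc_tau mul1g.
  rewrite wdK act_c mul1g c_tau cocg cocV !free_evalM !wdK free_eval_gen -/(act i _).
  set k := act i (y x); rewrite [act _ (tau i * _)]act_c mul1g -/(act i _) -/k.
  have -> : act k (tau k)^-1 = i0 by rewrite -{1}(c_tau k) act_c mulgV.
  by rewrite coc_tau invg1 mulg1.
move=> w1; apply/quotient_map_eq1; rewrite -/f fg /g.
rewrite (coc_eval _ _ 1); first exact: cocycle1.
by rewrite subE w1 val1 free_eval1.
Qed.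

End ReidemeisterSchreier.

(** For index [i] the deficiency [d] becomes [i (d - 1) + 1]. *)
Lemma deficient_sub (G : groupType) (K : subgroup G) :
  finite_index K -> deficient G -> deficient (group_of K).
Proof.
move=> /finite_index_label [n [c [rep [repK cP]]]] [X [J [y [r [pr XJ]]]]].
exists ('I_n.+1 * X)%type, ('I_n.+1 * J + 'I_n)%type.
do 2 eexists; split; first exact: (schreier_presentation repK cP pr).
rewrite card_sum !card_prod !card_ord.
by rewrite (leq_trans _ (leq_mul (leqnn n.+1) XJ)) // mulnS addnC ltn_add2r.
Qed.

(** * Kernels of homomorphisms to the integers *)

Lemma expgz_map (G K : groupType) (f : G -> K) x a :
  {morph f : x y / x * y} -> f (expgz x a) = expgz (f x) a.
Proof. by move=> fM; case: a => n /=; rewrite ?(morphVg fM) (morphXg fM). Qed.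

Lemma expgzN (G : groupType) (x : G) a : expgz x (- a)%R = (expgz x a)^-1.
Proof. by case: a => [[|n]|n] //=; rewrite ?expg0 ?invg1 ?invgK. Qed.

Lemma zhom_expgz (G : groupType) (V : zmodType) (f : G -> V) x a :
  zhom f -> f (expgz x a) = (f x *~ a)%R.
Proof. by move=> fM; case: a => n /=; rewrite ?zhomV // zhomX. Qed.

Section Tietze.
Variables (G : groupType) (X J : finType) (y : X -> G) (r : J -> free_group X).
Variables (chi : G -> int) (t : G).
Hypothesis pres : presentation y r.
Hypothesis chiM : zhom chi.
Hypothesis chit : chi t = 1%R.

(** The generators are moved into the kernel of [chi] at the cost of a new
    generator [t] and of one relator, which expresses [t]. *)
Definition adapted_gen (o : option X) : G :=
  if o is Some x then y x * expgz t (- chi (y x))%R else t.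

Lemma chi_adapted x : chi (adapted_gen (Some x)) = 0%R.
Proof. by rewrite /= chiM zhom_expgz // chit intz GRing.subrr. Qed.

(** Substituting words of the old generators in the new ones and back is the
    identity modulo the relator that expresses [t]. *)
Lemma adapted_presentation :
  exists r' : option J -> free_group (option X), presentation adapted_gen r'.
Proof.
have [ysurj yr ymin] := pres; have [wt wtE] := ysurj t.
pose t' : free_group (option X) := free_gen None.
pose phi (x : X) : free_group (option X) := free_gen (Some x) * expgz t' (chi (y x)).
pose psi (o : option X) : free_group X :=
  if o is Some x then free_gen x * expgz wt (- chi (y x))%R else wt.
have phiE w : free_eval adapted_gen (free_eval phi w) = free_eval y w.
  move: w; apply: free_group_ind => [|x w IH|x w IH].
  - by rewrite !free_eval1.
  - rewrite !free_evalM IH !free_eval_gen free_evalM free_eval_gen.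
    rewrite (expgz_map _ _ (free_evalM _)) free_eval_gen /= expgzN.
    by rewrite mulgVK.
  rewrite !(free_evalM, free_evalV) IH !free_eval_gen free_evalM free_eval_gen.
  by rewrite (expgz_map _ _ (free_evalM _)) free_eval_gen /= expgzN mulgVK.
have psiE w : free_eval y (free_eval psi w) = free_eval adapted_gen w.
  have genE o : free_eval y (psi o) = adapted_gen o.
    case: o => [x|] //=; rewrite free_evalM free_eval_gen.
    by rewrite (expgz_map _ _ (free_evalM _)) wtE.
  move: w; apply: free_group_ind => [|o w IH|o w IH].
  - by rewrite !free_eval1.
  - by rewrite !free_evalM IH !free_eval_gen genE.
  by rewrite !(free_evalM, free_evalV) IH !free_eval_gen genE.
pose r' (o : option J) := if o is Some j then free_eval phi (r j)
  else t'^-1 * free_eval phi wt.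
exists r'; split.
- by move=> g; have [w <-] := ysurj g; exists (free_eval phi w).
- case=> [j|] /=; first by rewrite phiE.
  by rewrite free_evalM free_evalV phiE wtE free_eval_gen mulVg.
move=> N Nr w w1; have [K [f [fM f1]]] := morph_with_kernel N.
have fr o : f (r' o) = 1 by exact/f1.
have ft : f (free_eval phi wt) = f t'.
  have := fr None; rewrite /= fM (morphVg fM) => /eqP.
  by rewrite mulg_eq1 => /eqP/invg_inj.
have fy u : free_eval y u = 1 -> f (free_eval phi u) = 1.
  move: u; apply: (presentation_ind pres).
  - by rewrite free_eval1 (morph1g fM).
  - by move=> u v eu ev; rewrite free_evalM fM eu ev mulg1.
  - by move=> u eu; rewrite free_evalV (morphVg fM) eu invg1.
  - move=> u g eu; rewrite /conjg !free_evalM !fM eu mul1g free_evalV.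
    by rewrite (morphVg fM) mulVg.
  by move=> j; exact: fr (Some j).
have fE u : f (free_eval phi (free_eval psi u)) = f u.
  have genE o : f (free_eval phi (psi o)) = f (free_gen o).
    case: o => [x|] //=; rewrite free_evalM fM free_eval_gen fM.
    rewrite (expgz_map _ _ (free_evalM _)) !(expgz_map _ _ fM) ft expgzN.
    by rewrite -mulgA mulgV mulg1.
  move: u; apply: free_group_ind => [|o u IH|o u IH].
  - by rewrite !free_eval1.
  - by rewrite !(free_evalM, fM) IH !free_eval_gen genE.
  rewrite !(free_evalM, fM, free_evalV, morphVg fM).
  by rewrite IH !free_eval_gen genE.
by apply/f1; rewrite -fE; apply: fy; rewrite psiE.
Qed.

End Tietze.

Section FinImage.
Variables (G : groupType) (T : finGroupType) (f : G -> T).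
Hypothesis fM : {morph f : x y / x * y}.

Definition fin_image (S : set G) : {set T} :=
  finset (fun s => `[< exists2 a, S a & f a = s >]).

Lemma fin_imageP (S : set G) s : s \in fin_image S <-> exists2 a, S a & f a = s.
Proof. by rewrite inE; split=> /asboolP. Qed.

Lemma mem_fin_image (S : set G) a : S a -> f a \in fin_image S.
Proof. by move=> Sa; apply/fin_imageP; exists a. Qed.

Lemma fin_image_group_set (H : subgroup G) : group_set (fin_image H).
Proof.
apply/group_setP; split.
  by rewrite -(morph1g fM); apply: mem_fin_image; exact: subgroup1.
move=> _ _ /fin_imageP [a Ha <-] /fin_imageP [b Hb <-].
by rewrite -fM; apply: mem_fin_image; exact: subgroupM.
Qed.

Definition fin_image_group H := group (fin_image_group_set H).

End FinImage.

Lemma free_group_nonabelian (X : choiceType) (x y : X) :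
  x != y -> ~ abelian_group (free_group X).
Proof.
move=> /eqP xy ab; apply: xy; have := congr1 (@word X) (ab (free_gen x) (free_gen y)).
by rewrite /= /letter_inv /= !xpair_eqE !andbF => -[].
Qed.

Definition full_subgroup (G : groupType) : subgroup G :=
  @Subgroup G setT I (fun _ _ _ _ => I) (fun _ _ => I).

Section HNN.
Variables (G : groupType) (X J : finType) (y : option X -> G).
Variables (r : J -> free_group (option X)) (chi : G -> int).
Hypothesis lerfG : LERF G.
Hypothesis pres : presentation y r.
Hypothesis chiM : zhom chi.
Hypothesis chi_t : chi (y None) = 1%R.
Hypothesis chi_x : forall x, chi (y (Some x)) = 0%R.

Let t := y None.

Definition shifted (l : nat) (x : X) : G := t ^+ l * y (Some x) * t ^- l.

(** The kernel of [chi] is generated by the conjugates of the [x] by the powers of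
    [t], and [t] shifts the heights. Once [b] is large compared with the relators,
    [G] is the HNN extension of the base [slab 0 b.+1] with stable letter [t],
    conjugating [slab 0 b] to [slab 1 b.+1]. *)
Definition slab (a b : nat) : subgroup G :=
  generated [set` [seq shifted l x | l <- index_iota a b.+1, x <- enum X]].

Lemma slab_fg a b : finitely_generated_subgroup (slab a b).
Proof. by eexists; last reflexivity; exact: finite_seq. Qed.

Lemma shifted_slab a b l x : (a <= l <= b)%N -> shifted l x isin slab a b.
Proof.
move=> lab; apply: sub_generated => /=; apply/allpairsP; exists (l, x).
by rewrite /= mem_index_iota ltnS mem_enum.
Qed.

Lemma slab_min a b (K : subgroup G) :
  (forall l x, (a <= l <= b)%N -> shifted l x isin K) -> slab a b `<=` K.
Proof.
move=> hK; apply: generated_min => g /= /allpairsP [[l x] /=].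
by rewrite mem_index_iota ltnS => -[lab _ ->]; exact: hK.
Qed.

Lemma shiftedS l x : t * shifted l x * t^-1 = shifted l.+1 x.
Proof. by rewrite /shifted expgS invgM !mulgA. Qed.

Lemma slab_chi a b g : g isin slab a b -> chi g = 0%R.
Proof.
apply: (@slab_min _ _ (zhom_kernel chiM)) => l x _ /=.
by rewrite /shifted !chiM zhomV // chi_x GRing.addr0 GRing.subrr.
Qed.

Lemma slab_conj a b g : t * g * t^-1 isin slab a.+1 b.+1 <-> g isin slab a b.
Proof.
pose K a b : set G := fun g => t * g * t^-1 isin slab a b.
pose K' a b : set G := fun g => t^-1 * g * t isin slab a b.
have K1 a' b' : K a' b' 1 by rewrite /K mulg1 mulgV; exact: subgroup1.
have KM a' b' u v : K a' b' u -> K a' b' v -> K a' b' (u * v).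
  rewrite /K => hu hv; have := subgroupM hu hv.
  by rewrite !mulgA mulgVK.
have KV a' b' u : K a' b' u -> K a' b' u^-1.
  by rewrite /K => /(@subgroupV _ _ _); rewrite !invgM invgK mulgA.
have K1' a' b' : K' a' b' 1 by rewrite /K' mulg1 mulVg; exact: subgroup1.
have KM' a' b' u v : K' a' b' u -> K' a' b' v -> K' a' b' (u * v).
  rewrite /K' => hu hv; have := subgroupM hu hv.
  by rewrite !mulgA mulgK.
have KV' a' b' u : K' a' b' u -> K' a' b' u^-1.
  by rewrite /K' => /(@subgroupV _ _ _); rewrite !invgM invgK mulgA.
split; last first.
  apply: (@slab_min _ _ (Subgroup (K1 a.+1 b.+1) (@KM _ _) (@KV _ _))) => l x lab.
  by rewrite /= /K shiftedS; exact: shifted_slab.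
move=> h; have : t * g * t^-1 isin Subgroup (K1' a b) (@KM' _ _) (@KV' _ _).
  move: h; apply: slab_min => -[|l] x lab //=.
  rewrite /K' -shiftedS !mulgA mulVg mul1g mulgVK.
  by apply: shifted_slab.
by rewrite /= /K' !mulgA mulVg mul1g mulgVK.
Qed.

Let surj : forall g, exists w, free_eval y w = g.
Proof. by case: pres. Qed.

(** [slab 1 m.+1] is the conjugate by [t] of [A = slab 0 m]. In a finite quotient
    both have the same number of elements, so that they have the same image as soon
    as one contains the other, and LERF lifts this equality to [G]. Then [t]
    normalises [A], every element is a power of [t] up to [A], and [A] is the
    kernel. *)
Lemma ascending_kernel m :
  slab 0 m `<=` slab 1 m.+1 -> forall g, chi g = 0%R -> g isin slab 0 m.
Proof.
move=> asc.
have desc : slab 1 m.+1 `<=` slab 0 m.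
  move=> c Cc; apply: contrapT => nAc.
  have [n [f [i [fM fA fc]]]] := LERF_separate lerfG (slab_fg 0 m) nAc.
  have sub : fin_image f (slab 0 m) \subset fin_image f (slab 1 m.+1).
    apply/fintype.subsetP => s /fin_imageP [a /asc Ca <-].
    exact: mem_fin_image.
  have card : #|fin_image f (slab 0 m)| = #|fin_image f (slab 1 m.+1)|.
    rewrite -(card_imset _ (conjg_inj (f t)^-1)); apply: eq_card => s.
    apply/imsetP/idP => [[u /fin_imageP [a Aa <-] ->]|/fin_imageP [a Ca <-]].
      rewrite -(morphVg fM) -(morphJg fM); apply: mem_fin_image.
      by rewrite conjgE invgK mulgA; apply/slab_conj.
    exists (f (a ^ t)).
      apply: mem_fin_image; apply/slab_conj.
      by rewrite conjgE !mulgA mulgV mul1g mulgK.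
    by rewrite -(morphVg fM) -(morphJg fM) conjgK.
  apply: fc; have : f c \in fin_image f (slab 0 m).
    have /eqP -> : fin_image f (slab 0 m) == fin_image f (slab 1 m.+1).
      by rewrite eqEcard sub card /=.
    exact: mem_fin_image.
  by move=> /fin_imageP [a Aa <-]; exact: fA.
have tA g : g isin slab 0 m -> t * g * t^-1 isin slab 0 m.
  by move=> /slab_conj /desc.
have tA' g : g isin slab 0 m -> t^-1 * g * t isin slab 0 m.
  move=> /asc h; apply/slab_conj.
  by rewrite !mulgA mulgV mul1g mulgK.
have xA x : y (Some x) isin slab 0 m.
  by have := @shifted_slab 0 m 0 x isT; rewrite /shifted expg0 mul1g invg1 mulg1.
have decomp g : exists a p q, a isin slab 0 m /\ g = a * t ^+ p * t ^- q.
  have [w <-] := surj g; move: w; apply: free_group_ind.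
  - exists 1, 0%N, 0%N; split; first exact: subgroup1.
    by rewrite free_eval1 expg0 invg1 !mulg1.
  - move=> o w [a [p [q [Aa wE]]]]; rewrite free_evalM free_eval_gen wE.
    case: o => [x|].
      by exists (y (Some x) * a), p, q; split; [exact: subgroupM | rewrite !mulgA].
    exists (t * a * t^-1), p.+1, q; split; first exact: tA.
    by rewrite expgS !mulgA mulgVK.
  move=> o w [a [p [q [Aa wE]]]]; rewrite free_evalM free_evalV free_eval_gen wE.
  case: o => [x|].
    exists ((y (Some x))^-1 * a), p, q; split; last by rewrite !mulgA.
    by apply: subgroupM => //; apply: subgroupV.
  exists (t^-1 * a * t), p, q.+1; split; first exact: tA'.
  rewrite -/t expgSr invgM !mulgA; congr (_ * _).
  by rewrite -(mulgA _ t) -expgS expgSr !mulgA mulgK.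
move=> g g0; have [a [p [q [Aa gE]]]] := decomp g.
suff -> : g = a by [].
move: g0; rewrite gE !chiM zhomV // !zhomX // (slab_chi Aa) chi_t GRing.add0r.
by move=> /eqP; rewrite GRing.subr_eq0 => /eqP; rewrite !natz => -[->]; rewrite mulgK.
Qed.

Section Graph.
Variables (m : nat) (T : finGroupType) (f : G -> T).
Hypothesis relator_size : forall j, (2 * size (word (r j)) <= m.+1)%N.
Hypothesis fM : {morph f : x y / x * y}.

(* The graph has the cosets of [PB] in [Q] for vertices and those of [PC] for edges,
   the edge [g PC] going from [g PB] to [g q PB]. A word traces a path in it: the
   letter [t] follows an edge and the letters [x] stay at a vertex. *)
Let PC := fin_image_group fM (slab 1 m.+1).
Let PB := fin_image_group fM (slab 0 m.+1).
Let Q := fin_image_group fM (full_subgroup G).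
Let q := f t.
Let edge (g : T) : free_group {set T} := free_gen (g *: PC).
Let act (g : T) (h : G) := g * f h.
Let s (g : T) (o : option X) := if o is Some _ then 1 else edge g.

Let act1 g : act g 1 = g.
Proof. by rewrite /act (morph1g fM) mulg1. Qed.

Let actM g h k : act g (h * k) = act (act g h) k.
Proof. by rewrite /act fM mulgA. Qed.

(** The last [k] edges of the line through [g] in the direction of [q]. It is a
    potential for the labels [s]: see [path_from_below_word]. *)
Fixpoint path_from_below (g : T) (k : nat) : free_group {set T} :=
  if k is k'.+1 then path_from_below (g * q^-1) k' * edge (g * q^-1) else 1.

Lemma edge_eq g c : c \in PC -> edge (g * c) = edge g.
Proof. by move=> Pc; rewrite /edge lcosetM lcoset_id. Qed.

Lemma path_from_below_eq g u k :
  (forall l, (0 < l <= k)%N -> f (t ^+ l * u * t ^- l) \in PC) ->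
  path_from_below (g * f u) k = path_from_below g k.
Proof.
elim: k g u => [//|k IH] g u hu; rewrite [LHS]/= [RHS]/=.
have -> : g * f u * q^-1 = g * q^-1 * f (t * u * t^-1).
  by rewrite !fM (morphVg fM) !mulgA mulgVK.
rewrite edge_eq; last exact: (hu 1%N).
congr (_ * _); apply: IH => l /andP [l0 lk].
suff -> : t ^+ l * (t * u * t^-1) * t ^- l = t ^+ l.+1 * u * t ^- l.+1.
  by apply: hu.
by rewrite expgSr invgM !mulgA.
Qed.

Lemma path_from_below_gen g x k :
  (k <= m.+1)%N -> path_from_below (g * f (y (Some x))) k = path_from_below g k.
Proof.
move=> km; apply: path_from_below_eq => l /andP [l0 lk].
by apply: mem_fin_image; apply: (@shifted_slab 1 m.+1); rewrite l0 (leq_trans lk).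
Qed.

(** Multiplying [g] by a letter [x] does not move the edges [k] steps below [g] or
    less, because the conjugates of [x] by [t], ..., [t^k] lie in [slab 1 m.+1] for
    [k <= m.+1]. So the labels along a word multiply to the quotient of two
    such paths, as long as its heights stay between [0] and [m.+1]. *)
Lemma path_from_below_word w g k : (size w <= k)%N -> (k + size w <= m.+1)%N ->
  exists2 k', Posz k' = (Posz k + chi (\prod_(a <- w) letter_eval y a))%R &
    path_from_below g k * word_cocycle y act s g w =
      path_from_below (act g (\prod_(a <- w) letter_eval y a)) k'.
Proof.
elim: w g k => [|[o b] w IH] g k.
  move=> _ _; exists k; rewrite big_nil ?zhom1 ?GRing.addr0 //=.
  by rewrite mulg1 act1.
rewrite big_cons /= => wk km.
have step k1 : (size w <= k1)%N -> (k1 + size w <= m.+1)%N ->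
    Posz k1 = (Posz k + chi (letter_eval y (o, b)))%R ->
    path_from_below g k * letter_cocycle y act s g (o, b) =
      path_from_below (letter_act y act g (o, b)) k1 ->
    exists2 k', Posz k' = (Posz k + chi (letter_eval y (o, b) * \prod_(a <- w) letter_eval y a))%R &
    path_from_below g k * (letter_cocycle y act s g (o, b) *
         word_cocycle y act s (letter_act y act g (o, b)) w) =
    path_from_below (act g (letter_eval y (o, b) * \prod_(a <- w) letter_eval y a)) k'.
  move=> wk1 k1m k1E pE; have [k' k'E p'E] := IH (letter_act y act g (o, b)) k1 wk1 k1m.
  exists k'; first by rewrite chiM GRing.addrA -k1E.
  by rewrite mulgA pE p'E /letter_act actM.
case: o b step => [x|] [] step.
- apply: (step k); rewrite ?(ltnW wk) ?(leq_trans _ km) ?leq_add2l //.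
    by rewrite /letter_eval /= zhomV // chi_x GRing.subr0.
  rewrite /letter_cocycle /= invg1 mulg1 /letter_act /act /letter_eval /=.
  rewrite -[in LHS](mulgVK (f (y (Some x))) g) -(morphVg fM).
  by rewrite path_from_below_gen // (leq_trans _ km) // leq_addr.
- apply: (step k); rewrite ?(ltnW wk) ?(leq_trans _ km) ?leq_add2l //.
    by rewrite /letter_eval /= chi_x GRing.addr0.
  rewrite /letter_cocycle /= mulg1 /letter_act /act /letter_eval /=.
  by rewrite path_from_below_gen // (leq_trans _ km) // leq_addr.
- case: k wk km step => // k wk km step; apply: (step k) => //.
  + by rewrite (leq_trans _ km) // addSn addnS -addn2 leq_addr.
  + by rewrite /letter_eval /= zhomV // chi_t -addn1 PoszD GRing.addrK.
  rewrite /letter_cocycle /= /letter_act /act /letter_eval /= (morphVg fM).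
  by rewrite mulgK.
apply: (step k.+1).
- by rewrite (leq_trans _ (leqnSn _)) // ltnW.
- by rewrite addSnnS.
- by rewrite /letter_eval /= chi_t -addn1 PoszD.
by rewrite /letter_cocycle /= /letter_act /act /letter_eval /= mulgK.
Qed.

(** Started at the height of its length, a relator stays in the admissible range
    and comes back to that height. *)
Lemma relator_cocycle g j : cocycle y act s g (r j) = 1.
Proof.
have [_ /(_ j) rj _] := pres.
have [|k'] := @path_from_below_word (word (r j)) g (size (word (r j))) (leqnn _).
  by rewrite addnn -mul2n.
rewrite -/(free_eval y (r j)) rj act1 zhom1 // GRing.addr0 => -[->].
by rewrite -{2}[path_from_below _ _]mulg1 => /mulgI.
Qed.

Let lift_word (h : G) : exists w, free_eval y w = h.
Proof. by case: pres. Qed.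

Definition edge_cocycle (g : T) (h : G) : free_group {set T} :=
  cocycle y act s g (projT1 (cid (lift_word h))).

Lemma edge_cocycleE g w : edge_cocycle g (free_eval y w) = cocycle y act s g w.
Proof.
apply: (cocycle_presentation act1 actM pres relator_cocycle).
by case: cid.
Qed.

Lemma edge_cocycleM g h k :
  edge_cocycle g (h * k) = edge_cocycle g h * edge_cocycle (g * f h) k.
Proof.
have [v <-] := lift_word h; have [w <-] := lift_word k.
by rewrite -free_evalM !edge_cocycleE cocycleM.
Qed.

Lemma edge_cocycle1 g : edge_cocycle g 1 = 1.
Proof. by rewrite -(free_eval1 y) edge_cocycleE cocycle1. Qed.

Lemma edge_cocycleV g h : edge_cocycle g h^-1 = (edge_cocycle (g * (f h)^-1) h)^-1.
Proof.
apply: (mulIg (edge_cocycle (g * (f h)^-1) h)); rewrite mulVg -(morphVg fM).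
by rewrite -edge_cocycleM mulVg edge_cocycle1.
Qed.

Lemma edge_cocycle_t g : edge_cocycle g t = edge g.
Proof. by rewrite /t -(free_eval_gen y None) edge_cocycleE cocycle_gen. Qed.

Lemma edge_cocycle_x g x : edge_cocycle g (y (Some x)) = 1.
Proof. by rewrite -(free_eval_gen y (Some x)) edge_cocycleE cocycle_gen. Qed.

Lemma edge_cocycle_tX g l : edge_cocycle g (t ^+ l) = path_from_below (g * q ^+ l) l.
Proof.
elim: l => [|l IH]; first by rewrite expg0 edge_cocycle1.
rewrite expgSr edge_cocycleM IH edge_cocycle_t /= (morphXg fM) -/q.
by rewrite expgSr mulgA mulgK.
Qed.

(** The base group does not move along the graph, so paths to a vertex do not depend
    on the representative of the coset. *)
Lemma edge_cocycle_slab g b : b isin slab 0 m.+1 -> edge_cocycle g b = 1.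
Proof.
pose K : set G := fun b => forall g, edge_cocycle g b = 1.
have K1 : K 1 by move=> h; exact: edge_cocycle1.
have KM u v : K u -> K v -> K (u * v).
  by move=> Ku Kv h; rewrite edge_cocycleM Ku Kv mulg1.
have KV u : K u -> K u^-1 by move=> Ku h; rewrite edge_cocycleV Ku invg1.
move=> sb; move: b sb g; apply: (slab_min (K := Subgroup K1 KM KV)) => l x lm /= g.
rewrite /shifted !edge_cocycleM edge_cocycle_x mulg1 edge_cocycleV.
rewrite !edge_cocycle_tX !fM !(morphXg fM) -/q mulgVK mulgA.
by rewrite path_from_below_gen // mulgV.
Qed.

Hypothesis slab_proper : ~~ (PB \subset PC).

Definition collapse (A : {set {set T}}) : free_group {set T} -> free_group {set T} :=
  free_eval (fun e => if e \in A then 1 else free_gen e).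

Lemma collapseM A : {morph collapse A : u v / u * v}.
Proof. exact: free_evalM. Qed.

Lemma collapse_gen A e : collapse A (free_gen e) = if e \in A then 1 else free_gen e.
Proof. exact: free_eval_gen. Qed.

Lemma collapse_sub (A B : {set {set T}}) w :
  A \subset B -> collapse A w = 1 -> collapse B w = 1.
Proof.
move=> /fintype.subsetP AB Aw; suff <- : collapse B (collapse A w) = collapse B w.
  by rewrite Aw (morph1g (@collapseM B)).
move: w {Aw}; apply: free_group_ind => [|e w IH|e w IH].
- by rewrite !(morph1g (@collapseM _)).
- rewrite !collapseM IH !collapse_gen; case: ifP => [eA|_]; last by rewrite collapse_gen.
  by rewrite (morph1g (@collapseM _)) (AB _ eA).
rewrite !(collapseM, morphVg (@collapseM _)) IH !collapse_gen.
case: ifP => [eA|_]; last by rewrite collapse_gen.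
by rewrite (morph1g (@collapseM _)) (AB _ eA).
Qed.

Let E := lcosets PC Q.
Let V := lcosets PB Q.

Let fQ h : f h \in Q.
Proof. exact: mem_fin_image. Qed.

Lemma lcoset_mem g : g \in Q -> g *: PB \in V.
Proof. by move=> gQ; apply/lcosetsP; exists g. Qed.

Let subBQ : PB \subset Q.
Proof. by apply/fintype.subsetP => s' /fin_imageP [a _ <-]; exact: fQ. Qed.

Let subCB : PC \subset PB.
Proof.
apply/fintype.subsetP => s' /fin_imageP [a sa <-]; apply: mem_fin_image.
move: a sa; apply: (slab_min (K := slab 0 m.+1)) => l x /andP [_ lm].
exact: shifted_slab.
Qed.

(** The edges that leave the vertex [g PB] are the cosets of [PC] in it, and [PC] is
    a proper subgroup of [PB]. *)
Lemma edge_count : (2 * #|V| <= #|E|)%N.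
Proof.
rewrite /E /V !card_lcosets -(Lagrange_index subBQ subCB) mulnC leq_mul2l.
by rewrite indexg_gt1 slab_proper orbT.
Qed.

(** Some [h] traces a path from the base vertex to [v] that uses only the edges in
    [A], which is tested by collapsing them. *)
Definition tree_reached (A : {set {set T}}) (v : {set T}) :=
  exists2 h, f h \in v & collapse A (edge_cocycle 1 h) = 1.

Lemma tree_reached_at A g : tree_reached A (g *: PB) ->
  exists2 h, f h = g & collapse A (edge_cocycle 1 h) = 1.
Proof.
move=> [h /lcosetP [p /fin_imageP [b Bb <-] hE] Ah]; exists (h * b^-1).
  by rewrite fM hE (morphVg fM) mulgK.
rewrite edge_cocycleM mul1g collapseM Ah mul1g edge_cocycleV edge_cocycle_slab //.
by rewrite invg1 (morph1g (@collapseM _)).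
Qed.

(** A tree with [k] vertices has [k - 1] edges. If no edge leaves the set [S] of its
    vertices, then [S] is stable under all generators, so it contains all
    vertices. *)
Lemma tree_grow k : (0 < k <= #|V|)%N -> exists (A S : {set {set T}}),
  [/\ #|S| = k, S \subset V, (#|A| < #|S|)%N
    & forall v, v \in S -> tree_reached A v].
Proof.
elim: k => // -[_ _|k IH /andP [_ kV]].
  exists (finset.set0 : {set {set T}}), [set 1 *: PB]%SET; rewrite cards1 cards0; split=> //.
    by rewrite finset.sub1set lcoset_mem.
  move=> v /finset.set1P ->; exists 1; first by rewrite (morph1g fM) lcoset_refl.
  by rewrite edge_cocycle1 (morph1g (@collapseM _)).
have [|A [S [Sk SV AS Sr]]] := IH; first exact: ltnW kV.
have add e v : v \in V -> v \notin S -> tree_reached (e |: A) v ->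
    exists A S : {set {set T}}, [/\ #|S| = k.+2, S \subset V, (#|A| < #|S|)%N
      & forall v, v \in S -> tree_reached A v].
  move=> vV vS vr; exists (e |: A), (v |: S).
  rewrite !finset.cardsU1 vS Sk add1n; split=> //.
  - by rewrite finset.subUset finset.sub1set vV.
  - by rewrite (leq_ltn_trans (leq_add (leq_b1 _) (leqnn _))) // add1n -Sk.
  move=> w /finset.setU1P [->//|/Sr [h hw Ah]]; exists h => //.
  by apply: collapse_sub Ah; exact: finset.subsetUr.
have [[g gQ]|closed] := pselect (exists2 g, g \in Q &
    ((g *: PB \in S) != (g * q *: PB \in S))).
  have gqQ : g * q \in Q by rewrite groupM // fQ.
  have eA : collapse (g *: PC |: A) (edge g) = 1 by rewrite collapse_gen finset.setU11.
  case: (boolP (g *: PB \in S)) => [gS gqS|gS]; last rewrite /= negbK => gqS.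
    apply: (add (g *: PC) (g * q *: PB)) => //; first exact: lcoset_mem.
    have [h hg Ah] := tree_reached_at (Sr _ gS).
    exists (h * t); first by rewrite fM hg lcoset_refl.
    rewrite edge_cocycleM mul1g hg edge_cocycle_t collapseM eA mulg1.
    by apply: collapse_sub Ah; exact: finset.subsetUr.
  apply: (add (g *: PC) (g *: PB)) => //; first exact: lcoset_mem.
  have [h hg Ah] := tree_reached_at (Sr _ gqS).
  exists (h * t^-1); first by rewrite fM hg (morphVg fM) mulgK lcoset_refl.
  rewrite edge_cocycleM mul1g hg edge_cocycleV mulgK edge_cocycle_t collapseM.
  rewrite (morphVg (@collapseM _)) eA invg1 mulg1.
  by apply: collapse_sub Ah; exact: finset.subsetUr.
have {closed} cl g : g \in Q -> (g * q *: PB \in S) = (g *: PB \in S).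
  move=> gQ; apply/eqP; rewrite eq_sym; apply: contrapT => /negP ne.
  by apply: closed; exists g.
have cx g x : g * f (y (Some x)) *: PB = g *: PB.
  rewrite lcosetM lcoset_id //; apply: mem_fin_image.
  have := @shifted_slab 0 m.+1 0 x isT.
  by rewrite /shifted expg0 mul1g invg1 mulg1.
have all g : g \in Q -> g *: PB \in S.
  have [v vS] : exists v, v \in S by apply/finset.set0Pn; rewrite -card_gt0 Sk.
  have [g0 g0Q vE] : exists2 g0, g0 \in Q & v = g0 *: PB.
    by have /lcosetsP [g0 g0Q ->] := fintype.subsetP SV _ vS; exists g0.
  have cw w g1 : g1 \in Q ->
      (g1 * f (free_eval y w) *: PB \in S) = (g1 *: PB \in S).
    move: w g1; apply: free_group_ind => [|o w IHw|o w IHw] g1 g1Q.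
    - by rewrite free_eval1 (morph1g fM) mulg1.
    - rewrite free_evalM fM mulgA IHw ?groupM ?fQ // free_eval_gen.
      by case: o => [x|]; rewrite ?cx ?cl.
    rewrite free_evalM fM mulgA IHw ?groupM ?fQ // free_evalV free_eval_gen.
    rewrite (morphVg fM).
    have g2Q : g1 * (f (y o))^-1 \in Q by rewrite groupM ?groupV ?fQ.
    rewrite -[in RHS](mulgVK (f (y o)) g1); move: (g1 * _) g2Q => g2 g2Q.
    by case: o => [x|]; rewrite ?cx ?cl.
  move=> gQ; have /fin_imageP [h _ hE] : g0^-1 * g \in Q by rewrite groupM ?groupV.
  have [w wh] := lift_word h.
  by have := cw w g0 g0Q; rewrite wh hE mulgA mulgV mul1g -vE vS.
have : V \subset S by apply/fintype.subsetP => v /lcosetsP [g gQ ->]; exact: all.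
by move=> /subset_leq_card; rewrite Sk leqNgt kV.
Qed.

(** Collapsing a maximal tree leaves a bouquet of at least [#|V|.+1] circles, whose
    fundamental group is free on them. The elements in the kernel of [f] trace
    closed paths, and every circle comes from one: follow the tree, then the edge,
    then the tree back. *)
Lemma graph_large : large G.
Proof.
have V0 : (0 < #|V|)%N.
  by apply/card_gt0P; exists (1 *: PB); rewrite lcoset_mem.
have [|A [S [Sk SV AS Sr]]] := @tree_grow #|V|; first by rewrite V0 leqnn.
have SE : S = V by apply/eqP; rewrite eqEcard SV Sk /=.
have EA : (1 < #|E :\: A|)%N.
  have cnt : (#|A|.+1 < #|E|)%N.
    have AV : (#|A| < #|V|)%N by rewrite -SE.
    apply: (leq_ltn_trans AV); apply: leq_trans edge_count.
    by rewrite mul2n -addnn -{1}[#|V|]addn0 ltn_add2l.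
  rewrite cardsD ltn_subRL addnC; apply: leq_ltn_trans cnt.
  by rewrite ltnS; apply/subset_leq_card/finset.subsetIr.
pose X' := {e : {set T} | e \in E :\: A}.
have /card_gt1P [x1 [x2 [_ _ x12]]] : (1 < #|{: X'}|)%N by rewrite card_sig.
pose K := morph_kernel fM; exists K; first exact: morph_kernel_finite_index.
exists X'; first exact: free_group_nonabelian x12.
pose kap (e : {set T}) : free_group X' :=
  if insub e is Some e' then free_gen e' else 1.
pose kappa := free_eval kap.
have kA w : collapse A w = 1 -> kappa w = 1.
  move=> Aw; suff <- : kappa (collapse A w) = kappa w.
    by rewrite Aw /kappa free_eval1.
  have genE e : kappa (collapse A (free_gen e)) = kappa (free_gen e).
    rewrite collapse_gen; case: ifP => // eA; rewrite /kappa free_eval1 free_eval_gen.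
    by rewrite /kap insubF // inE eA.
  rewrite /kappa in genE *.
  move: w {Aw}; apply: free_group_ind => [|e w IH|e w IH].
  - by rewrite (morph1g (@collapseM _)).
  - by rewrite collapseM !free_evalM genE IH.
  by rewrite collapseM (morphVg (@collapseM _)) !(free_evalM, free_evalV) genE IH.
pose theta (h : group_of K) := kappa (edge_cocycle 1 (val h)).
have thetaM : {morph theta : u v / u * v}.
  move=> u v; rewrite /theta valM edge_cocycleM (group_valP u : f _ = 1) mulg1.
  exact: free_evalM.
exists (multiplicative_of thetaM) => w /=.
have thetaV u : theta u^-1 = (theta u)^-1 by rewrite (morphVg thetaM).
have gen (e : X') : exists h, theta h = free_gen e.
  have /setDP [/lcosetsP [g gQ eE] eA] := valP e.
  have reach u : u \in Q -> exists2 h, f h = u & kappa (edge_cocycle 1 h) = 1.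
    move=> uQ; have [|h hu /kA ku] := @tree_reached_at A u; last by exists h.
    by apply: Sr; rewrite SE lcoset_mem.
  have [h1 h1g k1] := reach g gQ.
  have [|h2 h2g k2] := reach (g * q); first by rewrite groupM // fQ.
  have Ku : h1 * t * h2^-1 isin K.
    by rewrite /= !fM (morphVg fM) h1g h2g mulgV.
  exists (to_group_of Ku); rewrite /theta to_group_ofK.
  rewrite !edge_cocycleM edge_cocycleV !mul1g fM h1g h2g mulgV.
  rewrite /kappa !free_evalM free_evalV -/kappa k1 k2 mul1g invg1 mulg1.
  rewrite edge_cocycle_t /kappa free_eval_gen /kap.
  case: insubP => [e' _ e'E|]; first by congr free_gen; apply: val_inj; rewrite e'E eE.
  by rewrite -eE (valP e).
move: w; apply: free_group_ind => [|e w [h hw]|e w [h hw]].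
- by exists 1; rewrite (morph1g thetaM).
- by have [u ue] := gen e; exists (u * h); rewrite thetaM ue hw.
by have [u ue] := gen e; exists (u^-1 * h); rewrite thetaM thetaV ue hw.
Qed.

End Graph.

(** The length of the slabs is such that every relator, started in the middle, stays
    inside. *)
Lemma large_or_slab_kernel :
  large G \/ exists m, forall g, chi g = 0%R -> g isin slab 0 m.
Proof.
pose m := (2 * \max_j size (word (r j)))%N.
have [sub|nsub] := pselect (slab 0 m.+1 `<=` slab 1 m.+1).
  right; exists m; apply: ascending_kernel => g sg; apply: sub.
  move: g sg; apply: slab_min => l x /andP [_ lm]; apply: shifted_slab.
  by rewrite (leq_trans lm).
left; have [b Bb nCb] : exists2 b, b isin slab 0 m.+1 & ~ b isin slab 1 m.+1.
  apply: contrapT => nb; apply: nsub => b Bb; apply: contrapT => Cb.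
  by apply: nb; exists b.
have [n [f [i [fM fC fb]]]] := LERF_separate lerfG (slab_fg 1 m.+1) nCb.
apply: (@graph_large m _ f) => //.
  by move=> j; rewrite leqW // leq_mul2l /= leq_bigmax.
apply/fintype.subsetPn; exists (f b); first exact: mem_fin_image.
by apply/negP => /fin_imageP [c Cc cb]; apply: fb; rewrite -cb fC.
Qed.

End HNN.

(** The least positive value of [chi] divides all its values. *)
Lemma zhom_primitive (G : groupType) (chi : G -> int) : zhom chi ->
  (exists g, chi g <> 0%R) ->
  exists (d : int) (chi' : G -> int) (t : G), [/\ d != 0%R, zhom chi', chi' t = 1%R &
    forall g, chi g = (d * chi' g)%R].
Proof.
move=> chiM [g0 g0n].
pose P n := (0 < n)%N && `[< exists g, chi g = Posz n >].
have exP : exists n, P n.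
  case E: (chi g0) g0n => [n|n] n0.
    exists n; rewrite /P lt0n; apply/andP; split; last by apply/asboolP; exists g0.
    by apply/eqP => n0'; apply: n0; rewrite n0'.
  by exists n.+1; rewrite /P /=; apply/asboolP; exists g0^-1; rewrite zhomV // E NegzE GRing.opprK.
have [d /andP [d0 /asboolP [t tE]] dmin] := ex_minnP exP.
have dvd g : chi g = (d%:Z * (chi g %/ d%:Z)%Z)%R.
  have := divz_eq (chi g) d; set e := (chi g %/ d)%Z; set m := (chi g %% d)%Z => gE.
  have m0 : (0 <= m)%R by rewrite modz_ge0 // eqz_nat -lt0n.
  have md : (m < d%:Z)%R by rewrite ltz_pmod.
  have mE : chi (g * (expgz t e)^-1) = m.
    rewrite chiM zhomV // zhom_expgz // tE gE -mulrzr intz GRing.mulrC.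
    by rewrite GRing.addrAC GRing.subrr GRing.add0r.
  suff m00 : m = 0%R by rewrite gE m00 GRing.addr0 GRing.mulrC.
  case: m m0 md mE {gE} => // -[//|n] _ nd mE.
  have : P n.+1 by apply/andP; split=> //; apply/asboolP; eexists; exact: mE.
  by move=> /dmin; rewrite leqNgt -ltz_nat nd.
have d0' : (d%:Z != 0)%R by rewrite eqz_nat -lt0n.
exists d%:Z%R, (fun g => (chi g %/ d%:Z)%Z), t; split=> //.
  by move=> g h; apply: (GRing.mulfI d0'); rewrite GRing.mulrDr -!dvd chiM.
by rewrite tE divzz d0'.
Qed.

Lemma finitely_generated_kernel (G : groupType) (chi : G -> int) :
  LERF G -> deficient G -> ~ large G -> zhom chi -> (exists g, chi g <> 0%R) ->
  exists2 s : seq G, (forall g, g \in s -> chi g = 0%R) &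
    forall g, chi g = 0%R -> g isin generated [set` s].
Proof.
move=> lerfG [X [J [y [r [pr _]]]]] nl chiM /(zhom_primitive chiM).
move=> [d [chi' [t [d0 chi'M chi't chiE]]]].
have [r' pr'] := adapted_presentation chi' t pr.
have [//|[m km]] := large_or_slab_kernel lerfG pr' chi'M chi't (chi_adapted y chi'M chi't).
eexists; last first.
  move=> g g0; apply: km; move: g0; rewrite chiE => /eqP.
  by rewrite GRing.mulf_eq0 (negPf d0) => /eqP.
move=> g gs; rewrite chiE (_ : chi' g = 0%R) ?GRing.mulr0 //.
apply: (@slab_chi _ _ (adapted_gen y chi' t) chi' chi'M (chi_adapted y chi'M chi't) 0 m).
exact: sub_generated.
Qed.

(** * Derivations and linear representations *)

Section Derivation.
Variables (X : choiceType) (G : groupType) (y : X -> G) (V : zmodType).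
Variable act : G -> V -> V.
Hypothesis act1 : forall v, act 1 v = v.
Hypothesis actM : forall g h v, act (g * h) v = act g (act h v).
Hypothesis actD : forall g u v, act g (u + v)%R = (act g u + act g v)%R.
Variable d : X -> V.

Definition letter_derivation (a : letter X) : V :=
  if a.2 then (- act (letter_eval y a) (d a.1))%R else d a.1.

Fixpoint word_derivation (w : seq (letter X)) : V :=
  if w is a :: w' then
    (letter_derivation a + act (letter_eval y a) (word_derivation w'))%R
  else 0%R.

(** Derivations of the free group with values in a [G]-module; into a free module
    these are the Fox derivatives. *)
Definition derivation (w : free_group X) : V := word_derivation (word w).

Let act0 g : act g 0%R = 0%R.
Proof. by apply: (@GRing.addrI _ (act g 0%R)); rewrite -actD !GRing.addr0. Qed.

Let actN g v : act g (- v)%R = (- act g v)%R.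
Proof. by apply: (@GRing.addrI _ (act g v)); rewrite -actD !GRing.subrr act0. Qed.

Lemma word_derivation_push a w : word_derivation (push a w) =
  (letter_derivation a + act (letter_eval y a) (word_derivation w))%R.
Proof.
case: w => [|b w] //=; case: eqP => [->|//].
rewrite actD -actM GRing.addrA.
have -> : letter_eval y a * letter_eval y (letter_inv a) = 1.
  by case: a => x []; rewrite /letter_eval /= ?mulVg ?mulgV.
rewrite act1 (_ : (_ + act _ (letter_derivation _))%R = 0%R) ?GRing.add0r //.
case: a => x []; rewrite /letter_derivation /letter_eval /= ?GRing.addNr //.
by rewrite actN -actM mulgV act1 GRing.subrr.
Qed.

Lemma derivation1 : derivation 1 = 0%R.
Proof. by []. Qed.

Lemma derivation_gen x : derivation (free_gen x) = d x.
Proof. by rewrite /derivation /= act0 GRing.addr0. Qed.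

Lemma derivationM v w :
  derivation (v * w) = (derivation v + act (free_eval y v) (derivation w))%R.
Proof.
rewrite /derivation /free_eval [word (v * w)]/=; move: (word w) => {}w.
elim: (word v) => [|a u IH] /=; first by rewrite big_nil act1 GRing.add0r.
by rewrite word_derivation_push IH big_cons actM actD GRing.addrA.
Qed.

Lemma derivationV w :
  derivation w^-1 = (- act (free_eval y w)^-1 (derivation w))%R.
Proof.
apply: (@GRing.addIr _ (act (free_eval y w^-1) (derivation w))).
by rewrite -derivationM mulVg derivation1 free_evalV GRing.addNr.
Qed.

(** The words that act trivially and have their derivative in the submodule [I] form
    a normal subgroup, which contains the relators. *)
Lemma derivation_presentation (J : Type) (r : J -> free_group X) (I : V -> Prop) :
  presentation y r -> I 0%R -> (forall u v, I u -> I v -> I (u - v)%R) ->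
  (forall g u, I u -> I (act g u)) -> (forall j, I (derivation (r j))) ->
  forall v w, free_eval y v = free_eval y w -> I (derivation v - derivation w)%R.
Proof.
move=> pr I0 IB Iact Ir.
have IN u : I u -> I (- u)%R by move=> Iu; rewrite -GRing.sub0r; apply: IB.
have ID u v : I u -> I v -> I (u + v)%R.
  by move=> Iu Iv; rewrite -[v]GRing.opprK; apply: IB => //; apply: IN.
have key w : free_eval y w = 1 -> free_eval y w = 1 /\ I (derivation w).
  move: w; apply: (presentation_ind (R := fun w => _ /\ _) pr).
  - by rewrite free_eval1.
  - by move=> u v [u1 Iu] [v1 Iv]; rewrite free_evalM u1 v1 mulg1 derivationM u1 act1; split; auto.
  - move=> u [u1 Iu]; rewrite free_evalV u1 invg1 derivationV u1 invg1 act1.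
    by split; auto.
  - move=> u g [u1 Iu]; rewrite /conjg !free_evalM u1 mul1g free_evalV mulVg.
    split=> //; rewrite !derivationM u1 act1 derivationV free_evalV actD.
    by rewrite [(act _ (derivation u) + _)%R]GRing.addrC GRing.addrA GRing.addNr GRing.add0r; auto.
  by move=> j; split=> //; have [_ ->] := pr.
move=> v w vw; have vw1 : free_eval y (v * w^-1) = 1.
  by rewrite free_evalM free_evalV vw mulgV.
have [e1 Ie] := key _ vw1.
suff -> : (derivation v - derivation w)%R = derivation (v * w^-1) by [].
by rewrite derivationM derivationV actN -actM vw mulgV act1.
Qed.

End Derivation.

Lemma derivation_map (X : choiceType) (G : groupType) (y : X -> G)
    (V V' : zmodType) (act : G -> V -> V) (act' : G -> V' -> V')
    (phi : V -> V') (d : X -> V) w :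
  (forall u v, phi (u + v)%R = (phi u + phi v)%R) ->
  (forall g v, phi (act g v) = act' g (phi v)) ->
  phi (derivation y act d w) = derivation y act' (fun x => phi (d x)) w.
Proof.
move=> phiD phi_act.
have phi0 : phi 0%R = 0%R by apply: (@GRing.addrI _ (phi 0%R)); rewrite -phiD !GRing.addr0.
have phiN v : phi (- v)%R = (- phi v)%R.
  by apply: (@GRing.addrI _ (phi v)); rewrite -phiD !GRing.subrr.
rewrite /derivation; elim: (word w) => //= a u IH.
rewrite phiD phi_act IH; congr (_ + _)%R.
by case: a => x []; rewrite /letter_derivation //= phiN phi_act.
Qed.

Section DerivationLinear.
Variables (X : finType) (G : groupType) (y : X -> G) (k : fieldType) (V : lmodType k).
Variable act : G -> V -> V.
Hypothesis act1 : forall v, act 1 v = v.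
Hypothesis actM : forall g h v, act (g * h) v = act g (act h v).
Hypothesis actD : forall g u v, act g (u + v)%R = (act g u + act g v)%R.
Hypothesis actZ : forall g a v, act g (a *: v)%R = (a *: act g v)%R.

Lemma derivation_linear (I : finType) (a : I -> k) (d : I -> X -> V) w :
  derivation y act (fun x => \sum_i a i *: d i x)%R w =
  (\sum_i a i *: derivation y act (d i) w)%R.
Proof.
have actS g (F : I -> V) : act g (\sum_i F i)%R = (\sum_i act g (F i))%R.
  apply: (big_morph (act g)) => //.
  by apply: (@GRing.addrI _ (act g 0%R)); rewrite -actD !GRing.addr0.
move: w; apply: free_group_ind => [|x w IH|x w IH].
- by rewrite derivation1 big1 // => i _; rewrite derivation1 GRing.scaler0.
- rewrite derivationM // IH derivation_gen // actS -big_split.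
  apply: eq_bigr => i _.
  by rewrite derivationM // derivation_gen // actZ GRing.scalerDr.
rewrite derivationM // derivationV // IH derivation_gen // !actS -GRing.sumrN -big_split.
apply: eq_bigr => i _.
by rewrite derivationM // derivationV // derivation_gen // !actZ GRing.scalerDr GRing.scalerN.
Qed.

End DerivationLinear.

Import Order.TTheory GRing.Theory Num.Theory.
Local Open Scope ring_scope.

Lemma row_neq0 (R : nzRingType) (n : nat) (U : 'rV[R]_n) :
  U != 0 -> exists i, U 0 i != 0.
Proof.
move=> U0; apply: contrapT => nU; case/eqP: U0; apply/rowP => i; rewrite mxE.
by apply/eqP; apply: contrapT => /negP Ui; apply: nU; exists i.
Qed.

(** [B] induces a linear map from [ker A] to [coker A], whose dimensions differ by
    [n - m], so this map is not injective. *)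
Lemma nilpotent_lift (k : fieldType) (n m : nat) (A B : 'M[k]_(n, m)) :
  (m < n)%N -> exists2 U : 'rV[k]_n, U != 0 &
    U *m A = 0 /\ exists V : 'rV[k]_n, U *m B + V *m A = 0.
Proof.
move=> mn; pose B' := B *m cokermx A.
have : (kermx A :&: kermx B')%MS != 0.
  have := mxrank_mul_ker (kermx A) B'.
  rewrite -mxrank_eq0 => rE; apply/negP => /eqP r0; move: rE.
  rewrite r0 addn0 mxrank_ker => rE.
  have := mxrankM_maxr (kermx A *m B) (cokermx A).
  rewrite -mulmxA -/B' rE mxrank_coker leqNgt ltn_sub2r //.
  exact: leq_ltn_trans (rank_leq_col _) mn.
rewrite -nz_row_eq0; set U := nz_row _ => U0; exists U => //.
have : (U <= kermx A :&: kermx B')%MS by exact: nz_row_sub.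
rewrite sub_capmx => /andP [/sub_kermxP UA /sub_kermxP UB]; split=> //.
have : (U *m B <= A)%MS by rewrite submxE -mulmxA; apply/eqP.
by move=> /submxP [V VE]; exists (- V); rewrite VE mulNmx subrr.
Qed.

(** The pair [(u, v)] is a derivation of [G] into [k^2], on which [g] acts by the
    unipotent matrix with off-diagonal entry [eps g]. Derivations of the free group
    are given by the values on the generators, and the condition that they kill the
    relators is a linear system over [k[e] / e^2] with fewer equations than
    unknowns. *)
Lemma unipotent_lift (G : groupType) (k : fieldType) (eps : G -> k) :
  deficient G -> zhom eps ->
  exists (u v : G -> k), [/\ zhom u, exists g, u g != 0 &
    forall g h, v (g * h)%g = v g + v h + eps g * u h].
Proof.
move=> [X [J [y [r [pr JX]]]]] epsM.
pose W : lmodType k := (k^o * k^o)%type.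
pose act (g : G) (p : W) : W := (p.1, p.2 + eps g * p.1).
have act1 v : act 1%g v = v by case: v => a b; rewrite /act /= zhom1 // mul0r addr0.
have actM g h v : act (g * h)%g v = act g (act h v).
  by case: v => a b; rewrite /act /= epsM mulrDl addrAC addrA.
have actD g (u v : W) : act g (u + v) = act g u + act g v.
  by case: u v => [a b] [a' b']; rewrite /act /=; congr pair; rewrite /= mulrDr addrACA.
have actZ g a (v : W) : act g (a *: v) = a *: act g v.
  case: v => b c; rewrite /act /=; congr pair => /=.
  by rewrite scalerDr [RHS]addrC [LHS]addrC; congr (_ + _); rewrite /GRing.scale /= mulrCA.
pose D (d : X -> W) := derivation y act d.
pose n := #|X|; pose m := #|J|.
pose e1 (i : 'I_n) (x : X) : W := ((enum_val i == x)%:R, 0).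
pose e2 (i : 'I_n) (x : X) : W := (0, (enum_val i == x)%:R).
pose A : 'M[k]_(n, m) := \matrix_(i, j) (D (e1 i) (r (enum_val j))).1.
pose B : 'M[k]_(n, m) := \matrix_(i, j) (D (e1 i) (r (enum_val j))).2.
(* The derivations with values in the line of the second coordinate, where the
   action is trivial, repeat the first coordinates of the others. *)
have De2 i w : D (e2 i) w = (0, (D (e1 i) w).1).
  pose phi (p : W) : W := (0, p.1).
  rewrite -[RHS]/(phi (D (e1 i) w)); apply/esym/derivation_map.
    by move=> [a b] [a' b']; rewrite /phi /=; congr pair; rewrite addr0.
  by move=> g [a b]; rewrite /phi /act /= mulr0 addr0.
have [U U0 [UA [V UBVA]]] := nilpotent_lift A B JX.
pose a (i : 'I_n + 'I_n) := match i with inl i => U 0 i | inr i => V 0 i end.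
pose e (i : 'I_n + 'I_n) := match i with inl i => e1 i | inr i => e2 i end.
pose d x : W := \sum_i a i *: e i x.
have fst_sum (F : 'I_n + 'I_n -> W) : (\sum_i F i).1 = \sum_i (F i).1.
  exact: (big_morph (fun p : W => p.1)).
have snd_sum (F : 'I_n + 'I_n -> W) : (\sum_i F i).2 = \sum_i (F i).2.
  exact: (big_morph (fun p : W => p.2)).
have D1 w : (D d w).1 = \sum_i U 0 i * (D (e1 i) w).1.
  rewrite /D /d derivation_linear // fst_sum big_sumType /=.
  rewrite [X in _ + X]big1 ?addr0 // => i _.
  by rewrite -/(D _) De2 /= scaler0.
have D2 w : (D d w).2 = \sum_i U 0 i * (D (e1 i) w).2 + \sum_i V 0 i * (D (e1 i) w).1.
  rewrite /D /d derivation_linear // snd_sum big_sumType /=.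
  by congr (_ + _); apply: eq_bigr => i _; rewrite -/(D _) De2.
have Dr j : D d (r j) = 0.
  rewrite [D d _]surjective_pairing D1 D2; congr pair.
    have /matrixP /(_ 0 (enum_rank j)) := UA; rewrite !mxE => UAj; rewrite -[RHS]UAj.
    by apply: eq_bigr => i _; rewrite mxE enum_rankK.
  have /matrixP /(_ 0 (enum_rank j)) := UBVA; rewrite !mxE => UBj; rewrite -[RHS]UBj.
  by congr (_ + _); apply: eq_bigr => i _; rewrite mxE enum_rankK.
have [/choice [lift liftK] _ _] := pr.
have Dlift w : D d w = D d (lift (free_eval y w)).
  apply/subr0_eq/(derivation_presentation act1 actM actD pr (I := fun v => v = 0)) => //.
  - by move=> ? ? -> ->; rewrite subrr.
  - by move=> g _ ->; rewrite /act mulr0 addr0.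
have DM g h : D d (lift (g * h)%g) = D d (lift g) + act g (D d (lift h)).
  have -> : (g * h)%g = free_eval y (lift g * lift h)%g by rewrite free_evalM !liftK.
  by rewrite -Dlift /D derivationM // liftK.
exists (fun g => (D d (lift g)).1), (fun g => (D d (lift g)).2); split.
- by move=> g h; rewrite DM.
- have [i Ui] := row_neq0 U0.
  exists (y (enum_val i)); rewrite -(free_eval_gen y) -Dlift D1.
  have D1g i' x : (D (e1 i') (free_gen x)).1 = (enum_val i' == x)%:R.
    by rewrite /D derivation_gen.
  rewrite (eq_bigr (fun i' => U 0 i' * (i' == i)%:R)); last first.
    by move=> i' _; rewrite D1g (inj_eq enum_val_inj).
  rewrite (bigD1 i) //= eqxx mulr1 big1 ?addr0 // => i' /negPf ->.
  by rewrite mulr0.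
by move=> g h; rewrite DM /= addrA.
Qed.

Section Exponents.
Variable X : finType.

(** With the trivial action a derivation is a homomorphism. *)
Definition additive_extension (V : zmodType) (u : X -> V) : free_group X -> V :=
  derivation (@free_gen X) (fun _ v => v) u.

Lemma additive_extension_zhom (V : zmodType) (u : X -> V) :
  zhom (additive_extension u).
Proof. by move=> v w; apply: derivationM. Qed.

Lemma additive_extension_gen (V : zmodType) (u : X -> V) x :
  additive_extension u (free_gen x) = u x.
Proof. exact: derivation_gen. Qed.

(** The exponent sum of a letter. *)
Definition exponent (i : X) : free_group X -> int :=
  additive_extension (fun x => (i == x)%:R).

Lemma zhom_exponents (V : zmodType) (f : free_group X -> V) w : zhom f ->
  f w = \sum_i f (free_gen i) *~ exponent i w.
Proof.
move=> fM.
have eM i : zhom (exponent i) by exact: additive_extension_zhom.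
have eg i x : exponent i (free_gen x) = (i == x)%:R by exact: additive_extension_gen.
have gen x : \sum_i f (free_gen i) *~ exponent i (free_gen x) = f (free_gen x).
  rewrite (bigD1 x) //= eg eqxx big1 ?addr0 // => i ix.
  by rewrite eg (negPf ix).
move: w; apply: free_group_ind => [|x w IH|x w IH].
- by rewrite zhom1 // big1 // => i _; rewrite zhom1.
- rewrite fM -gen IH -big_split; apply: eq_bigr => i _.
  by rewrite eM; exact/esym/mulrzDr.
rewrite fM zhomV // -gen IH -sumrN -big_split; apply: eq_bigr => i _.
by rewrite eM zhomV // -mulrNz; exact/esym/mulrzDr.
Qed.

Lemma zhom_descend (G : groupType) (J : Type) (y : X -> G) (r : J -> free_group X)
    (V : zmodType) (u : X -> V) :
  presentation y r -> (forall j, additive_extension u (r j) = 0) ->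
  exists2 chi : G -> V, zhom chi &
    forall w, chi (free_eval y w) = additive_extension u w.
Proof.
move=> pr ur; have uM := additive_extension_zhom u.
have [/choice [lift liftK] yr _] := pr.
have ker w : free_eval y w = 1%g -> additive_extension u w = 0.
  move: w; apply: (presentation_ind pr) => //.
  - by move=> v w v0 w0; rewrite uM v0 w0 addr0.
  - by move=> v v0; rewrite zhomV // v0 oppr0.
  by move=> v g v0; rewrite zhomJ.
have chiE v w : free_eval y v = free_eval y w ->
    additive_extension u v = additive_extension u w.
  move=> vw; apply/eqP; rewrite -subr_eq0 -zhomV // -uM; apply/eqP/ker.
  by rewrite free_evalM free_evalV vw mulgV.
exists (fun g => additive_extension u (lift g)) => [g h|w].
  by rewrite -uM; apply: chiE; rewrite free_evalM !liftK.
exact: chiE.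
Qed.

End Exponents.

Lemma common_denominator (I : finType) (q : I -> rat) :
  exists2 N : int, N != 0 & exists z : I -> int, forall i, N%:~R * q i = (z i)%:~R.
Proof.
exists (\prod_i denq (q i)); first by apply/prodf_neq0 => i _; exact: denq_neq0.
exists (fun i => numq (q i) * \prod_(j | j != i) denq (q j)) => i.
rewrite (bigD1 i) //= !intrM mulrAC; congr (_ * _).
by rewrite -{2}[q i]divq_num_den mulrC divfK // intr_eq0 denq_neq0.
Qed.

(** Multiplying out denominators turns a rational solution of the abelianised
    relators into a homomorphism to [int]. *)
Lemma rational_zhom (G : groupType) (X : finType) (J : Type) (y : X -> G)
    (r : J -> free_group X) (U : X -> rat) : presentation y r ->
  (forall j, \sum_i U i *~ exponent i (r j) = 0) ->
  exists2 N : int, N != 0 & exists2 chi : G -> int, zhom chi &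
    forall w, (chi (free_eval y w))%:~R = N%:~R * \sum_i U i *~ exponent i w.
Proof.
move=> pr Ur; have [N N0 [z zE]] := common_denominator U.
have zw w : (additive_extension z w)%:~R = N%:~R * \sum_i U i *~ exponent i w.
  rewrite (zhom_exponents _ (additive_extension_zhom z)) rmorph_sum mulr_sumr.
  apply: eq_bigr => i _; rewrite additive_extension_gen mulrzz /= intrM -zE.
  by rewrite -mulrA mulrzr.
have [j|chi chiM chiE] := @zhom_descend _ _ _ _ _ _ z pr.
  by apply/eqP; rewrite -(intr_eq0 rat) zw Ur mulr0.
by exists N => //; exists chi => // w; rewrite chiE.
Qed.

Section RelationMatrix.
Variables (G : groupType) (X J : finType) (y : X -> G) (r : J -> free_group X).
Hypothesis pres : presentation y r.

(** It presents the abelianisation of [G] tensored with the rationals. *)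
Definition relation_matrix : 'M[rat]_(#|J|, #|X|) :=
  \matrix_(j, i) (exponent (enum_val i) (r (enum_val j)))%:~R.

Definition exponent_row (w : free_group X) : 'rV[rat]_#|X| :=
  \row_i (exponent (enum_val i) w)%:~R.

Lemma relation_matrix_zhom (U : 'cV[rat]_#|X|) : relation_matrix *m U = 0 ->
  exists2 N : int, N != 0 & exists2 chi : G -> int, zhom chi &
    forall w, (chi (free_eval y w))%:~R = N%:~R * (exponent_row w *m U) 0 0.
Proof.
move=> AU; pose u x := U (enum_rank x) 0.
have uE w : \sum_i u i *~ exponent i w = (exponent_row w *m U) 0 0.
  rewrite mxE [RHS](reindex enum_rank) /=; last exact/onW_bij/enum_rank_bij.
  by apply: eq_bigr => i _; rewrite mxE enum_rankK /u -mulrzr mulrC.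
have [j|N N0 [chi chiM chiE]] := rational_zhom (U := u) pres.
  rewrite uE; have /matrixP /(_ (enum_rank j) 0) := AU; rewrite [in X in _ = X]mxE => <-.
  by rewrite !mxE; apply: eq_bigr => i _; rewrite !mxE enum_rankK.
by exists N => //; exists chi => // w; rewrite chiE uE.
Qed.

End RelationMatrix.

Lemma deficient_zhom (G : groupType) : deficient G ->
  exists2 chi : G -> int, zhom chi & exists g, chi g <> 0.
Proof.
move=> [X [J [y [r [pr JX]]]]].
pose A := relation_matrix r.
have : cokermx A != 0.
  rewrite -mxrank_eq0 mxrank_coker subn_eq0 -ltnNge.
  exact: leq_ltn_trans (rank_leq_row _) JX.
move=> C0; have [i [l Cil]] : exists i l, cokermx A i l != 0.
  apply: contrapT => nC; case/eqP: C0; apply/matrixP => i l; rewrite [RHS]mxE.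
  by apply/eqP; apply: contrapT => /negP Cil; apply: nC; exists i, l.
have [|N N0 [chi chiM chiE]] := relation_matrix_zhom (U := col l (cokermx A)) pr.
  by rewrite colE mulmxA mulmx_coker mul0mx.
exists chi => //; exists (y (enum_val i)) => chi0.
have /eqP := chiE (free_gen (enum_val i)).
rewrite free_eval_gen chi0 eq_sym mulf_eq0 intr_eq0 (negPf N0) mxE.
rewrite (bigD1 i) // big1 => [/=|i' ii'].
  rewrite addr0 [exponent_row _ _ _]mxE [col _ _ _ _]mxE.
  rewrite /exponent additive_extension_gen eqxx mul1r.
  by rewrite (negPf Cil).
rewrite [exponent_row _ _ _]mxE /exponent additive_extension_gen (inj_eq enum_val_inj).
by rewrite (negPf ii') mul0r.
Qed.

(** An alias, so that the abelianisation can be the target of a [zhom]. *)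
Definition additive_abelianization (G : groupType) : Type := abelianization G.

Section AdditiveAbelianization.
Variable G : groupType.
Local Notation A := (additive_abelianization G).

HB.instance Definition _ := Choice.copy A (abelianization G).

Lemma abelianization_commute (a b : abelianization G) : (a * b = b * a)%g.
Proof.
have [x <-] := quotient_map_surj a; have [z <-] := quotient_map_surj b.
rewrite -!multM; apply/quotient_eqP.
have -> : ((x * z)^-1 * (z * x) = [~ z, x])%g.
  by rewrite /commg /conjg invgM !mulgA.
by apply: sub_generated; exists z => //; exists x.
Qed.

Let addA : associative (fun a b : A => a * b : abelianization G)%g.
Proof. exact: (@mulgA (abelianization G)). Qed.
Let addC : commutative (fun a b : A => a * b : abelianization G)%g.
Proof. exact: abelianization_commute. Qed.
Let add0 : left_id (1%g : abelianization G) (fun a b : A => a * b : abelianization G)%g.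
Proof. exact: mul1g. Qed.
Let addV : left_inverse (1%g : abelianization G) (fun a : A => (a : abelianization G)^-1)%g
  (fun a b : A => a * b : abelianization G)%g.
Proof. exact: mulVg. Qed.

HB.instance Definition _ := GRing.isZmodule.Build A addA addC add0 addV.

Definition to_additive_abelianization (g : G) : A := quotient_map (derived G) g.

Lemma to_additive_abelianization_zhom : zhom to_additive_abelianization.
Proof. by move=> g h; exact: (multM (quotient_map (derived G))). Qed.

End AdditiveAbelianization.

Lemma expgz_additive (G : groupType) (x : abelianization G) (a : int) :
  expgz x a = (x : additive_abelianization G) *~ a.
Proof.
have eN n : (x ^+ n)%g = (x : additive_abelianization G) *+ n.
  by elim: n => [|n IH]; rewrite ?expg0 // expgS IH mulrS.
by case: a => n /=; rewrite eN.
Qed.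

(** Independent classes remain so after tensoring with the rationals, where they
    have a dual family of linear forms; a common denominator makes it integral. *)
Lemma dual_zhoms (G : groupType) (b : nat) (x : 'I_b -> abelianization G) :
  deficient G -> Z_independent x ->
  exists (chi : 'I_b -> G -> int) (g : 'I_b -> G), (forall i, zhom (chi i)) /\
    forall i j, (chi i (g j) == 0) = (i != j).
Proof.
move=> [X [J [y [r [pr _]]]]] xind.
pose f := @to_additive_abelianization G.
have fM : zhom f by exact: to_additive_abelianization_zhom.
have [ysurj yr _] := pr.
have /choice [w wE] : forall i, exists w, f (free_eval y w) = x i.
  move=> i; have [g gE] := quotient_map_surj (x i); have [w wg] := ysurj g.
  by exists w; rewrite wg.
have ind (a : 'I_b -> int) : \sum_i f (free_eval y (w i)) *~ a i = 0 -> forall i, a i = 0.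
  move=> rel; apply: xind.
  rewrite -[RHS]/(0 : additive_abelianization G) -rel.
  rewrite (big_morph (fun u : abelianization G => u : additive_abelianization G)
    (op1 := +%R) (op2 := mul) (id1 := 0) (id2 := 1%g)) //.
  by apply: eq_bigr => i _; rewrite wE expgz_additive.
pose A := relation_matrix r.
pose E : 'M[rat]_(b, #|X|) := \matrix_(i, l) (exponent (enum_val l) (w i))%:~R.
have feM : zhom (f \o free_eval y) by move=> u v; rewrite /= free_evalM fM.
(* A linear relation between the classes modulo the relations, once freed of its
   denominators, is a relation in the abelianisation. *)
have Efree : row_free (E *m cokermx A).
  rewrite -kermx_eq0; apply/eqP/row_matrixP => i; rewrite row0.
  have : row i (kermx (E *m cokermx A)) *m (E *m cokermx A) = 0.
    by apply/sub_kermxP/row_sub.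
  move: (row i _) => v; rewrite mulmxA => /eqP; rewrite -submxE => /submxP [c vE].
  pose q (l : 'I_b + 'I_#|J|) := match l with inl i => v 0 i | inr j => c 0 j end.
  have [N N0 [z zE]] := common_denominator q.
  have zvE l : \sum_i z (inl i) * exponent l (w i) = \sum_j z (inr j) * exponent l (r (enum_val j)).
    apply/(@intr_inj rat); rewrite !rmorph_sum /=.
    have /matrixP /(_ 0 (enum_rank l)) := vE; rewrite !mxE.
    move/(congr1 (fun u => N%:~R * u)); rewrite !mulr_sumr => e.
    transitivity (\sum_i0 N%:~R * (v 0 i0 * E i0 (enum_rank l))).
      by apply: eq_bigr => i0 _; rewrite mulrA (zE (inl i0)) mxE enum_rankK intrM.
    rewrite e; apply: eq_bigr => j _.
    by rewrite mulrA (zE (inr j)) mxE enum_rankK intrM.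
  have z0 : forall i0, z (inl i0) = 0.
    apply: ind.
    rewrite (eq_bigr (fun i0 => \sum_l f (y l) *~ (z (inl i0) * exponent l (w i0)))); last first.
      move=> i0 _; rewrite -[f _]/((f \o free_eval y) (w i0)) (zhom_exponents _ feM).
      rewrite mulrz_suml; apply: eq_bigr => l _.
      by rewrite /= free_eval_gen -mulrzA mulrC.
    rewrite exchange_big /=.
    rewrite (eq_bigr (fun l =>
      \sum_j f (y l) *~ (z (inr j) * exponent l (r (enum_val j))))); last first.
      by move=> l _; rewrite -!mulrz_sumr zvE.
    rewrite exchange_big /= big1 // => j _.
    rewrite (eq_bigr (fun l => (f \o free_eval y) (free_gen l) *~
      exponent l (r (enum_val j)) *~ z (inr j))); last first.
      by move=> l _; rewrite /= free_eval_gen -mulrzA mulrC.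
    by rewrite -mulrz_suml -(zhom_exponents _ feM) /= yr zhom1 // mul0rz.
  apply/rowP => i0; rewrite [RHS]mxE; apply/eqP.
  have /eqP := zE (inl i0); rewrite z0 mulf_eq0 intr_eq0 (negPf N0) /=.
  by [].
pose U := cokermx A *m pinvmx (E *m cokermx A).
have AU : A *m U = 0 by rewrite mulmxA mulmx_coker mul0mx.
have EU : E *m U = 1%:M by rewrite mulmxA mulmxVp.
have /choice [chi chiP] : forall i, exists chi : G -> int, zhom chi /\
    forall j, (chi (free_eval y (w j)) == 0) = (i != j).
  move=> i; have [|N N0 [chi chiM chiE]] := relation_matrix_zhom (U := col i U) pr.
    by rewrite colE mulmxA -/A AU mul0mx.
  exists chi; split=> // j; rewrite -(intr_eq0 rat) chiE mulf_eq0 intr_eq0 (negPf N0) /=.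
  have -> : exponent_row (w j) = row j E by apply/rowP => l; rewrite !mxE.
  by rewrite colE mulmxA -row_mul EU row1 -colE !mxE eqxx pnatr_eq0 eqb0 eq_sym.
exists chi, (fun j => free_eval y (w j)); split=> [i|i j]; first by case: (chiP i).
by case: (chiP i) => _ ->.
Qed.

Definition independent_zhoms (G : groupType) (chi1 chi2 : G -> int) :=
  forall a b : int, (forall g, a * chi1 g + b * chi2 g = 0) -> a = 0 /\ b = 0.

Lemma two_zhoms (G : groupType) (b : nat) : deficient G -> first_betti G b ->
  (2 <= b)%N -> exists chi1 chi2 : G -> int,
    [/\ zhom chi1, zhom chi2 & independent_zhoms chi1 chi2].
Proof.
move=> dG [[x xind] _] b2; have [chi [g [chiM chig]]] := dual_zhoms dG xind.
pose i1 := Ordinal (ltnW b2); pose i2 := Ordinal b2.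
exists (chi i1), (chi i2); split=> // a1 a2 rel; split.
  have := rel (g i1); have /eqP -> : chi i2 (g i1) == 0 by rewrite chig.
  by move/eqP; rewrite mulr0 addr0 mulf_eq0 chig eqxx orbF => /eqP.
have := rel (g i2); have /eqP -> : chi i1 (g i2) == 0 by rewrite chig.
by move/eqP; rewrite mulr0 add0r mulf_eq0 chig eqxx orbF => /eqP.
Qed.

(** * Newton polygons of polynomials in two variables *)

Import Order.TTheory GRing.Theory Num.Theory.
Local Open Scope ring_scope.
Local Open Scope classical_set_scope.

Section Newton.
Variable k : fieldType.
Implicit Types (f g h : {poly {poly k}}).

Section Weight.
Variables (p q : int).
Hypothesis q0 : 0 < q.

Definition weight (i j : nat) : int := p * i%:Z + q * j%:Z.

Lemma weightD i j i' j' : weight (i + i') (j + j') = weight i j + weight i' j'.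
Proof. by rewrite /weight !PoszD; ring. Qed.

(** The top face of a Newton polygon in the direction [(p, q)] is an edge or a
    vertex; ties between the weights are broken so that [b] selects one of its two
    ends as the leading term. *)
Definition weight_le (b : bool) (i j i' j' : nat) : Prop :=
  weight i j < weight i' j' \/
  weight i j = weight i' j' /\ (if b then i <= i' else i' <= i)%N.

Definition leading b g i j :=
  g`_i`_j != 0 /\ forall i' j', g`_i'`_j' != 0 -> weight_le b i' j' i j.

Lemma weight_le_sum b i1 j1 i2 j2 i1' j1' i2' j2' :
  weight_le b i1 j1 i1' j1' -> weight_le b i2 j2 i2' j2' ->
  weight_le b (i1 + i2) (j1 + j2) (i1' + i2') (j1' + j2').
Proof. by rewrite /weight_le !weightD; case: b; lia. Qed.

Lemma weight_le_sum_eq b i1 j1 i2 j2 i1' j1' i2' j2' :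
  weight_le b i1 j1 i1' j1' -> weight_le b i2 j2 i2' j2' ->
  (i1 + i2 = i1' + i2')%N -> (j1 + j2 = j1' + j2')%N -> i1 = i1' /\ j1 = j1'.
Proof.
move=> h1 h2 ei ej.
have := weightD i1 j1 i2 j2; rewrite ei ej weightD => eW.
have [ei1 eW1] : i1 = i1' /\ weight i1 j1 = weight i1' j1'.
  by move: h1 h2; rewrite /weight_le; case: b; lia.
split=> //; move: eW1; rewrite /weight ei1 => /addrI/(mulfI _).
by rewrite gt_eqF // => /(_ isT) [].
Qed.

Lemma coefM2 g h i j : (g * h)`_i`_j =
  \sum_(a < i.+1) \sum_(b < j.+1) g`_a`_b * h`_(i - a)`_(j - b).
Proof.
by rewrite coefM coef_sum; apply: eq_bigr => a _; rewrite coefM.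
Qed.

(** For a total order compatible with addition, the leading term of a product comes
    from the leading terms of the factors only. *)
Lemma leadingM b g h i j i' j' : leading b g i j -> leading b h i' j' ->
  leading b (g * h) (i + i') (j + j').
Proof.
move=> [g0 gmax] [h0 hmax]; split.
  have ii' : (i < (i + i').+1)%N by rewrite ltnS leq_addr.
  have jj' : (j < (j + j').+1)%N by rewrite ltnS leq_addr.
  rewrite coefM2 (bigD1 (Ordinal ii')) //= [X in _ + X]big1 => [|a ai]; last first.
    apply: big1 => c _; apply/eqP; apply: contrapT => /negP.
    rewrite mulf_eq0 negb_or => /andP [/gmax gac /hmax hac].
    have [||ea _] := weight_le_sum_eq gac hac; try by rewrite subnKC // -ltnS.
    by case/eqP: ai; apply: val_inj.
  rewrite addr0 (bigD1 (Ordinal jj')) //= [X in _ + X]big1 => [|c cj]; last first.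
    apply/eqP; apply: contrapT => /negP.
    rewrite mulf_eq0 negb_or => /andP [/gmax gac /hmax hac].
    have [||_ ec] := weight_le_sum_eq gac hac; first by rewrite subnKC // leq_addr.
      by rewrite subnKC // -ltnS.
    by case/eqP: cj; apply: val_inj.
  by rewrite addr0 !addKn mulf_neq0.
move=> a c; rewrite coefM2 => /eqP s0.
have [a' [c' [gac hac]]] : exists (a' : 'I_a.+1) (c' : 'I_c.+1),
    g`_a'`_c' != 0 /\ h`_(a - a')`_(c - c') != 0.
  apply: contrapT => n; apply: s0; apply: big1 => a' _; apply: big1 => c' _.
  apply/eqP; apply: contrapT => /negP; rewrite mulf_eq0 negb_or => /andP [? ?].
  by apply: n; exists a', c'.
have := weight_le_sum (gmax _ _ gac) (hmax _ _ hac).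
by rewrite !subnKC // -ltnS.
Qed.

Lemma leading_uniq b g i j i' j' : leading b g i j -> leading b g i' j' -> i = i'.
Proof.
move=> [g0 gmax] [g0' gmax']; have := gmax _ _ g0'; have := gmax' _ _ g0.
by rewrite /weight_le; case: b {gmax gmax'}; lia.
Qed.

(** The factor [2 n] makes the weight prevail over the tie-break, which is less than
    [n] in absolute value. *)
Lemma lexicographic_key b (W W' : int) (n a a' : nat) : (a < n)%N -> (a' < n)%N ->
  W * (2 * n%:Z) + (if b then a%:Z else - a%:Z) <=
    W' * (2 * n%:Z) + (if b then a'%:Z else - a'%:Z) ->
  W < W' \/ W = W' /\ (if b then a <= a' else a' <= a)%N.
Proof.
move=> an a'n le.
have [WW'|WW'|WW'] := ltgtP W W'; first by left.
  have W1 : W' + 1 <= W by rewrite -lerBrDr lerBrDr lezD1.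
  by case: b le; nia.
by right; split=> //; rewrite WW' lerD2l in le; case: b le; lia.
Qed.

Lemma leading_exists b g : g != 0 -> exists i j, leading b g i j.
Proof.
move=> g0; pose n := size g.
pose m := \max_(i < n) size (g`_i)%R.
pose P (x : 'I_n * 'I_m) := g`_x.1`_x.2 != 0.
have inP i j : g`_i`_j != 0 -> exists x : 'I_n * 'I_m, x.1 = i :> nat /\ x.2 = j :> nat.
  move=> gij.
  have i_n : (i < n)%N.
    by rewrite ltnNge; apply: contra gij => /(nth_default 0) ->; rewrite coef0.
  have j_m : (j < m)%N.
    rewrite (leq_trans _ (leq_bigmax (Ordinal i_n))) //= ltnNge.
    by apply: contra gij => /(nth_default 0) ->.
  by exists (Ordinal i_n, Ordinal j_m).
have [x0 Px0] : exists x, P x.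
  have := g0; rewrite -lead_coef_eq0 => lc0.
  have := lc0; rewrite -lead_coef_eq0 => llc0.
  have [x [x1 x2]] := inP _ _ llc0; by exists x; rewrite /P x1 x2.
pose key (x : 'I_n * 'I_m) : int :=
  weight x.1 x.2 * (2 * n%:Z) + (if b then (x.1 : nat)%:Z else - (x.1 : nat)%:Z).
have [x Px xmax] := @Order.TotalTheory.arg_maxP _ _ _ x0 P key Px0.
exists x.1, x.2; split=> // i j gij; have [x' [x'1 x'2]] := inP _ _ gij.
have Px' : P x' by rewrite /P x'1 x'2.
have : key x' <= key x := xmax _ Px'; rewrite -x'1 -x'2 /key /weight_le.
exact: lexicographic_key.
Qed.

(** The Newton polygon has a single top point in the direction [(p, q)]. *)
Definition vertex g i j :=
  g`_i`_j != 0 /\ forall i' j', g`_i'`_j' != 0 -> (i', j') <> (i, j) ->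
    weight i' j' < weight i j.

Lemma vertex_leading b g i j : vertex g i j -> leading b g i j.
Proof.
move=> [g0 gmax]; split=> // i' j' g'.
have [e|ne] := pselect ((i', j') = (i, j)); last by left; apply: gmax.
by case: e => -> ->; right; case: b.
Qed.

Lemma leading_const b (c : {poly k}) : c != 0 -> leading b c%:P 0 (size c).-1.
Proof.
move=> c0; split; first by rewrite coefC eqxx -lead_coefE lead_coef_eq0.
move=> i j; rewrite coefC; have [->|_] := eqVneq i 0%N; last by rewrite coef0 eqxx.
move=> cj; have jc : (j <= (size c).-1)%N.
  by rewrite -ltnS (leq_trans _ (leqSpred _)) // ltnNge; apply: contra cj => /(nth_default 0) ->.
rewrite /weight_le /weight !mulr0 !add0r; case: b; nia.
Qed.

End Weight.

(** Here [s] is the outer variable, with exponents [i], and [t] the inner one. Choose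
    [(p, q)] normal to the edge of the upper boundary of the Newton polygon of [g]
    that arrives at its last column. Both ends of top faces add up under
    multiplication, so the top face of a multiple of [g] has two ends in distinct
    columns, whereas that of [c f] is a single point. *)
Lemma edge_not_vertex g : (1 < size g)%N -> g`_0 != 0 ->
  exists p q : int, 0 < q /\ forall (c : {poly k}) f h i j,
    c != 0 -> vertex p q f i j -> c%:P * f <> g * h.
Proof.
move=> g1 g00; pose r := (size g).-1.
have r0 : (0 < r)%N by rewrite /r -subn1 subn_gt0.
have gr : g`_r != 0 by rewrite -lead_coefE lead_coef_eq0 -size_poly_gt0 ltnW.
pose d i := (size (g`_i)).-1.
have dP i j : g`_i`_j != 0 -> (j <= d i)%N.
  move=> gij; rewrite -ltnS (leq_trans _ (leqSpred _)) // ltnNge.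
  by apply: contra gij => /(nth_default 0) ->.
have gd i : g`_i != 0 -> g`_i`_(d i) != 0 by rewrite -lead_coefE lead_coef_eq0.
(* Minus the slope of the segment from column [i] to the last column; the edge is
   the segment that maximises it. *)
pose slope (i : 'I_r) : rat := ((d i)%:Z - (d r)%:Z)%:~R / (r - i)%:R.
have [m gm mmax] := @Order.TotalTheory.arg_maxP _ _ _ (Ordinal r0)
  [pred i : 'I_r | g`_i != 0] slope g00.
pose q : int := (r - m)%:Z; pose p : int := (d m)%:Z - (d r)%:Z.
have q0 : 0 < q by rewrite /q ltz_nat subn_gt0.
have slopeP (i : 'I_r) : g`_i != 0 ->
    ((d i)%:Z - (d r)%:Z) * (r - m)%:Z <= ((d m)%:Z - (d r)%:Z) * (r - i)%:Z.
  move=> gi; have : slope i <= slope m := mmax i gi; rewrite /slope.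
  rewrite ler_pdivrMr ?ltr0n ?subn_gt0 // mulrAC ler_pdivlMr ?ltr0n ?subn_gt0 //.
  by rewrite !pmulrn -!intrM ler_int.
have gmaxw i j : g`_i`_j != 0 -> (i <= r)%N /\ weight p q i j <= weight p q r (d r).
  move=> gij; have jd := dP _ _ gij.
  have gi : g`_i != 0 by apply: contraNneq gij => ->; rewrite coef0.
  have ir : (i <= r)%N.
    rewrite -ltnS (leq_trans _ (leqSpred _)) // ltnNge.
    by apply: contra gi => /(nth_default 0) ->.
  split=> //; apply: (@le_trans _ _ (weight p q i (d i))).
    by rewrite /weight lerD2l ler_pM2l.
  move: ir; rewrite leq_eqVlt => /orP [/eqP -> //|ir].
  have := slopeP (Ordinal ir) gi; rewrite /weight /p /q /=.
  rewrite -!subzn ?(ltnW ir) ?(ltnW (ltn_ord m)) //.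
  by nia.
exists p, q; split=> // c f h i j c0 fv cfE.
have lcf b : leading p q b (c%:P * f) i ((size c).-1 + j).
  have := leadingM q0 (leading_const p q0 b c0) (vertex_leading b fv).
  by rewrite add0n.
have h0 : h != 0.
  apply/eqP => h0; have [+ _] := lcf true.
  by rewrite cfE h0 mulr0 !coef0 eqxx.
have lgp : leading p q true g r (d r).
  split; first exact: gd.
  move=> i' j' /gmaxw [ir]; rewrite le_eqVlt => /orP [/eqP|]; rewrite /weight_le; auto.
have g0 : g != 0 by rewrite -size_poly_gt0 ltnW.
have [i2 [j2 lgm]] := leading_exists p q0 false g0.
have [a [b lhp]] := leading_exists p q0 true h0.
have [a2 [b2 lhm]] := leading_exists p q0 false h0.
have Wm : weight p q m (d m) = weight p q r (d r).
  rewrite /weight /p /q -subzn ?(ltnW (ltn_ord m)) //; ring.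
have i2m : (i2 <= m)%N.
  have [gij2 /(_ m (d m) (gd _ gm))] := lgm.
  have [_] := gmaxw _ _ gij2; rewrite /weight_le Wm; lia.
have a2a : (a2 <= a)%N.
  have [h1 /(_ a2 b2)] := lhp; have [h2 /(_ a b)] := lhm.
  by rewrite /weight_le => /(_ h1) + /(_ h2); lia.
have lm := leadingM q0 lgm lhm; have lp := leadingM q0 lgp lhp.
rewrite -cfE in lm lp.
have e1 : (i2 + a2 = i)%N by apply: leading_uniq lm (lcf false).
have e2 : (r + a = i)%N by apply: leading_uniq lp (lcf true).
by have := ltn_ord m; lia.
Qed.

(** Let [g] be an element of least degree in [s]; by saturation its constant
    coefficient may be taken nonzero. Pseudo-division by [g] gives, for every [f] in
    the ideal, a multiple [c f] of [g] with [c] in [k[t]]. If [g] is not constant in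
    [s] this contradicts [edge_not_vertex]. *)
Lemma ideal_meets_constants (S : {poly {poly k}} -> Prop) :
  (forall f g, S f -> S g -> S (f - g)) -> (forall f g, S g -> S (f * g)) ->
  (forall f, S ('X * f) -> S f) ->
  (forall p q : int, 0 < q -> exists f i j, S f /\ vertex p q f i j) ->
  exists2 c : {poly k}, c != 0 & S c%:P.
Proof.
move=> SB SM SX Sv.
pose P n := `[< exists g, [/\ S g, g != 0 & size g = n] >].
have exP : exists n, P n.
  have [f [i [j [Sf [fij _]]]]] := Sv 0 1 isT.
  exists (size f); apply/asboolP; exists f; split=> //.
  by apply: contraNneq fij => ->; rewrite !coef0.
have [n /asboolP [g [Sg g0 gn]] nmin] := ex_minnP exP.
have small f : S f -> (size f < size g)%N -> f = 0.
  move=> Sf fg; apply/eqP; apply: contrapT => /negP f0.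
  have : P (size f) by apply/asboolP; exists f.
  by move=> /nmin; rewrite -gn leqNgt fg.
have [g1|g1] := leqP (size g) 1.
  exists g`_0; last by rewrite -size1_polyC.
  by move: g0; rewrite {1}(size1_polyC g1) polyC_eq0.
have [g00|g00] := eqVneq g`_0 0.
  have [g' gE] : exists g', g = 'X * g'.
    have /factor_theorem [g' ->] : root g 0 by rewrite /root horner_coef0 g00.
    by exists g'; rewrite subr0 mulrC.
  have g'0 : g' != 0 by apply: contraNneq g0 => g'0; rewrite gE g'0 mulr0.
  case: (elimN eqP g'0); apply: small; first by apply: SX; rewrite -gE.
  by rewrite gE mulrC size_mulX.
have [p [q [q0 nv]]] := edge_not_vertex g1 g00.
have [f [i [j [Sf fv]]]] := Sv p q q0.
have := Pdiv.ComRing.rdivp_eq g f; set c := _ ^+ _ => cfE.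
have m0 : Pdiv.Ring.rmodp f g = 0.
  apply: small; last by rewrite Pdiv.Ring.ltn_rmodp.
  have -> : Pdiv.Ring.rmodp f g = c%:P * f - Pdiv.Ring.rdivp f g * g.
    by rewrite mul_polyC cfE addrC addKr.
  by apply: SB; apply: SM.
have := nv c f (Pdiv.Ring.rdivp f g) i j; case=> //.
  by rewrite expf_neq0 // lead_coef_eq0.
by rewrite mul_polyC cfE m0 addr0 mulrC.
Qed.

(** The leading coefficient of [a] times a power of [t] is divisible by [c]; subtract
    it and repeat. *)
Lemma constant_divides (c : {poly k}) f a b (j : nat) :
  lead_coef f = 'X^j -> f * a = c%:P * b ->
  exists e b', ('X^e)%:P * a = c%:P * b'.
Proof.
move=> fj; have [n] := ubnP (size a); elim: n a b => // n IH a b.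
rewrite ltnS => an fa.
have [->|a0] := eqVneq a 0; first by exists 0%N, 0; rewrite !mulr0.
pose d := (size a).-1; pose e := b`_(size (f * a)).-1.
have le : 'X^j * lead_coef a = c * e.
  by rewrite -fj -lead_coefM lead_coefE /e fa coefCM.
pose a1 := ('X^j)%:P * a - ('X^j * lead_coef a)%:P * 'X^d.
have a1E : f * a1 = c%:P * (('X^j)%:P * b - f * e%:P * 'X^d).
  rewrite /a1 le polyCM mulrBr mulrCA fa; ring.
have a1n : (size a1 < n)%N.
  apply: (@leq_trans (size a)) => //.
  rewrite [X in (_ < X)%N]polySpred // ltnS; apply/leq_sizeP => i.
  rewrite /a1 coefB !coefCM coefXn.
  rewrite leq_eqVlt => /orP [/eqP <-|di]; first by rewrite eqxx mulr1 lead_coefE subrr.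
  rewrite gtn_eqF // mulr0 subr0 (nth_default 0) ?mulr0 //.
  by rewrite (leq_trans (leqSpred _)).
have [e' [b' a1b']] := IH _ _ a1n a1E.
exists (e' + j)%N, (b' + ('X^e')%:P * e%:P * 'X^d).
have -> : ('X^(e' + j))%:P * a = ('X^e')%:P * (a1 + c%:P * e%:P * 'X^d) :> {poly {poly k}}.
  by rewrite /a1 le polyCM exprD polyCM; ring.
by rewrite mulrDr a1b'; ring.
Qed.

End Newton.

(** * Laurent polynomials *)

Section Laurent.
(* [F] is the field of fractions of [k[t][s]], or any field that contains this
   ring. *)
Variables (k F : fieldType) (toF : {rmorphism {poly {poly k}} -> F}).
Hypothesis toF_inj : injective toF.

Let toF_eq0 f : (toF f == 0) = (f == 0).
Proof. by rewrite -(inj_eq toF_inj) rmorph0. Qed.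

Definition mono (a b : int) : F := toF 'X ^ a * toF ('X%:P) ^ b.

Let X0 : toF 'X != 0. Proof. by rewrite toF_eq0 polyX_eq0. Qed.
Let T0 : toF ('X%:P) != 0. Proof. by rewrite toF_eq0 polyC_eq0 polyX_eq0. Qed.

Lemma monoD a b a' b' : mono (a + a') (b + b') = mono a b * mono a' b'.
Proof. by rewrite /mono !expfzDr // mulrACA. Qed.

Lemma mono0 : mono 0 0 = 1.
Proof. by rewrite /mono !expr0z mulr1. Qed.

Lemma mono_neq0 a b : mono a b != 0.
Proof. by rewrite mulf_neq0 // expfz_neq0. Qed.

Lemma monoN a b : mono (- a) (- b) = (mono a b)^-1.
Proof.
apply: (mulfI (mono_neq0 a b)); rewrite -monoD !subrr mono0 divff //.
exact: mono_neq0.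
Qed.

Lemma mono_nat (a b : nat) : mono a b = toF ('X^a * ('X^b)%:P).
Proof. by rewrite /mono -!exprnP -!rmorphXn -rmorphM /= polyC_exp. Qed.

Lemma monoX a b n : mono a b ^+ n = mono (a *+ n) (b *+ n).
Proof.
by elim: n => [|n IH]; rewrite ?mulr0n ?mono0 // exprS IH !mulrS monoD.
Qed.

Lemma mono_eq1 a b : mono a b = 1 -> a = 0.
Proof.
move=> ab1; pose M := maxn (absz a) (absz b).
have [i iE] : exists i : nat, i%:Z = a + M%:Z by exists (absz (a + M%:Z)); rewrite /M; lia.
have [j jE] : exists j : nat, j%:Z = b + M%:Z by exists (absz (b + M%:Z)); rewrite /M; lia.
have : toF ('X^i * ('X^j)%:P) = toF ('X^M * ('X^M)%:P).
  by rewrite -!mono_nat iE jE monoD ab1 mul1r.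
have sz c e : size ('X^c * ('X^e)%:P : {poly {poly k}}) = c.+1.
  by rewrite mulrC mul_polyC size_scale ?size_polyXn // -size_poly_eq0 size_polyXn.
by move=> /toF_inj /(congr1 (fun f : {poly {poly k}} => size f)); rewrite !sz; lia.
Qed.

Definition scalar (c : k) : F := toF (c%:P%:P).

(** The last index is the value at [s = t = 1], which the elements of [F] in
    general do not have; the exponents are those allowed by [P]. *)
Inductive laurent_value (P : int -> int -> Prop) : F -> k -> Prop :=
| LaurentZero : laurent_value P 0 0
| LaurentTerm c a b x v : P a b -> laurent_value P x v ->
    laurent_value P (scalar c * mono a b + x) (c + v).

Definition laurent_on P x := exists v, laurent_value P x v.

Lemma laurent_value_sub (P Q : int -> int -> Prop) x v :
  (forall a b, P a b -> Q a b) -> laurent_value P x v -> laurent_value Q x v.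
Proof.
move=> PQ; elim=> [|c a b {}x {}v Pab _ IH]; first exact: LaurentZero.
by apply: LaurentTerm => //; apply: PQ.
Qed.

Lemma laurent_valueD P x y v w : laurent_value P x v -> laurent_value P y w ->
  laurent_value P (x + y) (v + w).
Proof.
move=> + yw; elim=> [|c a b {}x {}v Pab _ IH]; first by rewrite !add0r.
by rewrite -!addrA; apply: LaurentTerm.
Qed.

Lemma laurent_value_mono P c a b : P a b -> laurent_value P (scalar c * mono a b) c.
Proof.
move=> Pab; rewrite -[X in laurent_value _ X _]addr0 -[X in laurent_value _ _ X]addr0.
by apply: LaurentTerm => //; exact: LaurentZero.
Qed.

Lemma scalarM c d : scalar (c * d) = scalar c * scalar d.
Proof. by rewrite /scalar !polyCM rmorphM. Qed.

Lemma scalar1 : scalar 1 = 1.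
Proof. by rewrite /scalar !polyC1 rmorph1. Qed.

Lemma laurent_valueM (P Q R : int -> int -> Prop) x y v w :
  (forall a b a' b', P a b -> Q a' b' -> R (a + a') (b + b')) ->
  laurent_value P x v -> laurent_value Q y w -> laurent_value R (x * y) (v * w).
Proof.
move=> PQR + yw; elim=> [|c a b {}x {}v Pab _ IH].
  by rewrite !mul0r; exact: LaurentZero.
rewrite !mulrDl; apply: laurent_valueD => //; elim: yw => [|d a' b' y' w' Qab _ IHy].
  by rewrite !mulr0; exact: LaurentZero.
rewrite !mulrDr mulrACA -scalarM -monoD; apply: LaurentTerm => //.
exact: PQR.
Qed.

Lemma laurent_onD P x y : laurent_on P x -> laurent_on P y -> laurent_on P (x + y).
Proof. by move=> [v xv] [w yw]; exists (v + w); exact: laurent_valueD. Qed.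

Lemma laurent_onM (P Q R : int -> int -> Prop) x y :
  (forall a b a' b', P a b -> Q a' b' -> R (a + a') (b + b')) ->
  laurent_on P x -> laurent_on Q y -> laurent_on R (x * y).
Proof. by move=> PQR [v xv] [w yw]; exists (v * w); exact: laurent_valueM xv yw. Qed.

Lemma laurent_on_mono (P : int -> int -> Prop) a b : P a b -> laurent_on P (mono a b).
Proof.
by move=> Pab; exists 1; rewrite -[mono a b]mul1r -scalar1; apply: laurent_value_mono.
Qed.

Lemma laurent_onN P x : laurent_on P x -> laurent_on P (- x).
Proof.
move=> [v]; elim=> [|c a b {}x {}v Pab _ [w IH]].
  by rewrite oppr0; exists 0; exact: LaurentZero.
exists (- c + w); rewrite opprD -mulNr (_ : - scalar c = scalar (- c)).
  exact: LaurentTerm.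
by rewrite /scalar !polyCN rmorphN.
Qed.

Lemma laurent_on_sub (P Q : int -> int -> Prop) x :
  (forall a b, P a b -> Q a b) -> laurent_on P x -> laurent_on Q x.
Proof. by move=> PQ [v xv]; exists v; exact: laurent_value_sub xv. Qed.

(** The negative exponents are cleared by the monomial with exponents [M], [M]. *)
Lemma laurent_value_poly P x v : laurent_value P x v ->
  exists M0 : nat, forall M : nat, (M0 <= M)%N -> exists b : {poly {poly k}},
  [/\ toF b = x * mono M M, b.[1].[1] = v &
      forall i j, b`_i`_j != 0 -> P (i%:Z - M%:Z) (j%:Z - M%:Z)].
Proof.
elim=> [|c a b {}x {}v Pab _ [M0 IH]].
  exists 0%N => M _; exists 0; rewrite rmorph0 mul0r !horner0; split=> // i j.
  by rewrite !coef0 eqxx.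
exists (maxn M0 (maxn `|a| `|b|)) => M; rewrite !geq_max => /and3P [M0M aM bM].
have [f [fE fv fP]] := IH _ M0M.
have [i0 i0E] : exists i0 : nat, i0%:Z = a + M%:Z by exists (absz (a + M%:Z)); lia.
have [j0 j0E] : exists j0 : nat, j0%:Z = b + M%:Z by exists (absz (b + M%:Z)); lia.
exists (c%:P%:P * ('X^i0 * ('X^j0)%:P) + f); split.
- rewrite rmorphD rmorphM /= -mono_nat fE mulrDl; congr (_ + _).
  by rewrite -mulrA -monoD -i0E -j0E.
- rewrite !(hornerD, hornerM, hornerC, hornerXn) !expr1n fv.
  by rewrite hornerC mul1r mulr1.
move=> i j; rewrite coefD coefCM coefMC coefXn.
have [->|ii0] := eqVneq i i0.
  rewrite mul1r coefD coefCM coefXn.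
  have [->|jj0] := eqVneq j j0.
    by move=> _; rewrite i0E j0E !addrK.
  by rewrite mulr0 add0r; exact: fP.
by rewrite mul0r mulr0 add0r; exact: fP.
Qed.

Lemma laurent_value_uniq P Q x v w : laurent_value P x v -> laurent_value Q x w -> v = w.
Proof.
move=> /laurent_value_poly [M xv] /laurent_value_poly [M' xw].
have [f [fE <- _]] := xv _ (leq_maxl M M').
have [g [gE <- _]] := xw _ (leq_maxr M M').
by rewrite (_ : f = g) //; apply: toF_inj; rewrite fE gE.
Qed.

Lemma laurent_vertex (p q : int) (f : F) a0 b0 :
  laurent_on (fun a b => p * a + q * b < p * a0 + q * b0) (f - mono a0 b0) ->
  exists (M : nat) (g : {poly {poly k}}) (i j : nat),
    toF g = f * mono M M /\ vertex p q g i j.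
Proof.
move=> [v /laurent_value_poly [M0 fP]].
pose M := maxn M0 (maxn (absz a0) (absz b0)).
have [g [gE _ gP]] := fP M (leq_maxl _ _).
have [aM bM] : (absz a0 <= M)%N /\ (absz b0 <= M)%N by rewrite /M; lia.
have [i iE] : exists i : nat, i%:Z = a0 + M%:Z by exists (absz (a0 + M%:Z)); lia.
have [j jE] : exists j : nat, j%:Z = b0 + M%:Z by exists (absz (b0 + M%:Z)); lia.
exists M, ('X^i * ('X^j)%:P + g), i, j.
have coefE' i' j' : ('X^i * ('X^j)%:P + g)`_i'`_j' =
    ((i' == i) && (j' == j))%:R + g`_i'`_j'.
  rewrite coefD coefMC coefXn coefD; congr (_ + _).
  by case: (i' == i); rewrite ?mul1r ?coefXn // mul0r coef0.
split.
  by rewrite rmorphD /= -mono_nat gE iE jE monoD mulrBl addrC subrK.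
have weightE i' j' : p * (i'%:Z - M%:Z) + q * (j'%:Z - M%:Z) < p * a0 + q * b0 ->
    weight p q i' j' < weight p q i j.
  rewrite /weight iE jE !mulrBr !mulrDr; lia.
split.
  rewrite coefE' !eqxx /= (_ : g`_i`_j = 0) ?addr0 ?oner_eq0 //.
  apply/eqP; apply: contrapT => /negP /gP /weightE; by rewrite ltxx.
move=> i' j'; rewrite coefE' => + ne; have -> : (i' == i) && (j' == j) = false.
  by apply/negP => /andP [/eqP ii /eqP jj]; apply: ne; rewrite ii jj.
by rewrite add0r => /gP /weightE.
Qed.

Definition laurent := laurent_on (fun _ _ => True).

Lemma laurent0 : laurent 0.
Proof. by exists 0; exact: LaurentZero. Qed.

Lemma laurentD x y : laurent x -> laurent y -> laurent (x + y).
Proof. exact: laurent_onD. Qed.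

Lemma laurentM x y : laurent x -> laurent y -> laurent (x * y).
Proof. exact: laurent_onM. Qed.

Lemma laurent_mono a b : laurent (mono a b).
Proof. exact: laurent_on_mono. Qed.

Lemma laurent_scalar c : laurent (scalar c).
Proof. by exists c; rewrite -[scalar c]mulr1 -mono0; apply: laurent_value_mono. Qed.

Lemma laurent1 : laurent 1.
Proof. by rewrite -mono0; exact: laurent_mono. Qed.

Lemma laurentN x : laurent x -> laurent (- x).
Proof. exact: laurent_onN. Qed.

Lemma laurentB x y : laurent x -> laurent y -> laurent (x - y).
Proof. by move=> xl yl; apply: laurentD => //; exact: laurentN. Qed.

Lemma laurent_sum (I : Type) (r : seq I) (P : pred I) (f : I -> F) :
  (forall i, P i -> laurent (f i)) -> laurent (\sum_(i <- r | P i) f i).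
Proof. by move=> fl; apply: (big_ind laurent) => //; [exact: laurent0 | exact: laurentD]. Qed.

Lemma laurent_poly (f : {poly {poly k}}) : laurent (toF f).
Proof.
elim/poly_ind: f => [|f c IH]; first by rewrite rmorph0; exact: laurent0.
have mX : toF 'X = mono 1 0 by rewrite (mono_nat 1 0) mulr1.
rewrite rmorphD rmorphM mX; apply: laurentD.
  by apply: laurentM => //; exact: laurent_mono.
elim/poly_ind: c => [|c d IHc]; first by rewrite polyC0 rmorph0; exact: laurent0.
have mT : toF 'X%:P = mono 0 1 by rewrite (mono_nat 0 1) mul1r.
rewrite polyCD polyCM rmorphD rmorphM mT; apply: laurentD; last exact: laurent_scalar.
by apply: laurentM => //; exact: laurent_mono.
Qed.

Lemma laurent_clear x : laurent x -> exists M0 : nat, forall M : nat, (M0 <= M)%N ->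
  exists b, toF b = x * mono M M.
Proof.
move=> [v /laurent_value_poly [M0 xP]]; exists M0 => M /xP [b [bE _ _]].
by exists b.
Qed.

(** The element [x / c] of [F] equals [y / f]. By [constant_divides] the denominator
    [c] disappears up to a power of [t], which is invertible here. *)
Lemma laurent_divide (x y : F) (c : {poly k}) (f : {poly {poly k}}) j :
  c != 0 -> lead_coef f = 'X^j -> laurent x -> laurent y ->
  toF f * x = toF c%:P * y -> laurent (x / toF c%:P).
Proof.
move=> c0 fj /laurent_clear [M0 xP] /laurent_clear [M1 yP] fx.
have [a aE] := xP _ (leq_maxl M0 M1); have [b bE] := yP _ (leq_maxr M0 M1).
have fa : f * a = c%:P * b.
  apply: toF_inj.
  by rewrite !rmorphM /= aE bE !mulrA fx.
have [e [b' eE]] := constant_divides fj fa.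
have tc0 : toF c%:P != 0 by rewrite toF_eq0 polyC_eq0.
set M := maxn M0 M1 in aE bE.
have mE : toF ('X^e)%:P = mono 0 e by rewrite (mono_nat 0 e) mul1r.
have : mono 0 e * (x * mono M M) = toF c%:P * toF b'.
  by rewrite -aE -mE -!rmorphM eE.
move=> xE.
have -> : x / toF c%:P = toF b' * mono (- M%:Z) (- (e%:Z + M%:Z)).
  rewrite -[- M%:Z]add0r -{1}oppr0 opprD monoD !monoN.
  apply: (mulIf tc0); rewrite mulfVK // mulrC !mulrA -xE.
  by rewrite [mono 0 e * _]mulrC !mulfK ?mono_neq0.
by apply: laurentM; [exact: laurent_poly | exact: laurent_mono].
Qed.

End Laurent.

(** * The Alexander module of a pair of homomorphisms *)

Lemma expgzD (G : groupType) (x : G) a b : expgz x (a + b) = (expgz x a * expgz x b)%g.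
Proof.
have S c : expgz x (1 + c) = (x * expgz x c)%g.
  case: c => [c|[|c]] /=; first by rewrite expgS.
    by rewrite expg1 mulgV.
  by rewrite subn1 [in RHS]expgSr invgM mulgA mulgV mul1g.
elim/int_ind: a => [|n IH|n IH]; first by rewrite add0r /= expg0 mul1g.
  by rewrite intS -addrA !S IH mulgA.
apply: (mulgI x); rewrite mulgA -!S addrA.
by rewrite (_ : 1 - n.+1%:Z = - n%:Z); [rewrite IH | lia].
Qed.

(** A monomial on the line of weight [0] times [(c, d)^i] has less weight than
    [(c, d)^n], for [i < n]. *)
Lemma weight_dominated (p q a b c d o : int) (i n : nat) :
  p * a + q * b = 0 -> 0 < p * c + q * d -> (i < n)%N ->
  p * (o * a + c *+ i) + q * (o * b + d *+ i) < p * (c *+ n) + q * (d *+ n).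
Proof.
move=> ab0 cd0 i_n.
rewrite -[c *+ i]mulr_natr -[d *+ i]mulr_natr -[c *+ n]mulr_natr -[d *+ n]mulr_natr.
have -> : p * (o * a + c * i%:R) + q * (o * b + d * i%:R) =
    o * (p * a + q * b) + (p * c + q * d) * i%:R by ring.
have -> : p * (c * n%:R) + q * (d * n%:R) = (p * c + q * d) * n%:R by ring.
by rewrite ab0 mulr0 add0r ltr_pM2l // ltr_nat.
Qed.

(** The pair [(chi1, chi2)] maps the kernel of [p chi1 + q chi2] into a line, where
    the image is cyclic. *)
Lemma line_generator (G : groupType) (chi1 chi2 : G -> int) (p q : int) :
  zhom chi1 -> zhom chi2 -> (p != 0) || (q != 0) ->
  exists w, [/\ p * chi1 w + q * chi2 w = 0,
    forall g, p * chi1 g + q * chi2 g = 0 ->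
      exists e : int, chi1 g = e * chi1 w /\ chi2 g = e * chi2 w
    & chi1 w = 0 -> chi2 w = 0 -> w = 1%g].
Proof.
move=> chi1M chi2M.
wlog q0 : p q chi1 chi2 chi1M chi2M / q != 0.
  move=> wl /orP [p0|q0]; last by apply: wl => //; rewrite q0 orbT.
  have [|w [w0 wg w1]] := wl q p chi2 chi1 chi2M chi1M p0; first by rewrite p0 orbT.
  exists w; split=> [|g|*]; first by rewrite addrC.
    by rewrite addrC => /wg [e [? ?]]; exists e.
  exact: w1.
move=> _; have chiM : zhom (fun g => p * chi1 g + q * chi2 g).
  by move=> g h; rewrite chi1M chi2M; ring.
pose K := zhom_kernel chiM.
pose theta (g : group_of K) := chi1 (val g).
have thetaM : zhom theta by move=> g h; rewrite /theta valM chi1M.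
have KP g : p * chi1 g + q * chi2 g = 0 -> g isin K by [].
have prop a b a' b' (e : int) : p * a + q * b = 0 -> p * a' + q * b' = 0 ->
    a' = e * a -> b' = e * b.
  move=> ab ab' a'E; apply: (mulfI q0); apply/eqP.
  have -> : q * b' = - (p * a') by apply/eqP; rewrite -addr_eq0 addrC ab'.
  have -> : q * (e * b) = e * (q * b) by ring.
  have -> : q * b = - (p * a) by apply/eqP; rewrite -addr_eq0 addrC ab.
  by rewrite a'E; apply/eqP; ring.
have [nz|z] := pselect (exists g, theta g <> 0); last first.
  exists 1%g; rewrite !zhom1 // !mulr0 addr0; split=> // g Kg; exists 0.
  have g0 : chi1 g = 0.
    apply: contrapT => g0; apply: z; exists (to_group_of (KP _ Kg)).
    by rewrite /theta to_group_ofK.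
  rewrite !mul0r; split=> //; apply: (prop 0 0 (chi1 g) (chi2 g) 0) => //.
  by rewrite !mulr0 addr0.
have [d [theta' [t [d0 _ t1 thetaE]]]] := zhom_primitive thetaM nz.
exists (val t); have Kt := group_valP t; split=> // [g Kg|t0 _].
  exists (theta' (to_group_of (KP _ Kg))).
  have gE : chi1 g = theta' (to_group_of (KP _ Kg)) * chi1 (val t).
    have := thetaE (to_group_of (KP _ Kg)); have := thetaE t.
    by rewrite /theta t1 mulr1 to_group_ofK => -> ->; rewrite mulrC.
  by split=> //; apply: prop Kg gE.
by have := thetaE t; rewrite /theta t0 t1 mulr1 => d00; rewrite -d00 eqxx in d0.
Qed.

Lemma char_poly_closed (R : comNzRingType) (S : R -> Prop) n (M : 'M[R]_n) :
  S 1 -> (forall x y, S x -> S y -> S (x - y)) ->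
  (forall x y, S x -> S y -> S (x * y)) -> (forall i j, S (M i j)) ->
  forall i, S (char_poly M)`_i.
Proof.
move=> S1 SB SM SMij.
have S0 : S 0 by rewrite -(subrr 1); apply: SB.
have SN x : S x -> S (- x) by move=> Sx; rewrite -sub0r; apply: SB.
have SD x y : S x -> S y -> S (x + y).
  by move=> Sx Sy; rewrite -[y]opprK; apply: SB => //; apply: SN.
pose Q (f : {poly R}) := forall i, S f`_i.
have Q1 : Q 1 by move=> i; rewrite coef1; case: eqP.
have QN f : Q f -> Q (- f) by move=> Qf i; rewrite coefN; apply: SN.
have QD f g : Q f -> Q g -> Q (f + g) by move=> Qf Qg i; rewrite coefD; apply: SD.
have QM f g : Q f -> Q g -> Q (f * g).
  by move=> Qf Qg i; rewrite coefM; apply: (big_ind S) => // *; apply: SM.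
rewrite -/(Q _) /char_poly /determinant; apply: (big_ind Q) => //.
  by move=> i; rewrite coef0.
move=> s _; apply: (QM).
  by case: (odd_perm s); rewrite ?expr0 ?expr1 //; apply: QN.
apply: (big_ind Q Q1 QM) => i _; rewrite !mxE => j; rewrite coefB.
apply: SB; first by rewrite coefMn coefX; case: (j == _); case: (_ == _).
by rewrite coefC; case: eqP.
Qed.

Section Fox.
Variables (k F : fieldType) (toF : {rmorphism {poly {poly k}} -> F}).
Hypothesis toF_inj : injective toF.
Variables (G : groupType) (X J : finType) (y : X -> G) (r : J -> free_group X).
Variables (chi1 chi2 : G -> int).
Hypothesis pres : presentation y r.
Hypothesis chi1M : zhom chi1.
Hypothesis chi2M : zhom chi2.

Local Notation mono := (mono toF).
Local Notation laurent := (laurent toF).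
Local Notation laurent_on := (laurent_on toF).
Local Notation n := #|X|.
Local Notation m := #|J|.

Definition weight_char (g : G) : F := mono (chi1 g) (chi2 g).
Local Notation kap := weight_char.

Lemma weight_charM g h : kap (g * h)%g = kap g * kap h.
Proof. by rewrite /kap chi1M chi2M monoD. Qed.

Lemma weight_char1 : kap 1%g = 1.
Proof. by rewrite /kap !zhom1 // mono0. Qed.

Lemma weight_charV g : kap (g^-1)%g = (kap g)^-1.
Proof. by rewrite /kap !zhomV // monoN. Qed.

Lemma weight_char_neq0 g : kap g != 0.
Proof. exact: mono_neq0. Qed.

Lemma weight_char_laurent g : laurent (kap g).
Proof. exact: laurent_mono. Qed.

Definition fox_act (g : G) (v : 'rV[F]_n) := kap g *: v.

Let act1 v : fox_act 1%g v = v.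
Proof. by rewrite /fox_act weight_char1 scale1r. Qed.
Let actM g h v : fox_act (g * h)%g v = fox_act g (fox_act h v).
Proof. by rewrite /fox_act weight_charM scalerA. Qed.
Let actD g u v : fox_act g (u + v) = fox_act g u + fox_act g v.
Proof. exact: scalerDr. Qed.

(** The row of the Fox derivatives of a word, after the group ring has been mapped to
    [F]. *)
Definition fox : free_group X -> 'rV[F]_n :=
  derivation y fox_act (fun x => delta_mx 0 (enum_rank x)).

Lemma foxM v w : fox (v * w)%g = fox v + kap (free_eval y v) *: fox w.
Proof. exact: derivationM. Qed.

Lemma foxV w : fox (w^-1)%g = - ((kap (free_eval y w))^-1 *: fox w).
Proof. by rewrite /fox derivationV // /fox_act weight_charV. Qed.

Lemma foxME v w i : fox (v * w)%g 0 i = fox v 0 i + kap (free_eval y v) * fox w 0 i.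
Proof. by rewrite foxM !mxE. Qed.

Lemma foxVE w i : fox (w^-1)%g 0 i = - ((kap (free_eval y w))^-1 * fox w 0 i).
Proof. by rewrite foxV !mxE. Qed.

Lemma fox_gen x : fox (free_gen x) = delta_mx 0 (enum_rank x).
Proof. exact: derivation_gen. Qed.

Definition alexander_matrix : 'M[F]_(m, n) := \matrix_(j < m) fox (r (enum_val j)).
Local Notation N := alexander_matrix.

Definition laurent_mx a b (A : 'M[F]_(a, b)) := forall i j, laurent (A i j).

Lemma laurent_mxM a b c (A : 'M[F]_(a, b)) (B : 'M_(b, c)) :
  laurent_mx A -> laurent_mx B -> laurent_mx (A *m B).
Proof.
by move=> Al Bl i j; rewrite mxE; apply: laurent_sum => l _; apply: laurentM.
Qed.

(** Rows that are combinations of the relators with Laurent polynomial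
    coefficients, that is, that vanish in the relative Alexander module. *)
Definition null_rows a (Z : 'M[F]_(a, n)) :=
  exists2 A : 'M[F]_(a, m), laurent_mx A & Z = A *m N.

Lemma null_rows0 a : null_rows (0 : 'M_(a, n)).
Proof. by exists 0; rewrite ?mul0mx // => i j; rewrite mxE; exact: laurent0. Qed.

Lemma null_rowsB a (Z W : 'M_(a, n)) : null_rows Z -> null_rows W -> null_rows (Z - W).
Proof.
move=> [A Al ->] [B Bl ->]; exists (A - B); last by rewrite mulmxBl.
by move=> i j; rewrite !mxE; apply: laurentB.
Qed.

Lemma null_rowsN a (Z : 'M_(a, n)) : null_rows Z -> null_rows (- Z).
Proof. by rewrite -sub0r; apply: null_rowsB; exact: null_rows0. Qed.

Lemma null_rowsD a (Z W : 'M_(a, n)) : null_rows Z -> null_rows W -> null_rows (Z + W).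
Proof. by move=> Zn Wn; rewrite -[W]opprK; apply/null_rowsB/null_rowsN. Qed.

Lemma null_rowsZ a c (Z : 'M_(a, n)) : laurent c -> null_rows Z -> null_rows (c *: Z).
Proof.
move=> cl [A Al ->]; exists (c *: A); last by rewrite scalemxAl.
by move=> i j; rewrite mxE; apply: laurentM.
Qed.

Lemma null_rowsM a b (A : 'M_(a, b)) (Z : 'M_(b, n)) :
  laurent_mx A -> null_rows Z -> null_rows (A *m Z).
Proof.
by move=> Al [B Bl ->]; exists (A *m B); rewrite ?mulmxA //; apply: laurent_mxM.
Qed.

Lemma null_rows_row a (Z : 'M_(a, n)) : (forall i, null_rows (row i Z)) -> null_rows Z.
Proof.
move=> Zr.
have /choice [A AP] : forall i, exists A : 'rV_m, laurent_mx A /\ row i Z = A *m N.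
  by move=> i; have [A] := Zr i; exists A.
exists (\matrix_i A i); first by move=> i j; rewrite mxE; case: (AP i).
by apply/row_matrixP => i; rewrite row_mul rowK; case: (AP i).
Qed.

Lemma fox_wd v w : free_eval y v = free_eval y w -> null_rows (fox v - fox w).
Proof.
move: v w; apply: (derivation_presentation _ _ _ pres (I := @null_rows 1)) => //.
- exact: null_rows0.
- by move=> u v; apply: null_rowsB.
- by move=> g u; apply: null_rowsZ; exact: weight_char_laurent.
move=> j; exists (delta_mx 0 (enum_rank j)).
  by move=> i l; rewrite mxE; case: andP => _; [exact: laurent1 | exact: laurent0].
by rewrite -rowE rowK enum_rankK.
Qed.

Let lift_word g : exists w, free_eval y w = g.
Proof. by case: pres. Qed.

(** A representative in [F^n] of the class of [g] in the Alexander module, computed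
    from an arbitrary word for [g]. *)
Definition fox_class g := fox (projT1 (cid (lift_word g))).

Lemma fox_classE w : null_rows (fox_class (free_eval y w) - fox w).
Proof. by apply: fox_wd; case: cid. Qed.

Lemma fox_classM g h : null_rows (fox_class (g * h)%g - (fox_class g + kap g *: fox_class h)).
Proof.
rewrite /fox_class; case: cid => w /= wE; case: cid => u /= uE; case: cid => v /= vE.
by rewrite -[X in kap X]uE -foxM; apply: fox_wd; rewrite free_evalM uE vE.
Qed.

Lemma fox_classV g : null_rows (fox_class (g^-1)%g + (kap g)^-1 *: fox_class g).
Proof.
rewrite /fox_class; case: cid => w /= wE; case: cid => u /= uE.
by rewrite -[X in kap X]uE -[_ *: _]opprK -foxV; apply: fox_wd; rewrite free_evalV uE.
Qed.

Lemma fox_classJ g h : kap h = 1 ->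
  null_rows (fox_class (g * h * g^-1)%g - kap g *: fox_class h).
Proof.
move=> h1; rewrite /fox_class.
case: cid => w /= wE; case: cid => v /= vE.
have [u uE] := lift_word g.
have -> : kap g *: fox v = fox (u * v * u^-1)%g.
  rewrite !foxM foxV free_evalM !weight_charM uE vE h1 mulr1 scalerN scalerA.
  by rewrite divff ?weight_char_neq0 // scale1r addrAC subrr add0r.
by apply: fox_wd; rewrite !free_evalM free_evalV uE vE.
Qed.

Section Line.
Variables (p q : int) (s0 : G) (s' : seq G).
Local Notation chi g := (p * chi1 g + q * chi2 g).
Local Notation s := (s0 :: s').
Hypothesis pq : (p != 0) || (q != 0).
Hypothesis s_ker : forall g, g \in s -> chi g = 0.
Hypothesis s_gen : forall g, chi g = 0 -> g isin generated [set` s].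
Variable u : G.
Hypothesis u_pos : 0 < chi u.

(** The classes of the common kernel of [chi1] and [chi2] span a module over the
    Laurent polynomials in one monomial [kap w] of weight [0] for [(p, q)]. It is
    finitely generated, since the kernel of [p chi1 + q chi2] is, and stable under
    conjugation by [u]. The characteristic polynomial of this action, evaluated at
    [kap u], annihilates it and has [kap u ^+ size s] for dominant monomial. *)
Lemma vertex_annihilator : exists (f : F) (a0 b0 : int),
  [/\ laurent_on (fun a b => p * a + q * b < p * a0 + q * b0) (f - mono a0 b0),
      laurent f
    & forall g, chi1 g = 0 -> chi2 g = 0 -> null_rows (f *: fox_class g)].
Proof.
have [w [w0 wgen w1]] := line_generator chi1M chi2M pq.
pose P a b := exists e : int, a = e * chi1 w /\ b = e * chi2 w.
(* The ring of coefficients: Laurent polynomials in [kap w]. *)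
pose R0 := laurent_on P.
have R0l x : R0 x -> laurent x by apply: laurent_on_sub.
have R01 : R0 1.
  by rewrite -(mono0 toF); apply: laurent_on_mono; exists 0; rewrite !mul0r.
have R0D x z : R0 x -> R0 z -> R0 (x + z) by exact: laurent_onD.
have R0N x : R0 x -> R0 (- x) by exact: laurent_onN.
have R0B x z : R0 x -> R0 z -> R0 (x - z) by move=> Rx Rz; apply/R0D/R0N.
have R0M x z : R0 x -> R0 z -> R0 (x * z).
  apply: (laurent_onM toF_inj (P := P) (Q := P)) => a b a' b' [e [aE bE]] [e' [aE' bE']].
  by exists (e + e'); rewrite aE bE aE' bE' !mulrDl.
have R00 : R0 0 by rewrite -(subrr 1); exact: R0B.
have chiwX e : chi1 (expgz w e) = e * chi1 w /\ chi2 (expgz w e) = e * chi2 w.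
  by rewrite !zhom_expgz // !mulrzz mulrC [e * chi2 w]mulrC.
have R0w e : R0 (kap (expgz w e)).
  by apply: laurent_on_mono; exists e; case: (chiwX e) => -> ->.
pose nn (j : 'I_(size s).-1.+1) := nth 1%g s j.
have nnK j : chi (nn j) = 0 by apply: s_ker; apply: mem_nth; case: j.
have /choice [e eE] : forall j, exists e : int,
    chi1 (nn j) = e * chi1 w /\ chi2 (nn j) = e * chi2 w.
  by move=> j; apply: wgen.
(* The generators [nn j] are moved into the common kernel by powers of [w]. *)
pose kk j := (nn j * (expgz w (e j))^-1)%g.
have in_ker g e' : chi1 g = e' * chi1 w -> chi2 g = e' * chi2 w ->
    kap (g * (expgz w e')^-1)%g = 1.
  move=> g1 g2; have [w1' w2'] := chiwX e'.
  by rewrite /kap chi1M chi2M !zhomV // g1 g2 w1' w2' !subrr mono0.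
pose Y : 'M[F]_((size s).-1.+1, n) := \matrix_j fox_class (kk j).
pose Sp (v : 'rV[F]_n) := exists c : 'rV[F]_(size s).-1.+1,
  (forall j, R0 (c 0 j)) /\ null_rows (v - c *m Y).
have Sp_null v v' : null_rows (v - v') -> Sp v' -> Sp v.
  move=> vv' [c [cR cv]]; exists c; split=> //.
  by have := null_rowsD vv' cv; rewrite addrA subrK.
have SpB v v' : Sp v -> Sp v' -> Sp (v - v').
  move=> [c [cR cv]] [c' [c'R cv']]; exists (c - c'); split.
    by move=> j; rewrite !mxE; apply: R0B.
  by have := null_rowsB cv cv'; rewrite mulmxBl !opprD !opprK addrACA.
have SpZ x v : R0 x -> Sp v -> Sp (x *: v).
  move=> Rx [c [cR cv]]; exists (x *: c); split.
    by move=> j; rewrite mxE; apply: R0M.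
  by have := null_rowsZ (R0l _ Rx) cv; rewrite scalerBr scalemxAl.
have Sp0 : Sp 0.
  by exists 0; rewrite mul0mx subr0; split; [move=> j; rewrite mxE | exact: null_rows0].
have SpN v : Sp v -> Sp (- v) by move=> Sv; rewrite -sub0r; apply: SpB.
have SpD v v' : Sp v -> Sp v' -> Sp (v + v').
  by move=> Sv Sv'; rewrite -[v']opprK; apply: SpB => //; apply: SpN.
(* The elements whose component in the common kernel has its class in the span
   [Sp]; they form a subgroup, which contains the generators. *)
pose T : set G := fun g => exists e' : int, [/\ chi1 g = e' * chi1 w,
  chi2 g = e' * chi2 w & Sp (fox_class (g * (expgz w e')^-1)%g)].
have class1 : null_rows (fox_class 1%g).
  by have := fox_classE 1%g; rewrite free_eval1 /fox derivation1 subr0.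
have T1 : T 1%g.
  exists 0; rewrite !zhom1 // !mul0r; split=> //; rewrite /= expg0 invg1 mulg1.
  by apply: Sp_null Sp0; rewrite subr0.
have TM g h : T g -> T h -> T (g * h)%g.
  move=> [a [ga1 ga2 Sg]] [b [hb1 hb2 Sh]]; exists (a + b).
  rewrite chi1M chi2M ga1 ga2 hb1 hb2 !mulrDl; split=> //.
  have -> : (g * h * (expgz w (a + b))^-1 = (g * (expgz w a)^-1) *
      (expgz w a * (h * (expgz w b)^-1) * (expgz w a)^-1))%g.
    by rewrite !mulgA mulgVK expgzD invgM !mulgA.
  apply: (Sp_null _ _ (fox_classM _ _)); rewrite in_ker // scale1r.
  apply: SpD => //; apply: (Sp_null _ _ (fox_classJ _ (in_ker _ _ hb1 hb2))).
  by apply: SpZ.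
have TV g : T g -> T (g^-1)%g.
  move=> [a [ga1 ga2 Sg]]; exists (- a); rewrite !zhomV // ga1 ga2 !mulNr; split=> //.
  rewrite expgzN invgK.
  have -> : (g^-1 * expgz w a = (expgz w a)^-1 * (g * (expgz w a)^-1)^-1 * ((expgz w a)^-1)^-1)%g.
    by rewrite invgM !invgK !mulgA mulVg mul1g.
  have kk1 : kap ((g * (expgz w a)^-1)^-1)%g = 1 by rewrite weight_charV in_ker // invr1.
  apply: (Sp_null _ _ (fox_classJ _ kk1)); apply: SpZ.
    by rewrite -expgzN.
  have := fox_classV (g * (expgz w a)^-1)%g; rewrite in_ker // invr1 scale1r => cV.
  by apply: (Sp_null _ (- fox_class (g * (expgz w a)^-1)%g)); [rewrite opprK | apply: SpN].
have Tall g : chi g = 0 -> T g.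
  move=> /s_gen; apply: (generated_min (K := Subgroup T1 TM TV)) => h /= hs.
  have hs' : h \in s by exact: hs.
  have jlt : (index h s < (size s).-1.+1)%N by have := hs'; rewrite -index_mem.
  pose j := Ordinal jlt; have jE : nn j = h by apply: nth_index.
  exists (e j); rewrite -jE; case: (eE j) => e1 e2; split=> //.
  exists (delta_mx 0 j); split; first by move=> i; rewrite mxE; case: andP.
  by rewrite -rowE rowK subrr; exact: null_rows0.
have Kspan g : chi1 g = 0 -> chi2 g = 0 -> Sp (fox_class g).
  move=> g1 g2; have [a [a1 a2]] : T g by apply: Tall; rewrite g1 g2 !mulr0 addr0.
  suff -> : expgz w a = 1%g by rewrite invg1 mulg1.
  have [a0|a0] := eqVneq a 0; first by rewrite a0 /= expg0.
  have z1 : chi1 w = 0 by apply: (mulfI a0); rewrite mulr0 -a1.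
  have z2 : chi2 w = 0 by apply: (mulfI a0); rewrite mulr0 -a2.
  rewrite (w1 z1 z2); have := expgz_map (f := fun _ : G => 1%g : G) 1%g a.
  by case: (a) => b /=; rewrite expg1n ?invg1.
have kk0 j : chi1 (kk j) = 0 /\ chi2 (kk j) = 0.
  have [e1 e2] := eE j; have [w1' w2'] := chiwX (e j).
  by rewrite /kk chi1M chi2M !zhomV // e1 e2 w1' w2' !subrr.
have uK j : Sp (kap u *: row j Y).
  have kj1 : kap (kk j) = 1 by case: (eE j) => e1 e2; exact: in_ker.
  have := fox_classJ u kj1; rewrite rowK => /null_rowsN; rewrite opprB => uj.
  apply: Sp_null uj _; apply: Kspan.
    by rewrite chi1M (chi1M u) zhomV // (kk0 j).1 addr0 subrr.
  by rewrite chi2M (chi2M u) zhomV // (kk0 j).2 addr0 subrr.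
have /choice [c cP] := uK.
pose M' : 'M[F]_((size s).-1.+1) := \matrix_j c j.
have M'R i j : R0 (M' i j) by rewrite mxE; case: (cP i).
have M'Y : null_rows (kap u *: Y - M' *m Y).
  apply: null_rows_row => j; rewrite linearB linearZ /= row_mul rowK.
  by have [_] := cP j; rewrite !rowK.
have M'l : laurent_mx M' by move=> i j; apply: R0l.
have poly_act (f : {poly F}) : (forall i, laurent f`_i) ->
    [/\ laurent_mx (horner_mx M' f), laurent f.[kap u] &
        null_rows (f.[kap u] *: Y - horner_mx M' f *m Y)].
  elim/poly_ind: f => [|f a IH] fl.
    rewrite rmorph0 horner0 scale0r mul0mx subrr; split; last exact: null_rows0.
      by move=> i j; rewrite mxE; exact: laurent0.
    exact: laurent0.
  have fl' i : laurent f`_i.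
    by have := fl i.+1; rewrite coefD coefMX coefC addr0.
  have al : laurent a.
    by have := fl 0%N; rewrite coefD coefMX coefC add0r.
  have [Hl fu fY] := IH fl'.
  rewrite rmorphD rmorphM /= horner_mx_X horner_mx_C hornerMXaddC; split.
  - move=> i j; rewrite !mxE; apply: laurentD.
      by apply: laurent_sum => o _; apply: laurentM.
    by case: (i == j); rewrite ?mulr1n ?mulr0n //; exact: laurent0.
  - by apply: laurentD => //; apply: laurentM => //; exact: weight_char_laurent.
  have -> : (f.[kap u] * kap u + a) *: Y - (horner_mx M' f * M' + a%:M) *m Y =
      kap u *: (f.[kap u] *: Y - horner_mx M' f *m Y) +
      horner_mx M' f *m (kap u *: Y - M' *m Y).
    rewrite mulmxDl mul_scalar_mx scalerDl opprD addrACA subrr addr0.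
    rewrite scalerBr mulmxBr scalerA [kap u * _]mulrC mulmxA -scalemxAr.
    by rewrite addrA subrK.
  apply: null_rowsD; last exact: null_rowsM.
  by apply: null_rowsZ => //; exact: weight_char_laurent.
pose f := char_poly M'.
have fR i : R0 f`_i by apply: char_poly_closed.
have [_ fu fY] := poly_act f (fun i => R0l _ (fR i)).
rewrite Cayley_Hamilton mul0mx subr0 in fY.
exists f.[kap u], (chi1 u *+ size s), (chi2 u *+ size s); split=> //; last first.
  move=> g g1 g2; have [d [dR gd]] := Kspan g g1 g2.
  have -> : f.[kap u] *: fox_class g =
      f.[kap u] *: (fox_class g - d *m Y) + d *m (f.[kap u] *: Y).
    by rewrite scalerBr -scalemxAr subrK.
  apply: null_rowsD; first exact: null_rowsZ.
  by apply: null_rowsM => // i j; rewrite ord1; apply: R0l.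
have fs : size f = (size s).+1 by rewrite size_char_poly.
rewrite horner_coef fs big_ord_recr /= (_ : f`_(size s) = 1); last first.
  by have := char_poly_monic M'; rewrite monicE lead_coefE -/f fs => /eqP.
rewrite mul1r -(monoX toF_inj) -addrA subrr addr0.
apply: (big_ind (laurent_on _)); first by exists 0; exact: LaurentZero.
  by move=> ? ?; exact: laurent_onD.
move=> i _; rewrite (monoX toF_inj).
pose Q a b := a = chi1 u *+ i /\ b = chi2 u *+ i.
apply: (laurent_onM toF_inj (P := P) (Q := Q) _ (fR i)); last exact: laurent_on_mono.
by move=> a b a' b' [o [-> ->]] [-> ->]; apply: weight_dominated.
Qed.

End Line.

(** The Fox derivatives specialise at [s = t = 1] to the exponent sums. *)
Lemma fox_value w i :
  laurent_value toF (fun _ _ => True) (fox w 0 i) (exponent (enum_val i) w)%:~R.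
Proof.
have eM : zhom (exponent (enum_val i)) by exact: additive_extension_zhom.
pose PT (_ _ : int) := True.
have kv g : laurent_value toF PT (kap g) 1.
  by rewrite -[kap g]mul1r -(scalar1 toF); apply: laurent_value_mono.
have kvM c g x v : laurent_value toF (fun _ _ => True) x v ->
    laurent_value toF (fun _ _ => True) (scalar toF c * kap g * x) (c * v).
  move=> xv; apply: (laurent_valueM toF_inj (P := PT) (Q := PT)) xv => //.
  exact: laurent_value_mono.
have gv x : laurent_value toF (fun _ _ => True) (fox (free_gen x) 0 i)
    (exponent (enum_val i) (free_gen x))%:~R.
  rewrite fox_gen mxE /= /exponent additive_extension_gen -(inj_eq enum_rank_inj) enum_valK.
  case: eqP => _; first by rewrite -(weight_char1) mulr1z; exact: kv.
  by rewrite mulr0z; exact: LaurentZero.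
move: w; apply: free_group_ind => [|x w IH|x w IH].
- by rewrite /fox derivation1 mxE zhom1 // mulr0z; exact: LaurentZero.
- rewrite foxME eM intrD; apply: laurent_valueD; first exact: gv.
  by rewrite -[kap _]mul1r -(scalar1 toF) -[X in laurent_value _ _ _ X]mul1r; apply: kvM.
rewrite foxME foxVE eM zhomV // intrD free_evalV.
apply: laurent_valueD; last first.
  by rewrite -[kap _]mul1r -(scalar1 toF) -[X in laurent_value _ _ _ X]mul1r; apply: kvM.
rewrite -weight_charV mulrNz -[X in laurent_value _ _ _ X]mulN1r -mulNr -[X in - X]mul1r -mulNr.
have -> : -1 = scalar toF (-1) :> F by rewrite /scalar !polyCN !polyC1 rmorphN1.
exact: kvM.
Qed.

Hypothesis JX : (m < n)%N.
Hypothesis indep : independent_zhoms chi1 chi2.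
Hypothesis fg : forall p q : int, (p != 0) || (q != 0) ->
  exists2 s : seq G, (forall g, g \in s -> p * chi1 g + q * chi2 g = 0) &
    forall g, p * chi1 g + q * chi2 g = 0 -> g isin generated [set` s].

Lemma direction_annihilator (p q : int) : (p != 0) || (q != 0) ->
  exists (f : F) (a0 b0 : int),
  [/\ laurent_on (fun a b => p * a + q * b < p * a0 + q * b0) (f - mono a0 b0),
      laurent f
    & forall g, chi1 g = 0 -> chi2 g = 0 -> null_rows (f *: fox_class g)].
Proof.
move=> pq; have [s s_ker s_gen] := fg pq.
have [u u_pos] : exists u, 0 < p * chi1 u + q * chi2 u.
  have [u u0] : exists u, p * chi1 u + q * chi2 u != 0.
    apply: contrapT => nu; have [p0 q0] : p = 0 /\ q = 0.
      by apply: indep => g; apply/eqP; apply: contrapT => /negP g0; apply: nu; exists g.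
    by move: pq; rewrite p0 q0 eqxx.
  move: u0; rewrite neq_lt => /orP [u0|u0]; last by exists u.
  by exists (u^-1)%g; rewrite !zhomV // !mulrN -opprD oppr_gt0.
apply: (@vertex_annihilator p q 1%g s pq _ _ u u_pos).
  move=> g; rewrite inE => /orP [/eqP ->|]; last exact: s_ker.
  by rewrite !zhom1 // !mulr0 addr0.
move=> g /s_gen; apply: generated_min => h hs; apply: sub_generated => /=.
by rewrite inE; apply/orP; right.
Qed.

Lemma direction_vertex (p q : int) g : (p != 0) || (q != 0) ->
  chi1 g = 0 -> chi2 g = 0 ->
  exists (f : {poly {poly k}}) i j, null_rows (toF f *: fox_class g) /\ vertex p q f i j.
Proof.
move=> pq g1 g2; have [f [a0 [b0 [fv fl fn]]]] := direction_annihilator pq.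
have [M [h [i [j [hE hv]]]]] := laurent_vertex toF_inj fv.
exists h, i, j; split=> //; rewrite hE mulrC -scalerA.
by apply: null_rowsZ; [exact: laurent_mono | exact: fn].
Qed.

(** Let [f] be an annihilator as above, and [x1] a generator on which [(chi1, chi2)]
    does not vanish. Over [F] the rows of [N] span the Fox derivatives of all
    commutators, since [f] is invertible. The commutator with [x1] expresses each
    basis vector by the one of [x1], so [N] has rank at least [n - 1 >= m]. *)
Lemma alexander_matrix_free : row_free N.
Proof.
have [x1 x1k] : exists x1, kap (y x1) != 1.
  apply: contrapT => nx.
  have k1 g : kap g = 1.
    have [ysurj _ _] := pres; have [w <-] := ysurj g; move: w.
    have kx x : kap (y x) = 1.
      by apply/eqP; apply: contrapT => /negP xk; apply: nx; exists x.
    apply: free_group_ind => [|x w IH|x w IH].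
    - by rewrite free_eval1 weight_char1.
    - by rewrite free_evalM weight_charM IH free_eval_gen kx mulr1.
    by rewrite free_evalM weight_charM IH free_evalV weight_charV free_eval_gen kx invr1 mulr1.
  have [|//] := indep (a := 1) (b := 0).
  move=> g; rewrite mul1r mul0r addr0; exact: mono_eq1 (k1 g).
have [f [a0 [b0 [fv fl fn]]]] := @direction_annihilator 1 0 isT.
have f0 : f != 0.
  have [M [h [i [j [hE [hij _]]]]]] := laurent_vertex toF_inj fv.
  apply: contraNneq hij => f0; move: hE; rewrite f0 mul0r -(rmorph0 toF) => /toF_inj ->.
  by rewrite !coef0.
have comm x : ((delta_mx 0 (enum_rank x) : 'rV[F]_n) <=
    N + (delta_mx 0 (enum_rank x1) : 'rV[F]_n))%MS.
  pose w := (free_gen x1 * free_gen x * (free_gen x1)^-1 * (free_gen x)^-1)%g.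
  have wE : fox w = (1 - kap (y x)) *: delta_mx 0 (enum_rank x1) +
      (kap (y x1) - 1) *: delta_mx 0 (enum_rank x).
    rewrite /w !foxM !foxV !free_evalM !free_evalV !free_eval_gen !fox_gen.
    rewrite !weight_charM !weight_charV !scalerN !scalerA !scalerBl !scale1r.
    rewrite [kap (y x1) * _ / _]mulrAC divff ?weight_char_neq0 // mul1r divff ?weight_char_neq0 //.
    by rewrite scale1r -addrA addrACA.
  have wN : (fox w <= N)%MS.
    have : null_rows (f *: fox w).
      have -> : f *: fox w = f *: fox_class (free_eval y w) -
          f *: (fox_class (free_eval y w) - fox w) by rewrite -scalerBr opprB addrCA subrr addr0.
      apply: null_rowsB; last by apply: null_rowsZ => //; exact: fox_classE.
      by apply: fn; rewrite !free_evalM !free_evalV !free_eval_gen ?chi1M ?chi2M !zhomV //; ring.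
    move=> [A _ AE]; have : (f *: fox w <= N)%MS by rewrite AE submxMl.
    by rewrite (eqmx_scale _ f0).
  have k10 : kap (y x1) - 1 != 0 by rewrite subr_eq0.
  have -> : delta_mx 0 (enum_rank x) = (kap (y x1) - 1)^-1 *:
      (fox w - (1 - kap (y x)) *: delta_mx 0 (enum_rank x1)) :> 'rV[F]_n.
    by rewrite wE addrAC subrr add0r scalerA mulVf // scale1r.
  apply/scalemx_sub/addmx_sub; first exact: submx_trans wN (addsmxSl _ _).
  by rewrite -scaleNr; apply/scalemx_sub/addsmxSr.
have : ((1%:M : 'M[F]_n) <= N + (delta_mx 0 (enum_rank x1) : 'rV[F]_n))%MS.
  by apply/row_subP => i; rewrite row1 -(enum_valK i); exact: comm.
move=> /mxrankS; rewrite mxrank1 => nle.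
rewrite /row_free eqn_leq rank_leq_row /=.
have := leq_trans nle (mxrank_adds_leqif _ _).1; rewrite mxrank_delta addn1.
exact: leq_trans JX.
Qed.

(** The polynomials that kill the class of [g] form a saturated ideal with vertices in
    all directions. It contains a polynomial [c] in [t], and, for the direction
    [(1, 0)], a polynomial [h] whose leading coefficient is a power of [t]. As the
    rows of [N] are independent, the coefficients of the class of [g] on them are
    unique; having both [c] and [h] for denominators, they are Laurent
    polynomials. At [s = t = 1] the exponent sums of a word for [g] become a
    combination of those of the relators, and [phi] vanishes on the latter. *)
Theorem fox_kernel_zhom (phi : G -> k) g : zhom phi ->
  chi1 g = 0 -> chi2 g = 0 -> phi g = 0.
Proof.
move=> phiM g1 g2.
have [|||p q q0|c c0 cn] := @ideal_meets_constants k
    (fun f => null_rows (toF f *: fox_class g)).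
- by move=> f h fn hn; rewrite rmorphB scalerBl; apply: null_rowsB.
- move=> f h hn; rewrite rmorphM -scalerA; apply: null_rowsZ => //.
  exact: laurent_poly.
- move=> f fn; have mX : toF 'X = mono 1 0 by rewrite (mono_nat toF 1 0) mulr1.
  have -> : toF f = mono (-1) (- 0) * toF ('X * f).
    by rewrite rmorphM mX mulrA monoN // mulVf ?mul1r //; exact: mono_neq0.
  by rewrite -scalerA; apply: null_rowsZ => //; exact: laurent_mono.
- have [|f [i [j [fn fv]]]] := @direction_vertex p q g _ g1 g2.
    by rewrite (gt_eqF q0) orbT.
  by exists f, i, j.
have [f [i [j [fn fv]]]] := @direction_vertex 1 0 g isT g1 g2.
have [c1 fc] : exists c1 : k, c1 != 0 /\ lead_coef f = c1 *: 'X^j.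
  have [fij fmax] := fv.
  have low i' j' : f`_i'`_j' != 0 -> (i', j') <> (i, j) -> (i' < i)%N.
    by move=> h1 h2; have := fmax _ _ h1 h2; rewrite /weight !mul1r !mul0r !addr0.
  have fi : f`_i = f`_i`_j *: 'X^j.
    apply/polyP => j'; rewrite coefZ coefXn; have [->|jj'] := eqVneq j' j.
      by rewrite mulr1.
    rewrite mulr0; apply/eqP; apply: contrapT => /negP h.
    have /(low _ _ h) : (i, j') <> (i, j) by move=> [e]; rewrite e eqxx in jj'.
    by rewrite ltnn.
  exists f`_i`_j; split=> //; rewrite lead_coefE -fi; congr (f`_ _).
  suff -> : size f = i.+1 by [].
  apply/eqP; rewrite eqn_leq; apply/andP; split.
    apply/leq_sizeP => i' ii'.
    apply/polyP => j'; rewrite coef0; apply/eqP; apply: contrapT => /negP h.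
    have /(low _ _ h) : (i', j') <> (i, j) by move=> [e]; rewrite e ltnn in ii'.
    by rewrite ltnNge (ltnW ii').
  by rewrite ltnNge; apply: contra fij => /(nth_default 0) ->; rewrite coef0.
have [c10 {fc}fc] := fc.
pose h := (c1^-1)%:P%:P * f.
have hlead : lead_coef h = 'X^j.
  rewrite /h lead_coefM lead_coefC fc mul_polyC scalerA mulVf // scale1r.
  by [].
have hn : null_rows (toF h *: fox_class g).
  by rewrite /h rmorphM -scalerA; apply: null_rowsZ => //; exact: laurent_poly.
have [A1 A1l A1E] := cn; have [A2 A2l A2E] := hn.
have A12 : toF h *: A1 = toF c%:P *: A2.
  apply: (row_free_inj alexander_matrix_free).
  by rewrite -!scalemxAl -A1E -A2E !scalerA mulrC.
have tc0 : toF c%:P != 0 by rewrite -(rmorph0 toF) (inj_eq toF_inj) polyC_eq0.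
have [A Al AE] : null_rows (fox_class g).
  exists ((toF c%:P)^-1 *: A1); last by rewrite -scalemxAl -A1E scalerA mulVf // scale1r.
  move=> i' j'; rewrite mxE mulrC ord1.
  apply: (laurent_divide toF_inj c0 hlead (A1l 0 j') (A2l 0 j')).
  by have /matrixP /(_ 0 j') := A12; rewrite !mxE.
have /choice [a aE] : forall j, exists v, laurent_value toF (fun _ _ => True) (A 0 j) v.
  by move=> j'; exact: Al.
move: AE; rewrite /fox_class; case: cid => w /= wE wA.
have ev (i' : 'I_n) : (exponent (enum_val i') w)%:~R =
    \sum_(j' < m) a j' * (exponent (enum_val i') (r (enum_val j')))%:~R :> k.
  apply: (laurent_value_uniq toF_inj (fox_value w i') (Q := fun _ _ => True)).
  rewrite wA mxE; elim/big_rec2: _ => [|j' v z _ IH]; first exact: LaurentZero.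
  apply: laurent_valueD IH.
  apply: (laurent_valueM toF_inj (P := fun _ _ => True) (Q := fun _ _ => True)) (aE j') _ => //.
  by rewrite mxE; exact: fox_value.
have phiyM : zhom (phi \o free_eval y) by move=> v z; rewrite /= free_evalM phiM.
have phiE v : phi (free_eval y v) =
    \sum_(i' < n) phi (y (enum_val i')) * (exponent (enum_val i') v)%:~R.
  rewrite -[LHS]/((phi \o free_eval y) v) (zhom_exponents _ phiyM).
  rewrite (reindex (@enum_val X predT)) /=; last exact/onW_bij/enum_val_bij.
  by apply: eq_bigr => i' _; rewrite free_eval_gen mulrzr.
have [_ yr _] := pres.
rewrite -wE phiE.
rewrite (eq_bigr (fun i' : 'I_n => \sum_(j' < m) a j' *
  (phi (y (enum_val i')) * (exponent (enum_val i') (r (enum_val j')))%:~R))); last first.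
  by move=> i' _; rewrite ev mulr_sumr; apply: eq_bigr => j' _; rewrite mulrCA.
rewrite exchange_big big1 // => j' _.
by rewrite -mulr_sumr -phiE yr zhom1 // mulr0.
Qed.

End Fox.

(** * Pairs of independent homomorphisms to the integers *)

Local Open Scope group_scope.
Local Open Scope classical_set_scope.

Definition tame (G : groupType) := [/\ LERF G, deficient G & ~ large G].

Lemma tame_sub (G : groupType) (K : subgroup G) :
  finite_index K -> tame G -> tame (group_of K).
Proof.
move=> Kfi [Gl Gd Gn]; split; [exact: LERF_sub | exact: deficient_sub |].
by move=> /(large_sub Kfi).
Qed.

Lemma finite_index_exponent (G : groupType) (K : subgroup G) :
  finite_index K -> exists2 n : nat, (0 < n)%N & forall g, g ^+ n isin K.
Proof.
move=> /finite_index_perm [n [f [i [fM fK]]]].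
exists #|[set: {perm 'I_n.+1}]%SET|; first exact: cardG_gt0.
by move=> g; apply/fK; rewrite (morphXg fM) expg_cardG ?finset.in_setT // perm1.
Qed.

Lemma zhom_val (G : groupType) (V : zmodType) (K : subgroup G) (chi : G -> V) :
  zhom chi -> zhom (fun g : group_of K => chi (val g)).
Proof. by move=> chiM g h; rewrite valM chiM. Qed.

Lemma independent_zhoms_sub (G : groupType) (K : subgroup G) (chi1 chi2 : G -> int) :
  zhom chi1 -> zhom chi2 -> finite_index K -> independent_zhoms chi1 chi2 ->
  independent_zhoms (fun g : group_of K => chi1 (val g)) (fun g => chi2 (val g)).
Proof.
move=> chi1M chi2M /finite_index_exponent [n n0 nK] indep a b ab0.
apply: indep => g; have := ab0 (to_group_of (nK g)).
rewrite !to_group_ofK !zhomX // !mulrnAr -mulrnDl => /eqP.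
by rewrite mulrn_eq0 eqn0Ngt n0 => /eqP.
Qed.

Lemma tofrac_inj (R : idomainType) : injective (@tofrac R).
Proof. by move=> p q /eqP; rewrite tofrac_eq => /eqP. Qed.

Lemma kernel_zhom_field (G : groupType) (k : fieldType) (chi1 chi2 : G -> int)
    (phi : G -> k) (g : G) :
  tame G -> zhom chi1 -> zhom chi2 -> independent_zhoms chi1 chi2 -> zhom phi ->
  chi1 g = 0%R -> chi2 g = 0%R -> phi g = 0%R.
Proof.
move=> [Gl [X [J [y [r [pres JX]]]]] Gn] chi1M chi2M indep phiM.
apply: (@fox_kernel_zhom k {fraction {poly {poly k}}} (@tofrac _)
          (@tofrac_inj _)
          G X J y r chi1 chi2 pres chi1M chi2M JX indep _ phi g phiM) => p q pq.
apply: (@finitely_generated_kernel G (fun g => p * chi1 g + q * chi2 g)%R Gl _ Gn).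
- by exists X, J, y, r.
- by move=> x z; rewrite chi1M chi2M !mulrDr addrACA.
apply: contrapT => nz; have [p0 q0] : p = 0%R /\ q = 0%R.
  by apply: indep => x; apply: contrapT => x0; apply: nz; exists x.
by move: pq; rewrite p0 q0 eqxx.
Qed.

(** A nontrivial element of the common kernel survives in a finite quotient, where
    some power of it has prime order [p]. The preimage of the subgroup generated by
    that power has finite index, and maps onto the field of [p] elements without
    killing the power, against [kernel_zhom_field]. *)
Theorem kernel_injective (G : groupType) (chi1 chi2 : G -> int) g :
  tame G -> zhom chi1 -> zhom chi2 -> independent_zhoms chi1 chi2 ->
  chi1 g = 0%R -> chi2 g = 0%R -> g = 1.
Proof.
move=> Gg chi1M chi2M indep g1 g2; apply: contrapT => gn1; have [Gl _ _] := Gg.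
have idM : {morph @id G : x y / x * y} by [].
have [||n [f [i [fM _ fg]]]] := @LERF_separate G (generated set0) g Gl.
- by exists set0; first exact: finite_set0.
- by move=> /(generated_min (K := morph_kernel idM) (@sub0set _ _)).
have fg1 : (1 < #[f g]%g)%N.
  rewrite ltn_neqAle order_gt0 andbT eq_sym order_eq1.
  by apply/eqP => fg1; apply: fg; rewrite fg1 perm1.
pose p := pdiv #[f g]%g; have pp : prime p by exact: pdiv_prime.
pose d := (#[f g]%g %/ p)%N; have dg : (d %| #[f g]%g)%N.
  by apply: dvdn_div; apply: pdiv_dvd.
pose h := g ^+ d; pose a := f h.
have ao : #[a]%g = p.
  rewrite /a /h (morphXg fM) orderXdiv // /d divnA ?pdiv_dvd //.
  by rewrite mulKn // order_gt0.
pose P := [set x : G | f x \in <[a]>%g].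
have P1 : P 1 by rewrite /P /= (morph1g fM) group1.
have PM x y : P x -> P y -> P (x * y).
  by rewrite /P /= fM; apply: groupM.
have PV x : P x -> P x^-1 by rewrite /P /= (morphVg fM) groupV.
pose K := Subgroup P1 PM PV.
have Kfi : finite_index K.
  apply: (finite_indexI (c := f)) => x y fxy.
  by rewrite /= /P /= fM (morphVg fM) fxy mulVg group1.
have hK : h isin K by rewrite /= /P /= cycle_id.
have /choice [e eE] : forall x : group_of K, exists e : nat, f (val x) = (a ^+ e)%g.
  by move=> x; have := group_valP x; rewrite /= /P /= => /cycleP.
have eq_p m m' : (a ^+ m = a ^+ m')%g -> m%:R = m'%:R :> 'F_p.
  move=> /eqP; rewrite eq_expg_mod_order ao => /eqP mm.
  by rewrite -(Fp_nat_mod pp) mm Fp_nat_mod.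
have phiM : zhom (fun x => (e x)%:R : 'F_p).
  by move=> x y; rewrite -natrD; apply: eq_p; rewrite expgD -!eE valM fM.
have := kernel_zhom_field (g := to_group_of hK) (tame_sub Kfi Gg) (zhom_val chi1M)
  (zhom_val chi2M) (independent_zhoms_sub chi1M chi2M Kfi indep) phiM.
rewrite to_group_ofK /h !zhomX // g1 g2 !mul0rn => /(_ erefl erefl).
have -> : (e (to_group_of hK))%:R = 1%:R :> 'F_p.
  by apply: eq_p; rewrite -eE to_group_ofK expg1.
by move/eqP; rewrite oner_eq0.
Qed.

(** The transfer from a central subgroup: in [r i * h] the factor [h] can be moved to
    the left, so each coset contributes [chi h]. *)
Lemma transfer (G : groupType) (K : subgroup G) (chi : G -> int) :
  finite_index K -> (forall g h, g isin K -> h isin K -> chi (g * h) = (chi g + chi h)%R) ->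
  (forall g h, h isin K -> commute g h) ->
  exists (m : int) (V : G -> int),
    [/\ m != 0%R, zhom V & forall h, h isin K -> V h = (m * chi h)%R].
Proof.
move=> /finite_index_label [n [c [r [rK cP]]]] chiM Kcent.
have cr g : g * (r (c g))^-1 isin K by apply/cP; rewrite rK.
exists n.+1%:Z, (fun g => \sum_i chi (r i * g * (r (c (r i * g)))^-1)%g)%R; split=> //.
- move=> g h.
  pose s i := c (r i * g).
  have sI : injective s.
    move=> i j /cP; rewrite invgM mulgA mulgK => /cP; by rewrite !rK.
  rewrite [X in (_ + X)%R](reindex_inj sI) -big_split /=; apply: eq_bigr => i _.
  have -> : c (r i * (g * h)) = c (r (s i) * h).
    apply/cP; rewrite invgM !mulgA mulgK; exact: cr.
  rewrite -chiM; last exact: cr; last exact: cr.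
  by congr (chi _); rewrite !mulgA mulgKV.
move=> h hK; rewrite (eq_bigr (fun=> chi h)) => [|i _].
  by rewrite sumr_const card_ord -mulr_natl natz.
have ih : r i * h = h * r i by exact: Kcent.
have -> : c (r i * h) = i by rewrite -[RHS]rK; apply/cP; rewrite ih mulgK.
by rewrite ih mulgK.
Qed.

(** * Extensions of an infinite cyclic group by an infinite cyclic group *)

Lemma commute_expgz (G : groupType) (x y : G) e : commute x y -> commute x (expgz y e).
Proof.
by move=> xy; case: e => n /=; [apply: commuteX | apply/commuteV/commuteX].
Qed.

Lemma isomorphic_inj_surj (G K : groupType) (f : G -> K) :
  {morph f : x y / x * y} -> (forall x, f x = 1 -> x = 1) ->
  (forall y, exists x, f x = y) -> isomorphic G K.
Proof.
move=> fM f1 /choice [g gK]; exists (multiplicative_of fM).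
by exists g => // x; apply: (morphg_inj fM f1); rewrite gK.
Qed.

Lemma presented_isomorphic (P : finite_presentation) (G : groupType)
    (y : 'I_(ngens P) -> G) :
  (forall g, exists w, free_eval y w = g) ->
  (forall w, free_eval y w = 1 <-> w isin normal_closure [set` relators P]) ->
  isomorphic G (presented_group P).
Proof.
move=> /choice [s sK] yP; set N := normal_closure _ in yP.
have sP v w : free_eval y v = free_eval y w -> quotient_map N v = quotient_map N w.
  move=> vw; apply/divg1_eq; rewrite -(morphVg (multM _)) -(multM (quotient_map N)).
  by apply/quotient_map_eq1/yP; rewrite free_evalM free_evalV vw mulgV.
apply: (isomorphic_inj_surj (f := fun g => quotient_map N (s g))) => [g h|g|a].
- by rewrite -(multM (quotient_map N)); apply: sP; rewrite free_evalM !sK.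
- by move=> /quotient_map_eq1 /yP; rewrite sK.
have [w <-] := quotient_map_surj a.
by exists (free_eval y w); apply: sP; rewrite sK.
Qed.

(** [w] embeds [Y] in [Z]. *)
Lemma expgz_generator (G : groupType) (Y : subgroup G) (w : G -> int) :
  (forall g h, g isin Y -> h isin Y -> w (g * h) = (w g + w h)%R) ->
  (forall g, g isin Y -> w g = 0%R -> g = 1) ->
  exists2 y, y isin Y & forall g, g isin Y -> exists e : int, g = expgz y e.
Proof.
move=> wM w1; have wYM : zhom (fun g : group_of Y => w (val g)).
  by move=> g h; rewrite valM wM //; exact: group_valP.
have [nz|z] := pselect (exists g : group_of Y, w (val g) <> 0%R); last first.
  exists 1; first exact: subgroup1.
  move=> g gY; exists 0%R; apply: w1 => //; apply: contrapT => g0; apply: z.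
  by exists (to_group_of gY); rewrite to_group_ofK.
have [d [w' [y [d0 w'M w'y w'E]]]] := zhom_primitive wYM nz.
exists (val y); first exact: group_valP.
move=> g gY; exists (w' (to_group_of gY)).
set e := w' _; have w'1 (h : group_of Y) : w' h = 0%R -> h = 1.
  move=> h0; apply: val_inj; apply: w1; first exact: group_valP.
  by rewrite w'E h0 mulr0.
have := w'1 (to_group_of gY * (expgz y e)^-1).
rewrite w'M zhomV // zhom_expgz // w'y mulrzz mul1r subrr => /(_ erefl).
move=> /divg1_eq /(congr1 val); rewrite to_group_ofK => ->.
by apply: (expgz_map (f := @group_val G Y)) => u v; apply: valM.
Qed.

Lemma expgz_twist (G : groupType) (a b : G) e :
  b * a * b^-1 = a^-1 -> b * expgz a e = expgz a (- e) * b.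
Proof.
move=> ba; rewrite expgzN; apply: (mulIg b^-1); rewrite mulgK.
have <- : expgz a^-1 e = (expgz a e)^-1 by case: e => n /=; rewrite expVgn.
rewrite -ba; apply: (expgz_map (f := fun x => b * x * b^-1)) => u v.
by rewrite !mulgA mulgVK.
Qed.

(** The exponents depend on the word only, so that they can be compared between the
    presented group and another group that satisfies the relation. *)
Lemma klein_normal_form (w : free_group 'I_2) :
  exists e m : int, forall (K : groupType) (f : free_group 'I_2 -> K),
    {morph f : v w / v * w} ->
    let a := f (free_gen ord0) in let b := f (free_gen ord_max) in
    b * a * b^-1 = a^-1 -> f w = expgz a e * expgz b m.
Proof.
have ord2 (x : 'I_2) : x = ord0 \/ x = ord_max.
  by case: x => [[|[|//]] i]; [left | right]; apply: val_inj.
move: w; apply: free_group_ind => [|x w [e [m IH]]|x w [e [m IH]]].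
- by exists 0%R, 0%R => K f fM a b ba; rewrite (morph1g fM) /= !expg0 mulg1.
- have [->|->] := ord2 x.
    exists (1 + e)%R, m => K f fM a b ba.
    by rewrite fM (IH _ _ fM ba) expgzD mulgA.
  exists (- e)%R, (1 + m)%R => K f fM a b ba.
  by rewrite fM (IH _ _ fM ba) mulgA -/a -/b (expgz_twist e ba) expgzD mulgA.
have [->|->] := ord2 x.
  exists (-1 + e)%R, m => K f fM a b ba.
  by rewrite fM (IH _ _ fM ba) (morphVg fM) expgzD mulgA.
exists (- e)%R, (-1 + m)%R => K f fM a b ba.
have bVa : b^-1 * a * b^-1^-1 = a^-1.
  have := congr1 (fun x => x^-1) ba; rewrite invgK !invgM invgK => abE.
  by rewrite -[X in _ * X * _]abE !mulgA mulVg mul1g mulgVK.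
by rewrite fM (IH _ _ fM ba) (morphVg fM) mulgA -/a -/b (expgz_twist e bVa) expgzD mulgA.
Qed.

Section CyclicByCyclic.
Variables (G : groupType) (chi : G -> int) (t y : G).
Hypothesis chiM : zhom chi.
Hypothesis chi_t : chi t = 1%R.
Hypothesis chi_y : chi y = 0%R.
Hypothesis ker_chi : forall g, chi g = 0%R -> exists e, g = expgz y e.
Hypothesis y_free : forall e, expgz y e = 1 -> e = 0%R.

Let normal_form g : exists e, g = expgz y e * expgz t (chi g).
Proof.
have [|e eE] := @ker_chi (g * (expgz t (chi g))^-1).
  by rewrite chiM zhomV // zhom_expgz // chi_t mulrzz mul1r subrr.
by exists e; rewrite -eE mulgVK.
Qed.

Let normal_form1 e m : expgz y e * expgz t m = 1 -> e = 0%R /\ m = 0%R.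
Proof.
move=> em; have m0 : m = 0%R.
  have := congr1 chi em; rewrite chiM !zhom_expgz // chi_t chi_y zhom1 //.
  by rewrite mul0rz add0r mulrzz mul1r.
by split=> //; apply: y_free; rewrite m0 /= expg0 mulg1 in em.
Qed.

Lemma direct_isomorphic : commute t y -> isomorphic G ZxZ.
Proof.
move=> ty; apply: isomorphic_sym.
pose f (p : ZxZ) : G := expgz y (p.1 : int) * expgz t (p.2 : int).
have fM : {morph f : p q / p * q}.
  move=> p q; rewrite /f.
  have -> : expgz y ((p * q).1 : int) = expgz y (p.1 : int) * expgz y (q.1 : int).
    exact: expgzD.
  have -> : expgz t ((p * q).2 : int) = expgz t (p.2 : int) * expgz t (q.2 : int).
    exact: expgzD.
  rewrite !mulgA; congr (_ * _); rewrite -!mulgA; congr (_ * _).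
  by apply/commute_sym/commute_expgz/commute_sym/commute_expgz/commute_sym.
apply: (isomorphic_inj_surj fM) => [[m e] /normal_form1 [/= -> ->] //|g].
by have [e ->] := normal_form g; exists (e, chi g).
Qed.

Lemma twisted_isomorphic : t * y * t^-1 = y^-1 -> isomorphic G klein_bottle_group.
Proof.
move=> ty; pose c (i : 'I_2) : G := if i == ord0 then y else t.
apply: (@presented_isomorphic klein_bottle_presentation G c) => [g|w].
  have [e ->] := normal_form g.
  exists (expgz (free_gen ord0) e * expgz (free_gen ord_max) (chi g)).
  by rewrite free_evalM !(expgz_map (f := free_eval c)) ?free_eval_gen //; exact: free_evalM.
have cM : {morph free_eval c : v w / v * w} := @free_evalM _ _ c.
pose N := normal_closure [set` relators klein_bottle_presentation].
pose q := quotient_map N; have qM : {morph q : v w / v * w} := multM q.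
have qrel : q (free_gen ord_max) * q (free_gen ord0) * (q (free_gen ord_max))^-1 =
    (q (free_gen ord0))^-1.
  apply/divg1_eq; rewrite -!(morphVg qM) -!qM; apply/quotient_map_eq1/sub_generated.
  pose a : free_group 'I_2 := free_gen ord0; pose b : free_group 'I_2 := free_gen ord_max.
  pose rel : free_group 'I_2 := b * a * b^-1 * a^-1^-1.
  by exists rel; [rewrite /= mem_seq1 | exists 1; rewrite ?conjg1].
split=> [w1|]; last first.
  apply: (generated_min (K := morph_kernel cM)) => _ [r + [v _ <-]].
  rewrite /= mem_seq1 => /eqP ->; rewrite (morphJg cM) !cM !(morphVg cM) !free_eval_gen.
  by rewrite /c /= ty mulgV conj1g.
apply/quotient_map_eq1; have [e [m em]] := klein_normal_form w.
have := em _ _ cM; rewrite w1 !free_eval_gen => /(_ ty) /esym /normal_form1 [e0 m0].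
by rewrite (em _ _ qM qrel) e0 m0 /= !expg0 mulg1.
Qed.

End CyclicByCyclic.

(** * Groups that contain an abelian subgroup of rank two with finite index *)

Lemma expgzM (G : groupType) (x : G) a b : expgz (expgz x a) b = expgz x (a * b)%R.
Proof.
elim/int_ind: b => [|n IH|n IH]; first by rewrite mulr0.
  by rewrite intS mulrDr mulr1 !expgzD IH /= expg1.
have -> : (- n.+1%:Z = -1 + - n%:Z)%R by lia.
rewrite mulrDr !expgzD IH; congr (_ * _).
by rewrite mulrN1 !expgzN /= expg1.
Qed.

Lemma extend_group_of (G : groupType) (H : subgroup G) (T : Type) (t0 : T)
    (f : group_of H -> T) : exists F : G -> T, forall h, F (val h) = f h.
Proof.
by exists (fun g => if insub g is Some h then f h else t0) => h; rewrite valK.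
Qed.

(** By [kernel_injective] the subgroup [H] is abelian, so that it is contained in the
    centraliser [D] of its normal core [H0]. The transfer from [H0] to [D] yields a
    pair of independent homomorphisms on [D], so that [D] is abelian too; an element
    that centralises [D] centralises [H0]. *)
Lemma abelian_normal_finite_index (G : groupType) :
  tame G ->
  (exists H : subgroup G, finite_index H /\
     exists b : nat, first_betti (group_of H) b /\ (2 <= b)%N) ->
  exists (D : subgroup G) (w1 w2 : group_of D -> int),
  [/\ finite_index D,
      forall x g, x isin D -> x ^ g isin D,
      forall x y, x isin D -> y isin D -> commute x y &
      forall g, (forall x, x isin D -> commute g x) -> g isin D] /\
  [/\ zhom w1, zhom w2 & independent_zhoms w1 w2].
Proof.
move=> Gg [H [Hfi [b [Hb b2]]]]; have Hg := tame_sub Hfi Gg.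
have [_ Hd _] := Hg.
have [chi1 [chi2 [chi1M chi2M ind]]] := two_zhoms Hd Hb b2.
have comm_inj (K : subgroup G) (u v : group_of K -> int) : tame (group_of K) ->
    zhom u -> zhom v -> independent_zhoms u v ->
    forall x y, x isin K -> y isin K -> commute x y.
  move=> Kg uM vM uv x y xK yK.
  suff : to_group_of xK * to_group_of yK = to_group_of yK * to_group_of xK.
    by move=> /(congr1 val); rewrite !valM !to_group_ofK.
  apply/divg1_eq/(kernel_injective Kg uM vM uv).
    by rewrite !uM zhomV // uM [X in (_ - X)%R]addrC subrr.
  by rewrite !vM zhomV // vM [X in (_ - X)%R]addrC subrr.
have Hab := comm_inj _ _ _ Hg chi1M chi2M ind.
have [n [f [i [fM fH]]]] := finite_index_perm Hfi.
pose H0 := morph_kernel fM.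
have H0H g : f g = 1 -> g isin H by move=> fg; apply/fH; rewrite fg perm1.
have H0fi : finite_index H0.
  exact: morph_kernel_finite_index.
pose Dset := [set g : G | forall h, f h = 1 -> commute g h].
have D1 : Dset 1 by move=> h _; apply: commute_sym; apply: commute1.
have DM x y : Dset x -> Dset y -> Dset (x * y).
  move=> xD yD h h1; apply/commute_sym/commuteM; apply: commute_sym; first exact: xD.
  exact: yD.
have DV x : Dset x -> Dset x^-1.
  by move=> xD h h1; apply/commute_sym/commuteV/commute_sym/xD.
pose D := Subgroup D1 DM DV.
have HD g : g isin H -> g isin D by move=> gH h /H0H hH; apply: Hab.
have H0D g : f g = 1 -> g isin D by move=> /H0H; apply: HD.
have Dfi : finite_index D.
  apply: (finite_indexI (c := f)) => x y fxy; apply: H0D.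
  by rewrite fM (morphVg fM) fxy mulVg.
have Dg := tame_sub Dfi Gg.
pose K := preimage_sub D H0; have Kfi : finite_index K by exact: preimage_finite_index.
have tr chi : zhom chi -> exists (m : int) (V : group_of D -> int),
    [/\ m != 0%R, zhom V & forall h (hH : h isin H) (hD : h isin D), f h = 1 ->
      V (to_group_of hD) = (m * chi (to_group_of hH))%R].
  move=> chiM; have [F FE] := extend_group_of 0%R chi.
  have FE' h (hH : h isin H) : F h = chi (to_group_of hH) by rewrite -FE to_group_ofK.
  have [||m [V [m0 VM VE]]] := @transfer _ K (fun d => F (val d)) Kfi.
  - move=> g h /H0H gH /H0H hH; rewrite valM !FE'; first exact: subgroupM.
    move=> ghH; rewrite -chiM; congr chi; apply: val_inj.
    by rewrite valM !to_group_ofK.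
  - move=> g h hK; apply: val_inj; rewrite !valM.
    by have := group_valP g; apply.
  exists m, V; split=> // h hH hD h1; rewrite VE ?to_group_ofK ?FE' //.
have [m1 [w1 [m10 w1M w1E]]] := tr _ chi1M.
have [m2 [w2 [m20 w2M w2E]]] := tr _ chi2M.
have wind : independent_zhoms w1 w2.
  move=> a c ac0; have [e e0 eH0] := finite_index_exponent H0fi.
  have [|a0 c0] := ind (a * m1)%R (c * m2)%R.
    move=> h; have hX := eH0 (val h); have hXH := H0H _ hX; have hXD := H0D _ hX.
    have := ac0 (to_group_of hXD); rewrite (w1E _ hXH) // (w2E _ hXH) //.
    have -> : to_group_of hXH = h ^+ e.
      apply: val_inj; rewrite to_group_ofK.
      by apply/esym; apply: (morphXg (f := @group_val G H)) => u v; apply: valM.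
    rewrite !zhomX // !mulrA !mulrnAr -mulrnDl => /eqP.
    by rewrite mulrn_eq0 eqn0Ngt e0 => /eqP.
  by move: a0 c0 => /eqP + /eqP; rewrite !mulf_eq0 (negPf m10) (negPf m20) !orbF =>
    /eqP -> /eqP ->.
exists D, w1, w2; split; split=> //.
- move=> x g xD h h1; have hg : f (h ^ g^-1) = 1 by rewrite (morphJg fM) h1 conj1g.
  by rewrite /commute -{1 2}(conjgKV g h) -!conjMg (xD _ hg).
- exact: (comm_inj D w1 w2).
by move=> g gD h h1; apply: gD; exact: H0D.
Qed.

(** The case in view is the product of [Z], generated by [z], and of the infinite
    dihedral group, generated by the involutions [a] and [y a]. Consider [u] and [v]
    as given by [unipotent_lift]. In characteristic [2] the relation
    [b^2 = 1] gives [u b = 0] for an involution [b] with [eps b = 1], and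
    [z a = a z] gives [u z = 0], so [u] vanishes everywhere. *)
Lemma no_dihedral_by_Z (G : groupType) (eps : G -> 'F_2) (z a y : G) :
  deficient G -> zhom eps -> eps z = 0%R -> eps a = 1%R -> eps y = 0%R ->
  a * a = 1 -> (y * a) * (y * a) = 1 -> commute z a ->
  (forall g, exists e m, g = expgz y e * expgz z m \/ g = expgz y e * a * expgz z m) ->
  False.
Proof.
move=> Gd epsM ez ea ey aa yaya za gen.
have [u [v [uM [g ug] vM]]] := unipotent_lift Gd epsM.
have two (x : 'F_2) : (x + x = 0)%R by rewrite -mulr2n; apply: mulrn_pchar; exact: pchar_Fp.
have v1 : v 1 = 0%R.
  by have := vM 1 1; rewrite mulg1 (zhom1 uM) mulr0 addr0 two.
have inv b : eps b = 1%R -> b * b = 1 -> u b = 0%R.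
  by move=> eb bb; have := vM b b; rewrite bb v1 two add0r eb mul1r.
have ua := inv a ea aa.
have uy : u y = 0%R.
  have := inv (y * a); rewrite epsM ey ea add0r => /(_ erefl yaya).
  by rewrite uM ua addr0.
have uz : u z = 0%R.
  have := vM z a; rewrite za vM ez ea mul0r mul1r addr0 [X in (X + _)%R]addrC => /eqP.
  by rewrite -subr_eq0 addrAC subrr add0r => /eqP.
have [e [m gE]] := gen g; case/eqP: ug.
by case: gE => ->; rewrite !uM (zhom_expgz _ _ uM) (zhom_expgz z _ uM) ?ua uy uz !mul0rz ?addr0.
Qed.

(** If [c] were dependent with both [w1] and [w2], these would be rational multiples
    of [c], hence dependent. *)
Lemma independent_with (G : groupType) (c w1 w2 : G -> int) :
  zhom c -> zhom w1 -> zhom w2 -> (exists g, c g <> 0%R) -> independent_zhoms w1 w2 ->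
  exists2 w : G -> int, zhom w & independent_zhoms c w.
Proof.
move=> cM w1M w2M [g cg] ind.
have dep w : ~ independent_zhoms c w ->
    exists a b, b <> 0%R /\ forall h, (a * c h + b * w h = 0)%R.
  move=> /existsNP [a /existsNP [b /not_implyP [abh ab]]]; exists a, b; split=> // b0.
  apply: ab; split=> //; have := abh g; rewrite b0 mul0r addr0 => /eqP.
  by rewrite mulf_eq0 (introF eqP cg) orbF => /eqP.
have [i1|/dep [a1 [b1 [b10 h1]]]] := pselect (independent_zhoms c w1).
  by exists w1.
have [i2|/dep [a2 [b2 [b20 h2]]]] := pselect (independent_zhoms c w2).
  by exists w2.
have [|/eqP a20 /eqP a10] := ind (a2 * b1)%R (- (a1 * b2))%R.
  move=> h; have -> : (a2 * b1 * w1 h + - (a1 * b2) * w2 h =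
      a2 * (a1 * c h + b1 * w1 h) - a1 * (a2 * c h + b2 * w2 h))%R by ring.
  by rewrite h1 h2 !mulr0 subr0.
have a2_0 : a2 = 0%R by move: a20; rewrite mulf_eq0 (introF eqP b10) orbF => /eqP.
have [|_ /eqP] := ind 0%R b2; first by move=> h; have := h2 h; rewrite a2_0 !mul0r.
by move=> /eqP /b20.
Qed.

Lemma self_inverse_int (a b : int) : (a * b = 1)%R -> a = 1%R \/ a = (-1)%R.
Proof.
move=> /(congr1 absz); rewrite abszM => /eqP; rewrite muln_eq1 => /andP [/eqP + _].
by case: a => [[|[|n]]|[|n]] //= _; [left | right].
Qed.

Section EndGame.
Variables (G : groupType) (D : subgroup G) (w1 w2 : group_of D -> int).
Hypothesis Gg : tame G.
Hypothesis Dfi : finite_index D.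
Hypothesis DJ : forall x g, x isin D -> x ^ g isin D.
Hypothesis DC : forall x y, x isin D -> y isin D -> commute x y.
Hypothesis DZ : forall g, (forall x, x isin D -> commute g x) -> g isin D.
Hypothesis w1M : zhom w1.
Hypothesis w2M : zhom w2.
Hypothesis w12 : independent_zhoms w1 w2.

(** Let [chi] map [G] onto [Z]. By [kernel_injective] the kernel of [chi] on [D] is
    infinite cyclic, generated by some [y]. Conjugation sends [y] to [y] or to its
    inverse, and the elements that fix [y] belong to [D]: such a [g] sends [x] in
    [D] to [x y^e], and a power of [g] lies in [D], so [e = 0]. If [D] is [G], then
    [G] is [Z^2]. If [D] contains the kernel of [chi], then this kernel is generated
    by [y], and [G] is the Klein bottle group. Otherwise some [a] in the kernel of
    [chi] inverts [y]; it is an involution, as its square is a power of [y] that it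
    both fixes and inverts. The elements [y] and [a], with an element [z] of [D] that
    commutes with [a], then generate a finite index subgroup of the kind excluded by
    [no_dihedral_by_Z]. *)
Theorem isomorphic_ZxZ_or_klein : isomorphic G ZxZ \/ isomorphic G klein_bottle_group.
Proof.
have [_ Gd _] := Gg; have Dg := tame_sub Dfi Gg.
have [chi [t [chiM chi_t]]] : exists (chi : G -> int) t, zhom chi /\ chi t = 1%R.
  have [chi' chi'M nz] := deficient_zhom Gd.
  by have [d [chi [t [_ chiM chi_t _]]]] := zhom_primitive chi'M nz; exists chi, t.
have [M M0 MD] := finite_index_exponent Dfi.
have chiX m : chi (expgz t m) = m by rewrite zhom_expgz // chi_t mulrzz mul1r.
pose c (d : group_of D) := chi (val d); have cM : zhom c := zhom_val chiM.
pose d0 := to_group_of (MD t); have cd0 : c d0 = M%:Z.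
  by rewrite /c to_group_ofK zhomX // chi_t natz.
have [|w wM cw] := independent_with cM w1M w2M _ w12.
  by exists d0; rewrite cd0; move/eqP; rewrite eqz_nat eqn0Ngt M0.
have cw_inj := kernel_injective Dg cM wM cw.
have [W WE] := extend_group_of 0%R w.
have WE' g (gD : g isin D) : W g = w (to_group_of gD) by rewrite -WE to_group_ofK.
have WM g h : g isin D -> h isin D -> W (g * h) = (W g + W h)%R.
  move=> gD hD; rewrite !WE'; first exact: subgroupM.
  by move=> ghD; rewrite -wM; congr w; apply: val_inj; rewrite valM !to_group_ofK.
have cW_inj g : g isin D -> chi g = 0%R -> W g = 0%R -> g = 1.
  move=> gD chi0 W0; rewrite -[g](to_group_ofK gD) (cw_inj (to_group_of gD)) //.
  by rewrite -WE'.
pose Yset := [set g : G | g isin D /\ chi g = 0%R].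
have Y1 : Yset 1 by split; [exact: subgroup1 | rewrite zhom1].
have YM g h : Yset g -> Yset h -> Yset (g * h).
  by move=> [gD g0] [hD h0]; split; [exact: subgroupM | rewrite chiM g0 h0 addr0].
have YV g : Yset g -> Yset g^-1.
  by move=> [gD g0]; split; [exact: subgroupV | rewrite zhomV // g0 oppr0].
have [||y [yD chi_y] yY] := @expgz_generator G (Subgroup Y1 YM YV) W.
- by move=> g h [gD _] [hD _]; apply: WM.
- by move=> g [gD g0]; apply: cW_inj.
have y_gen g : g isin D -> chi g = 0%R -> exists e, g = expgz y e.
  by move=> gD g0; apply: yY.
have WX e : W (expgz y e) = (e * W y)%R.
  have yE : expgz y e = val (expgz (to_group_of yD) e).
    have Dval : {morph @group_val G D : u v / u * v} by move=> u v; apply: valM.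
    exact: esym (expgz_map (to_group_of yD) e Dval).
  by rewrite yE WE zhom_expgz // mulrC mulrzz (WE' y yD) mulrC.
have Wy : W y <> 0%R.
  move=> Wy; have Wker g : g isin D -> chi g = 0%R -> W g = 0%R.
    by move=> gD /(y_gen g gD) [e ->]; rewrite WX Wy mulr0.
    (* Otherwise [w] vanishes on the kernel of [c], so the two are proportional. *)
have [|_ /eqP] := cw (- w d0)%R (c d0).
    move=> g; pose h := expgz g (c d0) * expgz d0 (- c g).
    have h0 : w h = 0%R.
      rewrite -WE; apply: Wker; first exact: group_valP.
      rewrite -/(c h) /h cM !zhom_expgz // !mulrzz mulrN mulrC subrr //.
    by have := h0; rewrite /h wM !zhom_expgz // !mulrzz => <-; ring.
  by rewrite cd0 eqz_nat eqn0Ngt M0.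
have y_inj e e' : expgz y e = expgz y e' -> e = e'.
  move=> /(congr1 W); rewrite !WX; apply: mulIf; exact/eqP.
have y_free e : expgz y e = 1 -> e = 0%R by move=> e1; apply: (y_inj e 0%R).
have yD' e : expgz y e isin D.
  by case: e => n /=; [| apply: subgroupV]; apply: subgroupX.
have conjD x g : x isin D -> g * x * g^-1 isin D.
  by move=> xD; have := DJ g^-1 xD; rewrite /conjg invgK mulgA.
have chiJ x g : chi (g * x * g^-1) = chi x.
  by rewrite !chiM zhomV // addrAC subrr add0r.
have conjM g : {morph (fun x : G => g * x * g^-1) : u v / u * v}.
  by move=> u v; rewrite !mulgA mulgVK.
have invert g : g * y * g^-1 = y \/ g * y * g^-1 = y^-1.
  have [e eE] := y_gen _ (conjD y g yD) (etrans (chiJ y g) chi_y).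
  have [e' eE'] := y_gen _ (conjD y g^-1 yD) (etrans (chiJ y g^-1) chi_y).
  have [|e1|e1] := @self_inverse_int e e'.
  - apply: y_inj; rewrite -expgzM -eE -(expgz_map (f := fun x => g * x * g^-1)) //.
    by rewrite -eE' invgK !mulgA mulgV mul1g mulgK /= expg1.
  - by left; rewrite eE e1 /= expg1.
  by right; rewrite eE e1 /= expg1.
have centD g : g * y * g^-1 = y -> g isin D.
  move=> gy; have gyc : commute g y by rewrite /commute -[in RHS]gy mulgVK.
  apply: DZ => x xD.
  have [||e eE] := y_gen (g * x * g^-1 * x^-1).
  - by apply: subgroupM; [exact: conjD | exact: subgroupV].
  - by rewrite chiM chiJ zhomV // subrr.
  have gx : g * x = expgz y e * x * g by rewrite -eE !mulgVK.
  have gXx n : g ^+ n * x = expgz y (e * n%:Z) * x * g ^+ n.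
    elim: n => [|n IH]; first by rewrite mulr0 /= !expg0 !mul1g mulg1.
    rewrite expgS -mulgA IH !mulgA (commute_expgz (e * n%:Z) gyc).
    rewrite -(mulgA _ g x) gx !mulgA -expgzD.
    by congr (expgz y _ * _ * _ * _); rewrite intS mulrDr mulr1 addrC.
  have : expgz y (e * M%:Z) = 1.
    have := gXx M; rewrite (DC (MD g) xD) => /(mulIg _) xE.
    by apply: (mulIg x); rewrite mul1g -xE.
  move=> /y_free /eqP; rewrite mulf_eq0 eqz_nat [M == 0%N]eqn0Ngt M0 orbF => /eqP e0.
  by rewrite /commute gx e0 /= expg0 mul1g.
have notD g : ~ g isin D -> g * y * g^-1 = y^-1.
  by move=> gD; case: (invert g) => // /centD.
have notDM g h : ~ g isin D -> ~ h isin D -> g * h isin D.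
  move=> /notD gy /notD hy; apply: centD; rewrite invgM.
  have -> : g * h * y * (h^-1 * g^-1) = g * (h * y * h^-1) * g^-1 by rewrite !mulgA.
  by rewrite hy (morphVg (conjM g)) gy invgK.
have [allD|/existsNP [g0 g0D]] := pselect (forall g, g isin D).
  left; apply: (@direct_isomorphic G chi t y chiM chi_t chi_y _ y_free).
    by move=> g; apply: y_gen.
  exact: DC.
have [kerD|] := pselect (forall g, chi g = 0%R -> g isin D).
  right; apply: (@twisted_isomorphic G chi t y chiM chi_t chi_y _ y_free).
    by move=> g g0'; apply: y_gen => //; exact: kerD.
  apply: notD => tD; apply: g0D.
  rewrite -(mulgVK (expgz t (chi g0)) g0); apply: subgroupM.
    by apply: kerD; rewrite chiM zhomV // chiX subrr.
  by case: (chi g0) => n /=; [| apply: subgroupV]; apply: subgroupX.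
move=> /existsNP [a /not_implyP [chi_a aD]]; exfalso.
have ay := notD a aD.
have aa : a * a = 1.
  have [||e aae] := y_gen (a * a); first exact: notDM.
    by rewrite chiM chi_a addr0.
  have := expgz_twist e ay; rewrite -aae mulgA => /(mulIg a) aae'.
  suff e0 : e = 0%R by rewrite aae e0 /= expg0.
  have : e = (- e)%R by apply: y_inj; rewrite -aae.
  by lia.
have aV : a^-1 = a by rewrite -[RHS](mulKg a) aa mulg1.
pose d := t ^+ M; have dD : d isin D := MD t.
have chi_d : chi d = M%:Z by rewrite zhomX // chi_t natz.
(* The product over the orbit of [d] under the involution [a] commutes with [a]. *)
pose z := d * (a * d * a^-1).
have zD : z isin D by apply: subgroupM => //; exact: conjD.
have za : commute z a.
  apply/(mulIg a^-1); rewrite mulgK; apply/esym.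
  rewrite /z (conjM a) [X in _ * X](_ : _ = d); last by rewrite aV !mulgA aa mul1g -mulgA aa mulg1.
  by apply: DC => //; exact: conjD.
have chi_z : chi z = (M + M)%N%:Z by rewrite chiM chiJ chi_d.
have chi_z0 : chi z != 0%R by rewrite chi_z eqz_nat addn_eq0 andbb -lt0n.
pose Kset := [set g : G | (chi z %| chi g)%Z].
have K1 : Kset 1 by rewrite /Kset /= zhom1 // dvdz0.
have KM g h : Kset g -> Kset h -> Kset (g * h).
  by rewrite /Kset /= chiM => ? ?; rewrite rpredD.
have KV g : Kset g -> Kset g^-1 by rewrite /Kset /= zhomV // rpredN.
pose K := Subgroup K1 KM KV.
have Kfi : finite_index K.
  apply: (finite_indexI (c := fun g => inord (absz (chi g %% chi z)%Z) : 'I_(M + M).-1.+1)).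
  move=> g h ch; rewrite /= /Kset /= chiM zhomV // addrC -eqz_mod_dvd.
  have lt x : (absz (chi x %% chi z)%Z < (M + M).-1.+1)%N.
    rewrite prednK ?addn_gt0 ?M0 //; have := ltz_mod (chi x) chi_z0.
    by have := modz_ge0 (chi x) chi_z0; rewrite chi_z; lia.
  have := congr1 val ch; rewrite /= !inordK ?lt // => /eqP.
  rewrite -eqz_nat !gez0_abs ?modz_ge0 // eq_sym; done.
have zK : z isin K by exact: dvdzz.
have aK : a isin K by rewrite /= /Kset /= chi_a dvdz0.
have yK : y isin K by rewrite /= /Kset /= chi_y dvdz0.
pose eps (g : group_of K) : 'F_2 := if pselect (val g isin D) then 0%R else 1%R.
have eps0 g : val g isin D -> eps g = 0%R by rewrite /eps; case: pselect.
have eps1 g : ~ val g isin D -> eps g = 1%R by rewrite /eps; case: pselect.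
have valX (u : group_of K) e : val (expgz u e) = expgz (val u) e.
  have Kval : {morph @group_val G K : v v' / v * v'} by move=> v v'; apply: valM.
  exact: (expgz_map u e Kval).
apply: (@no_dihedral_by_Z (group_of K) eps (to_group_of zK) (to_group_of aK) (to_group_of yK)).
- exact: deficient_sub.
- move=> g h; have [gD|gD] := pselect (val g isin D).
    rewrite (eps0 g gD) add0r; have [hD|hD] := pselect (val h isin D).
      by rewrite !eps0 // valM; apply: subgroupM.
    rewrite !eps1 // valM => ghD; apply: hD; rewrite -(mulKg (val g) (val h)).
    by apply: subgroupM => //; apply: subgroupV.
  rewrite (eps1 g gD); have [hD|hD] := pselect (val h isin D).
    rewrite (eps0 h hD) addr0 eps1 // valM => ghD; apply: gD.
    by rewrite -(mulgK (val h) (val g)); apply: subgroupM => //; apply: subgroupV.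
  by rewrite (eps1 h hD) eps0; [apply/val_inj | rewrite valM; exact: notDM].
- by rewrite eps0 // to_group_ofK.
- by rewrite eps1 // to_group_ofK.
- by rewrite eps0 // to_group_ofK.
- by apply: val_inj; rewrite valM !to_group_ofK.
- apply: val_inj; rewrite !valM !to_group_ofK.
  by rewrite -mulgA (mulgA a y a) -[X in _ * (_ * X)]aV ay mulgV.
- by apply: val_inj; rewrite !valM !to_group_ofK.
move=> g; have /dvdzP [m mE] : (chi z %| chi (val g))%Z by exact: (group_valP g).
pose n := val g * (expgz z m)^-1.
have chi_n : chi n = 0%R.
  by rewrite chiM zhomV // zhom_expgz // mE mulrzz mulrC subrr.
have gE : val g = n * expgz z m by rewrite mulgVK.
have [nD|nD] := pselect (n isin D).
  have [e eE] := y_gen n nD chi_n; exists e, m; left; apply: val_inj.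
  by rewrite valM !valX !to_group_ofK gE eE.
have [||e eE] := y_gen (n * a); [exact: notDM | by rewrite chiM chi_n chi_a addr0 |].
exists e, m; right; apply: val_inj.
rewrite !valM !valX !to_group_ofK gE -eE; congr (_ * _).
by rewrite -[LHS]mulg1 -aa mulgA.
Qed.

End EndGame.

Theorem theorem3p3 (G : groupType) :
  LERF G ->
  has_deficiency G 1%R ->
  (exists H : subgroup G, finite_index H /\
     exists b : nat, first_betti (group_of H) b /\ (2 <= b)%N) ->
  large G \/ isomorphic G ZxZ \/ isomorphic G klein_bottle_group.
Proof.
move=> Gl /has_deficiency_deficient Gd Gb.
have [Gn|Gn] := pselect (large G); [by left | right].
have Gg : tame G by [].
have [D [w1 [w2 [[Dfi DJ DC DZ] [w1M w2M w12]]]]] := abelian_normal_finite_index Gg Gb.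
exact: (isomorphic_ZxZ_or_klein Gg Dfi DJ DC DZ w1M w2M w12).
Qed.
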